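(* Consider the Markov chain $\{(x_t,\Delta_t)\}_{t\ge0}$ on $\mathbb{R}^n\times\Omega_\Delta$ produced by Scheme P$(\beta,\varepsilon)$ (defined in the context, in particular with $K>\|A\|_\infty$). For every even $N\ge2$ this Markov chain is positive Harris recurrent. Therefore, for every even $N\ge 2$, it has a unique invariant probability measure $\pi_N$.
   Context: Norms: $\|x\|_\infty=\max_i|x^i|$ for $x\in\mathbb{R}^n$; $\|A\|_\infty=\max_i\sum_j|A_{ij}|$. System: $x_{t+1}=Ax_t+Bu_t+w_t$ in $\mathbb{R}^n$, $B\in\mathbb{R}^{n\times n}$ invertible, $A\in\mathbb{R}^{n\times n}$ a single real Jordan block with eigenvalue $\lambda$, $|\lambda|\ge1$: either $\lambda\in\mathbb{R}$ and $A$ has $\lambda$ on the diagonal, $1$ on the superdiagonal and $0$ elsewhere; or $\lambda=p+qi\in\mathbb{C}\setminus\mathbb{R}$, $n$ is even, and $A$ is block bidiagonal with $2\times2$ diagonal blocks $\begin{bmatrix}p&q\\-q&p\end{bmatrix}$ and $2\times 2$ identity blocks on the block superdiagonal. The noise $\{w_t\}$ is i.i.d., zero-mean, with a Lebesgue density $\eta$ positive everywhere on $\mathbb{R}^n$, and $E[\|w_0\|_\infty^\beta]<\infty$ for some $\beta>2$; $x_0$ is independent of $\{w_t\}$ with $E[\|x_0\|_\infty^\beta]<\infty$. Fix $\varepsilon\in(0,\beta-2)$. Quantizers: for even $M\ge2$ and $\Delta>0$ let $u_M^\Delta(y)=\Delta\lfloor y/\Delta\rfloor+\Delta/2$ for $y\in[-\frac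 M2\Delta,\frac M2\Delta)$ and $u_M^\Delta(\frac M2\Delta)=\frac M2\Delta-\frac\Delta2$. For $x\in\mathbb{R}^n$, $Q_M^\Delta(x)=(u_M^\Delta(x^i))_{i=1}^n$ if $\|x\|_\infty\le\frac M2\Delta$ and $Q_M^\Delta(x)=0$ otherwise; $U_M^\Delta(x)$ has $i$-th component $u_M^\Delta(x^i)$ if $|x^i|\le\frac M2\Delta$ and $0$ otherwise. Scheme P$(\beta,\varepsilon)$: fix parameters, independent of $N$: an even integer $K\ge2$ with $K>\|A\|_\infty$, reals $\alpha,\rho,L,\Delta_0$ with $\frac{\|A\|_\infty}{K}<\alpha<1$, $\rho>\|A\|_\infty$, $\rho\ge K\alpha$, $\rho>\|A\|_\infty^{\beta/\varepsilon}$, $L>0$, $\Delta_0\ge L$, and such that $\alpha^j\rho^k=1$ for some relatively prime integers $j,k\ge1$. For even $N\ge2$ let $\Delta_{(N)}=2N^{-1+\frac{2}{\beta-\varepsilon}}$ and $U_N:=U_N^{\Delta_{(N)}}$; it is required that $\alpha L>\frac{\|A\|_\infty}{K\alpha-\|A\|_\infty}\Delta_{(N)}$ for every even $N\ge2$. With $e_t=x_t-Q_K^{\Delta_t}(x_t)$, the control is $u_t=-B^{-1}A\big(Q_K^{\Delta_t}(x_t)+U_N(e_t)\big)$, so $x_{t+1}=A(e_t-U_N(e_t))+w_t$, and the bin size evolves as $\Delta_{t+1}=\rho\Delta_t$ if $\|x_t\|_\infty>\frac K2\Delta_t$; $\Delta_{t+1}=\alpha\Delta_t$ if $\|x_t\|_\infty\le\frac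 K2\Delta_t$ and $\Delta_t\ge L$; $\Delta_{t+1}=\Delta_t$ if $\|x_t\|_\infty\le\frac K2\Delta_t$ and $\Delta_t<L$. Bin-size state space: $\Omega_\Delta=\{\alpha^j\rho^k\Delta_0:j,k\in\mathbb{Z}_{\ge0}\}\cap[\alpha L,\infty)$. For each even $N$, $\{(x_t,\Delta_t)\}$ is a time-homogeneous Markov chain on $\mathbb{R}^n\times\Omega_\Delta$. Recurrence: for a Borel set $D$ let $\tau_D=\min\{t\ge1:\phi_t\in D\}$. For a $\sigma$-finite measure $\varphi$, a chain $\{\phi_t\}$ is $\varphi$-irreducible if $P_\phi(\tau_D<\infty)>0$ for every state $\phi$ and every Borel $D$ with $\varphi(D)>0$; a $\varphi$-irreducible chain is Harris recurrent if $P_\phi(\tau_D<\infty)=1$ for all such $\phi,D$; it is positive Harris recurrent if in addition it has an invariant probability measure. Here $\varphi$-irreducibility is with respect to some nonzero $\varphi$ (the paper uses the product of Lebesgue measure on $\mathbb{R}^n$ and counting measure on $\Omega_\Delta$). *)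

(* Defs.v *)
From HB Require Import structures.
From mathcomp Require Import all_boot all_order all_algebra finmap.
From mathcomp Require Import all_classical all_reals all_analysis.

Set Implicit Arguments.
Unset Strict Implicit.
Unset Printing Implicit Defensive.
Import Order.TTheory GRing.Theory Num.Theory.
Import numFieldNormedType.Exports.

Local Open Scope classical_set_scope.
Local Open Scope ring_scope.

(* The Borel sigma-algebra of R^n, presented (as for n.-tuple in the library)
   as the one generated by the coordinate maps. *)
Section cV_measurable.
Context {R : realType} {n : nat}.

Let coords : 'I_n -> 'cV[R]_n -> R := fun i x => x i 0.

Let cV_set0 : g_sigma_preimage coords set0.
Proof. exact: sigma_algebra0. Qed.

Let cV_setC A : g_sigma_preimage coords A -> g_sigma_preimage coords (~` A).
Proof. exact: sigma_algebraC. Qed.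

Let cV_bigcup (F : _^nat) : (forall i, g_sigma_preimage coords (F i)) ->
  g_sigma_preimage coords (\bigcup_i (F i)).
Proof. exact: sigma_algebra_bigcup. Qed.

HB.instance Definition _ := @isMeasurable.Build default_measure_display
  'cV[R]_n (g_sigma_preimage coords) cV_set0 cV_setC cV_bigcup.

Lemma measurable_coord (i : 'I_n) :
  measurable_fun [set: 'cV[R]_n] (fun x => x i 0).
Proof.
move=> _ Y mY; rewrite setTI; apply: sub_sigma_algebra => /=.
rewrite -bigcup_seq/=; exists i => /=; first by rewrite mem_index_enum.
by exists Y => //; rewrite setTI.
Qed.

Lemma measurable_fun_coordP d (T : measurableType d) (f : T -> 'cV[R]_n) :
  (forall i, measurable_fun [set: T] (fun t => f t i 0)) ->
  measurable_fun [set: T] f.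
Proof.
move=> mf _ A mA; rewrite setTI.
have : preimage_set_system setT f (g_sigma_preimage coords) (f @^-1` A).
  by exists A => //; rewrite setTI.
rewrite -g_sigma_preimage_comp => h.
apply: (smallest_sub _ _ h); first exact: sigma_algebra_measurable.
move=> B; rewrite -bigcup_seq/= => -[i _ [C mC <-]].
exact: (mf i _ C mC).
Qed.

End cV_measurable.

Section cV_lebesgue.
Context {R : realType}.

Definition cV_cons n (p : R * 'cV[R]_n) : 'cV[R]_n.+1 :=
  \col_i (if unlift ord0 i is Some j then p.2 j 0 else p.1).

Lemma measurable_cV_cons n : measurable_fun setT (@cV_cons n).
Proof.
apply: measurable_fun_coordP => i; rewrite /cV_cons.
under eq_fun do rewrite mxE.
case: unliftP => [j _|_]; last exact: measurable_fst.
exact: (measurableT_comp (measurable_coord j) measurable_snd).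
Qed.

HB.instance Definition _ n :=
  isMeasurableFun.Build _ _ _ _ (@cV_cons n) (@measurable_cV_cons n).

(* (lebesgue x mu) transported along R x R^n = R^(n+1) *)
Definition lebesgue_step n (mu : {measure set 'cV[R]_n -> \bar R}) :
    set 'cV[R]_n.+1 -> \bar R :=
  pushforward (lebesgue_measure \x^ mu)%E (@cV_cons n).

Section lebesgue_step_measure.
Variables (n : nat) (mu : {measure set 'cV[R]_n -> \bar R}).

Let step0 : lebesgue_step mu set0 = 0%E.
Proof. by rewrite /lebesgue_step /pushforward preimage_set0 measure0. Qed.

Let step_ge0 A : (0 <= lebesgue_step mu A)%E.
Proof. by rewrite /lebesgue_step /pushforward; apply: measure_ge0. Qed.

Let step_sigma_additive : semi_sigma_additive (lebesgue_step mu).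
Proof.
move=> F mF tF mUF; rewrite /lebesgue_step /pushforward preimage_bigcup.
have mpre k : measurable (@cV_cons n @^-1` F k).
  by rewrite -[X in measurable X]setTI; exact: measurable_cV_cons.
apply: measure_semi_sigma_additive => //.
- apply/trivIsetP => /= i j _ _ ij; rewrite -preimage_setI.
  by move/trivIsetP : tF => /(_ _ _ _ _ ij) ->//; rewrite preimage_set0.
- exact: bigcupT_measurable.
Qed.

HB.instance Definition _ := isMeasure.Build _ _ _ (lebesgue_step mu)
  step0 step_ge0 step_sigma_additive.

End lebesgue_step_measure.

(* Lebesgue measure on R^n *)
Fixpoint lebesgue_cV n : {measure set 'cV[R]_n -> \bar R} :=
  match n with
  | 0 => \d_(0 : 'cV[R]_0)
  | n'.+1 => lebesgue_step (lebesgue_cV n')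
  end.

Lemma lebesgue_cV_box n (A : 'I_n -> set R) : (forall i, measurable (A i)) ->
  lebesgue_cV n [set x | forall i, A i (x i 0)] =
  (\prod_(i < n) lebesgue_measure (A i))%E.
Proof.
elim: n A => [|n IH] A mA.
  by rewrite big_ord0 /= diracE mem_set// => -[].
pose B := [set x : 'cV[R]_n | forall i : 'I_n, A (lift ord0 i) (x i 0)].
have mB : measurable B.
  rewrite (_ : B = \bigcap_(i in [set: 'I_n])
      ((fun x : 'cV[R]_n => x i 0) @^-1` A (lift ord0 i))).
    apply: fin_bigcap_measurable => // i _.
    by rewrite -[X in measurable X]setTI; exact: measurable_coord.
  by apply/seteqP; split => x /= h i => [_|]; exact: h.
have -> : lebesgue_cV n.+1 [set x | forall i, A i (x i 0)] =
    (lebesgue_measure \x^ lebesgue_cV n)%E (A ord0 `*` B).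
  rewrite /= /lebesgue_step /pushforward.
  rewrite (_ : _ @^-1` _ = A ord0 `*` B)//; apply/seteqP; split => -[r x] /=.
    move=> h; split; first by have := h ord0; rewrite mxE unlift_none.
    by move=> i; have := h (lift ord0 i); rewrite mxE liftK.
  by move=> [h0 h] i; rewrite mxE; case: unliftP => [j ->|->] //; exact: h.
rewrite big_ord_recl -(IH (fun i => A (lift ord0 i)))//.
exact: (@product_measure2E _ _ _ _ _ lebesgue_measure (lebesgue_cV n)
         _ _ (mA ord0) mB).
Qed.

End cV_lebesgue.

Section jordan_blocks.
Context {R : realType} {n : nat}.

Definition jordan_block_real (lambda : R) : 'M[R]_n :=
  \matrix_(i, j) (if j == i :> nat then lambda
                  else if j == i.+1 :> nat then 1 else 0).

(* for n even: rows and columns 2k, 2k+1 form the k-th 2x2 block *)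
Definition jordan_block_complex (p q : R) : 'M[R]_n :=
  \matrix_(i, j)
    (if j./2 == i./2 then
       (if odd i == odd j then p else if odd i then - q else q)
     else if (j./2 == (i./2).+1) && (odd i == odd j) then 1 else 0).

Definition unstable_jordan_block (A : 'M[R]_n) : Prop :=
  (exists lambda : R, 1 <= `|lambda| /\ A = jordan_block_real lambda) \/
  (exists p q : R, [/\ q != 0, 1 <= Num.sqrt (p ^+ 2 + q ^+ 2), ~~ odd n &
     A = jordan_block_complex p q]).

(* the operator norm for the sup norm; on 'cV[R]_n the library norm `|x| is
   already the sup norm *)
Definition opnorm (A : 'M[R]_n) : R :=
  \big[Num.max/0]_(i < n) \sum_(j < n) `|A i j|.

End jordan_blocks.

Section quantizers.
Context {R : realType}.

(* only meaningful for `|y| <= M / 2 * D, the only place where it is used *)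
Definition quantizer (M : nat) (D y : R) : R :=
  if y == M%:R / 2 * D then M%:R / 2 * D - D / 2
  else D * (Num.floor (y / D))%:~R + D / 2.

Definition quantizerQ n (M : nat) (D : R) (x : 'cV[R]_n) : 'cV[R]_n :=
  if `|x| <= M%:R / 2 * D then \col_i quantizer M D (x i 0) else 0.

Definition quantizerU n (M : nat) (D : R) (x : 'cV[R]_n) : 'cV[R]_n :=
  \col_i (if `|x i 0| <= M%:R / 2 * D then quantizer M D (x i 0) else 0).

End quantizers.

Section scheme.
Context {R : realType} {n : nat}.
Variables (A B : 'M[R]_n) (beta eps : R).
Variables (K : nat) (alpha rho L Delta0 : R).

Definition fine_bin (N : nat) : R := 2 * N%:R `^ (- 1 + 2 / (beta - eps)).

Record scheme_parameters : Prop := SchemeParameters {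
  K_even : ~~ odd K ;
  K_ge2 : (2 <= K)%N ;
  K_gt_norm : opnorm A < K%:R ;
  alpha_gt : opnorm A / K%:R < alpha ;
  alpha_lt1 : alpha < 1 ;
  rho_gt_norm : opnorm A < rho ;
  rho_ge : K%:R * alpha <= rho ;
  rho_gt_pow : opnorm A `^ (beta / eps) < rho ;
  L_gt0 : 0 < L ;
  Delta0_ge : L <= Delta0 ;
  alpha_rho_rel : exists j k : nat,
    [/\ (1 <= j)%N, (1 <= k)%N, coprime j k & alpha ^+ j * rho ^+ k = 1] ;
  alphaL_gt : forall N : nat, ~~ odd N -> (2 <= N)%N ->
    opnorm A / (K%:R * alpha - opnorm A) * fine_bin N < alpha * L }.

Definition control (N : nat) (x : 'cV[R]_n) (Delta : R) : 'cV[R]_n :=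
  let e := x - quantizerQ K Delta x in
  - (invmx B *m A *m (quantizerQ K Delta x + quantizerU N (fine_bin N) e)).

Definition next_bin (x : 'cV[R]_n) (Delta : R) : R :=
  if K%:R / 2 * Delta < `|x| then rho * Delta
  else if L <= Delta then alpha * Delta else Delta.

Definition scheme_step (N : nat) (z : 'cV[R]_n * R) (w : 'cV[R]_n) :
    'cV[R]_n * R :=
  (A *m z.1 + B *m control N z.1 z.2 + w, next_bin z.1 z.2).

Definition bin_sizes : set R :=
  [set D | (exists j k : nat, D = alpha ^+ j * rho ^+ k * Delta0) /\
           alpha * L <= D].

(* R^n x Omega_Delta, as a Borel subset of R^n x R *)
Definition state_space : set ('cV[R]_n * R) := [set z | bin_sizes z.2].

(* (x_t, Delta_t) when (x_0, Delta_0) = z and the noise is w *)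
Fixpoint scheme_chain (T : Type) (w : nat -> T -> 'cV[R]_n) (N : nat)
    (z : 'cV[R]_n * R) (t : nat) (omega : T) : 'cV[R]_n * R :=
  match t with
  | 0 => z
  | t'.+1 => scheme_step N (scheme_chain w N z t' omega) (w t' omega)
  end.

End scheme.

Section independence.
Context {dS dT : measure_display} {S : measurableType dS}
  {T : measurableType dT} {R : realType} (P : probability T R).

Definition mutually_independent (w : nat -> T -> S) : Prop :=
  forall (J : {fset nat}) (D : nat -> set S), (forall t, measurable (D t)) ->
  P (\bigcap_(t in [set` J]) (w t @^-1` D t)) =
  (\prod_(t <- J) P (w t @^-1` D t))%E.

Definition identically_distributed (w : nat -> T -> S) : Prop :=
  forall t (D : set S), measurable D -> P (w t @^-1` D) = P (w 0%N @^-1` D).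

Definition sigma_of (w : nat -> T -> S) : set (set T) :=
  <<s \bigcup_t preimage_set_system setT (w t) measurable >>.

Definition independent_of_sequence (x : T -> S) (w : nat -> T -> S) : Prop :=
  forall (D : set S) (F : set T), measurable D -> sigma_of w F ->
  P (x @^-1` D `&` F) = (P (x @^-1` D) * P F)%E.

End independence.

(* X s t omega is the position at time t of a time-homogeneous Markov chain
   started at s, for every s on the same probability space (T, P): P_s(.) is
   the law under P of X s, and s, D |-> P (X s 1 @^-1` D) is the transition
   kernel.  The state space of the chain is the Borel subset E of S; measures
   on E are measures on S vanishing outside E. *)
Section recurrence.
Context {dS dT : measure_display} {S : measurableType dS}
  {T : measurableType dT} {R : realType} (P : probability T R).
Variables (E : set S) (X : S -> nat -> T -> S).

(* +oo if D is never reached after time 0 *)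
Definition return_time (D : set S) (z : nat -> S) : \bar R :=
  ereal_inf [set t%:R%:E | t in [set t : nat | (1 <= t)%N /\ D (z t)]].

Definition return_prob (s : S) (D : set S) : \bar R :=
  P [set omega | return_time D (X s ^~ omega) < +oo]%E.

Definition irreducible (phi : set S -> \bar R) : Prop :=
  forall s (D : set S), E s -> measurable D -> D `<=` E -> (0 < phi D)%E ->
  (0 < return_prob s D)%E.

Definition harris_recurrent (phi : set S -> \bar R) : Prop :=
  irreducible phi /\
  forall s (D : set S), E s -> measurable D -> D `<=` E -> (0 < phi D)%E ->
  return_prob s D = 1%E.

Definition invariant_probability (pi : probability S R) : Prop :=
  pi (~` E) = 0%E /\
  forall D : set S, measurable D -> D `<=` E ->
  (\int[pi]_(s in E) P (X s 1%N @^-1` D))%E = pi D.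

Definition positive_harris_recurrent : Prop :=
  exists phi : {sigma_finite_measure set S -> \bar R},
    [/\ phi (~` E) = 0%E, phi E != 0%E, harris_recurrent phi &
        exists pi : probability S R, invariant_probability pi].

Definition unique_invariant_probability : Prop :=
  exists2 pi : probability S R, invariant_probability pi &
    forall pi' : probability S R, invariant_probability pi' ->
    forall D : set S, measurable D -> pi' D = pi D.

End recurrence.

(* Main.v *)
(* With y = 2 |x| / K, overflow means Delta < y, and the function
     V = k ln (Delta / (alpha L)) + 1_{Delta < y} (c0 + c ln (y / Delta))
   drifts down in one step: on granular steps ln Delta decreases, while on
   overflow steps the decrease of ln (y / Delta), at rate about
   ln (rho / max (|A|, 1)) > 0, outweighs the growth of Delta.  Since V is
   logarithmic, the noise enters only through E |w_0|, and
   P V + 1 <= V + b 1_C with C bounded in x and Delta.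

   C is small for a power of the kernel.  After one step from C the law of x is
   absolutely continuous uniformly in the starting point, and from any state
   some pattern of overflows and contractions, of a length common to all bin
   sizes reachable from C, leads to one fixed bin size below L (this uses
   alpha^j rho^k = 1), each step having positive probability as eta > 0.  A
   strictly positive, jointly measurable density is bounded below by a constant
   off a set of small measure; hence P^m (s, .) >= dl nu for s in C.

   Drift and minorization give the conclusions directly.  The operator killed
   at a set D with nu D > 0 satisfies n a P_D^n 1 <= a V + b m, so D is reached
   almost surely.  The chain making m steps at once on C has as invariant measure
   the sum over k of its laws at time k, started from nu and killed at
   regeneration; spreading the mass on C over the skipped steps gives an
   invariant measure for P.  If two invariant probabilities differed, both parts of
   the Hahn-Jordan decomposition of their difference would be invariant and
   nonzero, hence would charge C and dominate a multiple of nu, although they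
   are carried by disjoint sets. *)

Require Import Defs.
From HB Require Import structures.
From mathcomp Require Import all_boot all_order all_algebra finmap.
From mathcomp Require Import all_classical all_reals all_analysis.
From mathcomp Require Import measurable_realfun ring lra.

Set Implicit Arguments.
Unset Strict Implicit.
Unset Printing Implicit Defensive.
Import Order.TTheory GRing.Theory Num.Theory.
Import numFieldNormedType.Exports.

Local Open Scope classical_set_scope.
Local Open Scope ring_scope.

(** * Markov operators *)

(** The drift inequality speaks of one step, the minorization of [m.+1] steps, and this mismatch
    shapes the abstract half: for killed chains [V] receives a correction summing [m.+1] non-return
    probabilities, and for the invariant measure the chain is made to jump on [C]. No split chain is
    built: a regeneration is the removal of a multiple of [nu] from a finite measure, so that the
    total mass left records the probability of not having regenerated. [V] is [+oo] exactly off the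
    state space. All inequalities then hold on the whole ambient type, and being in the state space
    becomes finiteness of [V]. Under an arbitrary invariant probability [V] is not known to be
    integrable, hence the truncations in the uniqueness part. In the concrete half the obstacle is a
    path length common to all starting bins. A bin below [L] stays unchanged while there is no
    overflow, so a target bin chosen below [L] can be held for any number of steps, and finitely
    many paths can be padded to the longest one. The next bin is a function of the current state
    alone; the noise acts only on the vector component. *)

Section measure_lemmas.
Local Open Scope ereal_scope.
Context d (S : measurableType d) (R : realType).

Lemma ge0_integral_mrestr (l : {measure set S -> \bar R}) (C : set S)
    (mC : measurable C) (g : S -> \bar R) :
  measurable_fun setT g -> (forall x, 0 <= g x) ->
  \int[mrestr l mC]_x g x = \int[l]_(x in C) g x.
Proof.
move=> mg g0; rewrite (@ge0_negligible_integral _ _ _ _ setT (~` C))//.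
- rewrite setTD setCK; apply: eq_measure_integral => A mA AC.
  by rewrite /= /mrestr setIidl.
- exact: measurableC.
- by rewrite /= /mrestr setICl measure0.
Qed.

(** The difference is formed among charges, where it always exists; its nonnegativity turns it back
    into a measure. It serves to remove the regenerated mass. *)
Lemma measure_subtraction (l1 l2 : {finite_measure set S -> \bar R}) :
  (forall D, measurable D -> l1 D <= l2 D) ->
  exists l3 : {finite_measure set S -> \bar R},
    forall D, measurable D -> l2 D = l1 D + l3 D.
Proof.
move=> l12.
pose c := cadd (charge_of_finite_measure l2) (copp (charge_of_finite_measure l1)).
have c0 E : 0 <= crestr0 c (measurableT : measurable [set: S]) E.
  rewrite /crestr0; case: ifPn => // /[1!inE] mE.
  by rewrite /crestr setIT /c /cadd /copp/= sube_ge0 ?l12// fin_num_measure.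
pose l : {measure set S -> \bar R} := measure_of_charge _ c0.
have lE D : measurable D -> l D = l2 D - l1 D.
  move=> mD; rewrite /l /= /measure_of_charge /crestr0 mem_set// /crestr setIT.
  by [].
have lfin : l setT < +oo.
  rewrite lE// ltey_eq; apply/orP; left.
  by rewrite fin_numB !fin_num_measure.
exists (mfrestr measurableT lfin) => D mD.
rewrite /= /mfrestr /mrestr setIT [X in _ = _ + X](_ : _ = l2 D - l1 D)//.
  by rewrite addeC subeK// fin_num_measure.
exact: lE.
Qed.

End measure_lemmas.

Section markov_operator.
Local Open Scope ereal_scope.
Context d d' (S : measurableType d) (W : measurableType d') (R : realType).
Variables (mu : probability W R) (F : S * W -> S)
  (mF : measurable_fun setT F).

Definition markov_op (g : S -> \bar R) (s : S) : \bar R :=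
  \int[mu]_w g (F (s, w)).

Local Notation Pop := markov_op.

Lemma markov_op_ge0 g : (forall x, 0 <= g x) -> forall s, 0 <= Pop g s.
Proof. by move=> g0 s; exact: integral_ge0. Qed.

Let measurable_FX s : measurable_fun setT (fun w => F (s, w)).
Proof. by apply: measurableT_comp => //; exact: measurable_pair1. Qed.

Lemma measurable_markov_op (g : S -> \bar R) : measurable_fun setT g ->
  (forall x, 0 <= g x) -> measurable_fun setT (Pop g).
Proof.
move=> mg g0.
have mgF : measurable_fun setT (g \o F) by exact: measurableT_comp.
exact: (measurable_fun_fubini_tonelli_F (m2 := mu) (g \o F) mgF (fun=> g0 _)).
Qed.

Let mgF (g : S -> \bar R) s : measurable_fun setT g ->
  measurable_fun setT (fun w => g (F (s, w))).
Proof. by move=> mg; exact: (measurableT_comp mg (measurable_FX s)). Qed.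

Lemma le_markov_op (f g : S -> \bar R) : measurable_fun setT f -> measurable_fun setT g ->
  (forall x, 0 <= f x) -> (forall x, f x <= g x) ->
  forall s, Pop f s <= Pop g s.
Proof.
move=> mf mg f0 fg s; apply: ge0_le_integral => //; exact: mgF.
Qed.

Lemma markov_opD (f g : S -> \bar R) : measurable_fun setT f -> measurable_fun setT g ->
  (forall x, 0 <= f x) -> (forall x, 0 <= g x) ->
  forall s, Pop (fun x => f x + g x) s = Pop f s + Pop g s.
Proof.
by move=> mf mg f0 g0 s; rewrite /markov_op ge0_integralD//; exact: mgF.
Qed.

Lemma markov_opZ (k : R) (f : S -> \bar R) : (0 <= k)%R -> measurable_fun setT f ->
  (forall x, 0 <= f x) ->
  forall s, Pop (fun x => k%:E * f x) s = k%:E * Pop f s.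
Proof.
by move=> k0 mf f0 s; rewrite /markov_op ge0_integralZl_EFin//; exact: mgF.
Qed.

Lemma markov_op_cst k s : Pop (cst k) s = k.
Proof.
rewrite /markov_op [LHS](integral_cst mu measurableT).
by rewrite [X in k * X](probability_setT mu) mule1.

Qed.

Lemma markov_op_sum n (f : nat -> S -> \bar R) :
  (forall i, measurable_fun setT (f i)) -> (forall i x, 0 <= f i x) ->
  forall s, Pop (fun x => \sum_(i < n) f i x) s = \sum_(i < n) Pop (f i) s.
Proof.
by move=> mf f0 s; rewrite /markov_op ge0_integral_sum// => i; exact: mgF.
Qed.

Section iterates.
Variables (g : S -> \bar R) (mg : measurable_fun setT g).
Hypothesis g0 : forall x, 0 <= g x.

Lemma iter_markov_op_ge0 k s : 0 <= iter k Pop g s.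
Proof. by case: k => [//|k /=]; apply: integral_ge0 => w _; elim: k s w => [//|k IH] s w /=; exact: integral_ge0. Qed.

Lemma measurable_iter_markov_op k : measurable_fun setT (iter k Pop g).
Proof.
by elim: k => [//|k IH] /=; apply: measurable_markov_op => // ?;
  exact: iter_markov_op_ge0.
Qed.

End iterates.

Section push_measure.
Variable l : {finite_measure set S -> \bar R}.

Let pm : {measure set S -> \bar R} :=
  measure_function_pushforward__canonical__measure_function_Measure (l \x mu) mF.

Let pmT : pm setT = l setT.
Proof.
rewrite /pm /= /pushforward preimage_setT -setXTT.
by rewrite product_measure1E// [X in _ * X](probability_setT mu) mule1.
Qed.

Let pm_lty : pm setT < +oo.
Proof. by rewrite pmT -ge0_fin_numE// fin_num_measure. Qed.

(** The left action [l -> l P] of the kernel, dual to [markov_op]. Here as below, restriction to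
    [setT] by [mfrestr] only attaches the finite-measure structure. *)
Definition push_measure : {finite_measure set S -> \bar R} :=
  mfrestr measurableT pm_lty.

Lemma integral_push_measure (g : S -> \bar R) :
  measurable_fun setT g -> (forall x, 0 <= g x) ->
  \int[push_measure]_x g x = \int[l]_x Pop g x.
Proof.
move=> mg g0; transitivity (\int[pm]_x g x).
  by apply: eq_measure_integral => A mA _; rewrite /= /mfrestr /mrestr setIT.
rewrite (ge0_integral_pushforward _ (l \x mu))//.
rewrite preimage_setT fubini_tonelli1//; first exact: measurableT_comp.
by move=> x; exact: g0.
Qed.

End push_measure.

Lemma integral_iter_push k (l : {finite_measure set S -> \bar R}) (g : S -> \bar R) :
  measurable_fun setT g -> (forall x, 0 <= g x) ->
  \int[iter k push_measure l]_x g x = \int[l]_x iter k Pop g x.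
Proof.
elim: k g => [//|k IH] g mg g0.
rewrite iterS integral_push_measure// IH; last exact: markov_op_ge0.
  by under [RHS]eq_integral do rewrite iterSr.
exact: measurable_markov_op.
Qed.

End markov_operator.

(** * Probability of not yet having reached a set *)

Section killed_operator.
Local Open Scope ereal_scope.
Context d d' (S : measurableType d) (W : measurableType d') (R : realType).
Variables (mu : probability W R) (F : S * W -> S)
  (mF : measurable_fun setT F).

Local Notation Pop := (markov_op mu F).
Local Notation ind A := (fun x : S => (\1_A x)%:E : \bar R).

Lemma measurable_eindic (A : set S) : measurable A ->
  measurable_fun setT (ind A).
Proof. by move=> mA; apply/measurable_EFinP; exact: measurable_indic. Qed.

Lemma eindic_ge0 (A : set S) x : 0 <= ind A x.
Proof. by rewrite lee_fin indicE ler0n. Qed.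

Lemma eindic_le1 (A : set S) x : ind A x <= 1.
Proof. by rewrite lee_fin indicE lern1 leq_b1. Qed.

(** The [k]-th iterate on [cst 1] is the probability of being outside [D] at times 1 to [k]. The
    starting point is not tested, in accordance with return times that begin at 1. *)
Definition killed_op (D : set S) (g : S -> \bar R) : S -> \bar R :=
  Pop (fun x => (\1_(~` D) x)%:E * g x).

Lemma iter_markov_op_cst k s : iter k Pop (cst 1) s = 1.
Proof.
elim: k s => // k IH s; rewrite iterS (_ : iter k Pop (cst 1) = cst 1).
  exact: markov_op_cst.
exact/funext.
Qed.

Lemma iter_markov_opD (f g : S -> \bar R) k :
  measurable_fun setT f -> measurable_fun setT g ->
  (forall x, 0 <= f x) -> (forall x, 0 <= g x) ->
  forall s, iter k Pop (fun x => f x + g x) s = iter k Pop f s + iter k Pop g s.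
Proof.
move=> mf mg f0 g0; elim: k => // k IH s.
rewrite iterS (_ : iter k Pop _ = fun x => iter k Pop f x + iter k Pop g x).
  rewrite markov_opD//; try exact: measurable_iter_markov_op.
  - exact: iter_markov_op_ge0.
  - exact: iter_markov_op_ge0.
exact/funext.
Qed.

Section killed.
Variables (D : set S) (mD : measurable D).
Local Notation T := (killed_op D).
Local Notation u := (fun k => iter k T (cst 1)).

Let kill_ge0 (g : S -> \bar R) : (forall x, 0 <= g x) ->
  forall x, 0 <= (\1_(~` D) x)%:E * g x.
Proof. by move=> g0 x; rewrite mule_ge0//; exact: eindic_ge0. Qed.

Let kill_le (g : S -> \bar R) : (forall x, 0 <= g x) ->
  forall x, (\1_(~` D) x)%:E * g x <= g x.
Proof.
move=> g0 x; rewrite -[leRHS]mul1e; apply: lee_wpmul2r => //.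
exact: eindic_le1.
Qed.

Let measurable_kill (g : S -> \bar R) : measurable_fun setT g ->
  measurable_fun setT (fun x => (\1_(~` D) x)%:E * g x).
Proof.
move=> mg; apply: emeasurable_funM => //; apply: measurable_eindic.
exact: measurableC.
Qed.

Lemma killed_op_ge0 (g : S -> \bar R) : (forall x, 0 <= g x) ->
  forall s, 0 <= T g s.
Proof. by move=> g0; apply: markov_op_ge0; exact: kill_ge0. Qed.

Lemma measurable_killed_op (g : S -> \bar R) : measurable_fun setT g ->
  (forall x, 0 <= g x) -> measurable_fun setT (T g).
Proof.
by move=> mg g0; apply: measurable_markov_op => //;
  [exact: measurable_kill|exact: kill_ge0].
Qed.

Lemma le_killed_op (f g : S -> \bar R) :
  measurable_fun setT f -> measurable_fun setT g ->
  (forall x, 0 <= f x) -> (forall x, f x <= g x) ->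
  forall s, T f s <= T g s.
Proof.
move=> mf mg f0 fg; apply: le_markov_op => //; try exact: measurable_kill.
- exact: kill_ge0.
- by move=> x; apply: lee_wpmul2l => //; exact: eindic_ge0.
Qed.

Lemma killed_op_le (g : S -> \bar R) : measurable_fun setT g ->
  (forall x, 0 <= g x) -> forall s, T g s <= Pop g s.
Proof.
by move=> mg g0; apply: le_markov_op => //;
  [exact: measurable_kill|exact: kill_ge0|exact: kill_le].
Qed.

Lemma killed_opD (f g : S -> \bar R) :
  measurable_fun setT f -> measurable_fun setT g ->
  (forall x, 0 <= f x) -> (forall x, 0 <= g x) ->
  forall s, T (fun x => f x + g x) s = T f s + T g s.
Proof.
move=> mf mg f0 g0 s; rewrite /killed_op -markov_opD//; first last.
- exact: kill_ge0.
- exact: kill_ge0.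
- exact: measurable_kill.
- exact: measurable_kill.
- by apply: eq_integral => w _; rewrite ge0_muleDr.
Qed.

Lemma killed_opZ (k : R) (f : S -> \bar R) : (0 <= k)%R ->
  measurable_fun setT f -> (forall x, 0 <= f x) ->
  forall s, T (fun x => k%:E * f x) s = k%:E * T f s.
Proof.
move=> k0 mf f0 s; rewrite /killed_op -markov_opZ//; first last.
- exact: kill_ge0.
- exact: measurable_kill.
- by apply: eq_integral => w _; rewrite muleCA.
Qed.

Lemma iter_killed_ge0 k s : 0 <= u k s.
Proof. by elim: k s => [s|k IH s] /=; [exact: lee01|exact: killed_op_ge0]. Qed.

Lemma measurable_iter_killed k : measurable_fun setT (u k).
Proof.
elim: k => [|k IH] /=; first exact: measurable_cst.
by apply: measurable_killed_op => // x; exact: iter_killed_ge0.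
Qed.

Lemma iter_killed_nonincreasing k s : u k.+1 s <= u k s.
Proof.
elim: k s => [s|k IH s].
  rewrite /= /killed_op -[leRHS](markov_op_cst mu F 1 s).
  apply: le_markov_op => //.
  - by apply: measurable_kill; exact: measurable_cst.
  - by apply: kill_ge0 => x; exact: lee01.
  - by apply: kill_le => x; exact: lee01.
rewrite [in leLHS]iterS [in leRHS]iterS; apply: le_killed_op => //.
- exact: measurable_iter_killed.
- exact: measurable_iter_killed.
- by move=> x; exact: iter_killed_ge0.
Qed.

Lemma iter_killed_le1 k s : u k s <= 1.
Proof.
elim: k s => [//|k IH s].
exact: (le_trans (iter_killed_nonincreasing k s)).
Qed.

(** All visits but the last are forgotten: this is the form in which a lower bound on the
    [k.+1]-step kernel alone can be used. *)
Lemma iter_killed_le k s : u k.+1 s <= iter k.+1 Pop (ind (~` D)) s.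
Proof.
have mDC := measurable_eindic (measurableC mD).
elim: k s => [s|k IH s].
  rewrite /= /killed_op; apply: le_markov_op => //.
  - by apply: measurable_kill; exact: measurable_cst.
  - by apply: kill_ge0 => x; exact: lee01.
  - by move=> x; rewrite mule1.
rewrite [in leLHS]iterS.
apply: (@le_trans _ _ (Pop (u k.+1) s)).
  by apply: killed_op_le; [exact: measurable_iter_killed|exact: iter_killed_ge0].
rewrite [in leRHS]iterS; apply: le_markov_op => //.
- exact: measurable_iter_killed.
- by apply: measurable_iter_markov_op => // x; exact: eindic_ge0.
- by move=> x; exact: iter_killed_ge0.
Qed.

Lemma iter_markov_op_indicC k s :
  iter k Pop (ind (~` D)) s + iter k Pop (ind D) s = 1.
Proof.
rewrite -iter_markov_opD; last first.
- exact: eindic_ge0.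
- exact: eindic_ge0.
- exact: measurable_eindic.
- by apply: measurable_eindic; exact: measurableC.
rewrite -[RHS](iter_markov_op_cst k s); congr (iter _ _ _ _).
apply/funext => x; rewrite /= -EFinD !indicE in_setC.
by case: (x \in D); rewrite ?addr0 ?add0r.
Qed.

Section drift.
Variables (V : S -> \bar R) (C : set S) (b a : R) (m : nat).
Hypothesis mV : measurable_fun setT V.
Hypothesis V0 : forall x, 0 <= V x.
Hypothesis mC : measurable C.
Hypothesis b0 : (0 <= b)%R.
Hypothesis drift : forall s, Pop V s + 1 <= V s + (b * \1_C s)%:E.
Hypothesis a0 : (0 <= a)%R.
Hypothesis aD : forall s, C s -> a%:E <= iter m.+1 Pop (ind D) s.

(** The sum telescopes under the killed operator, [T Y = Y - 1 + u m.+1], and [u m.+1 <= 1 - a] on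
    [C]. So the gain [a], which [C] yields only after [m.+1] steps, becomes a one-step decrease of
    [Y]. *)
Let Y s := \sum_(i < m.+1) u i s.

Let Y0 s : 0 <= Y s.
Proof. by apply: sume_ge0 => i _; exact: iter_killed_ge0. Qed.

Let mY : measurable_fun setT Y.
Proof.
by apply: emeasurable_sum => i; exact: measurable_iter_killed.
Qed.

Let iter_killed_C s : u m.+1 s + (a * \1_C s)%:E <= 1.
Proof.
rewrite indicE; have [/set_mem Cs|_] := boolP (s \in C); last first.
  by rewrite mulr0 adde0; exact: iter_killed_le1.
rewrite mulr1 -[leRHS](iter_markov_op_indicC m.+1 s).
by apply: leeD; [exact: iter_killed_le|exact: aD].
Qed.

Let TsumE n s : T (fun s => \sum_(i < n) u i s) s = \sum_(i < n) u i.+1 s.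
Proof.
elim: n s => [s|n IH s].
  rewrite big_ord0 /killed_op /markov_op integral0_eq// => w _.
  by rewrite big_ord0 mule0.
rewrite big_ord_recr /= -IH -killed_opD//.
- by congr (T _ s); apply/funext => x; rewrite big_ord_recr.
- by apply: emeasurable_sum => i; exact: measurable_iter_killed.
- exact: measurable_iter_killed.
- by move=> x; apply: sume_ge0 => i _; exact: iter_killed_ge0.
- by move=> x; exact: iter_killed_ge0.
Qed.

Let TY s : T Y s + (a * \1_C s)%:E <= Y s.
Proof.
rewrite -(@leeD2rE _ 1)// addeAC /Y TsumE.
have -> : \sum_(i < m.+1) u i.+1 s + 1 = Y s + u m.+1 s.
  transitivity (\sum_(i < m.+2) u i s); last by rewrite big_ord_recr.
  by rewrite [RHS]big_ord_recl addeC.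
by rewrite -addeA leeD2l.
Qed.

(** The weights make the terms on [C] cancel: there [V] may grow at rate [b] while [Y] loses [a].
    What remains is a decrease by [a] at every point. *)
Let U s := a%:E * V s + b%:E * Y s.

Let U0 s : 0 <= U s.
Proof. by rewrite /U adde_ge0// mule_ge0. Qed.

Let mU : measurable_fun setT U.
Proof.
by apply: emeasurable_funD; apply: emeasurable_funM => //; exact: measurable_cst.
Qed.

Let TU s : T U s + a%:E <= U s.
Proof.
rewrite /U killed_opD; last first.
- by move=> x; rewrite mule_ge0.
- by move=> x; rewrite mule_ge0.
- by apply: emeasurable_funM => //; exact: measurable_cst.
- by apply: emeasurable_funM => //; exact: measurable_cst.
rewrite !killed_opZ// addeAC.
apply: (@le_trans _ _ (a%:E * (Pop V s + 1) + b%:E * T Y s)).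
  rewrite (ge0_muleDr _ (markov_op_ge0 mu F V0 s) (@lee01 R)).
  by rewrite mule1 !leeD2r// lee_wpmul2l// killed_op_le.
apply: (@le_trans _ _ (a%:E * (V s + (b * \1_C s)%:E) + b%:E * T Y s)).
  by rewrite leeD2r// lee_wpmul2l.
rewrite ge0_muleDr//; last by rewrite lee_fin mulr_ge0// indicE ler0n.
rewrite -addeA leeD2l// -EFinM mulrCA EFinM -ge0_muleDr.
- by rewrite lee_wpmul2l// addeC TY.
- by rewrite lee_fin mulr_ge0// indicE ler0n.
- by apply: killed_op_ge0.
Qed.

Let sum_killed n s : \sum_(i < n) a%:E * u i s <= U s.
Proof.
elim: n s => [s|n IH s]; first by rewrite big_ord0.
have -> : \sum_(i < n.+1) a%:E * u i s = a%:E * (\sum_(i < n) u i.+1 s) + a%:E.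
  rewrite big_ord_recl [u _ _]/= mule1 addeC ge0_sume_distrr//.
  by move=> i _; exact: (iter_killed_ge0 i.+1).
apply: le_trans (TU s); rewrite leeD2r//.
rewrite -TsumE -killed_opZ//; last 2 first.
- by apply: emeasurable_sum => i; exact: measurable_iter_killed.
- by move=> x; apply: sume_ge0 => i _; exact: iter_killed_ge0.
apply: le_killed_op => //.
- apply: emeasurable_funM => //.
  by apply: emeasurable_sum => i; exact: measurable_iter_killed.
- by move=> x; rewrite mule_ge0// sume_ge0// => i _; exact: iter_killed_ge0.
- move=> x; rewrite ge0_sume_distrr//.
  by move=> i _; exact: iter_killed_ge0.
Qed.

(** The uniform decrease of [U] bounds [a] times the sum of all [u i]; since [u] is nonincreasing in
    its index, the sum of the first [n] terms is at least [n] times [u n]. *)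
Lemma iter_killed_drift n s :
  (n%:R * a)%:E * u n s <= a%:E * V s + (b * m.+1%:R)%:E.
Proof.
apply: (@le_trans _ _ (U s)); last first.
  rewrite /U leeD2l// EFinM lee_wpmul2l// /Y.
  apply: (@le_trans _ _ (\sum_(i < m.+1) 1)).
    by apply: lee_sum => i _; exact: iter_killed_le1.
  by rewrite sumEFin sumr_const card_ord.
apply: le_trans (sum_killed n s).
apply: (@le_trans _ _ (\sum_(i < n) a%:E * u n s)).
  by rewrite sumr_const card_ord EFinM -muleA mule_natl.
apply: lee_sum => i _; rewrite lee_wpmul2l//.
elim: n i => [[]//|n IH i].
have := ltn_ord i; rewrite ltnS leq_eqVlt => /orP[/eqP ->|lin].
  exact: iter_killed_nonincreasing.
apply: le_trans (iter_killed_nonincreasing n s) _.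
exact: (IH (Ordinal lin)).
Qed.

End drift.
End killed.
End killed_operator.

(** * Existence and uniqueness of invariant probabilities *)

Section regeneration.
Local Open Scope ereal_scope.
Context d d' (S : measurableType d) (W : measurableType d') (R : realType).
Variables (mu : probability W R) (F : S * W -> S)
  (mF : measurable_fun setT F).

Local Notation Pop := (markov_op mu F).
Local Notation ind A := (fun x : S => (\1_A x)%:E : \bar R).
Local Notation fmeasure := {finite_measure set S -> \bar R}.

Variables (C : set S) (mC : measurable C) (m : nat).
Variables (dl : R) (nu : probability S R).
Hypothesis dl0 : (0 < dl)%R.
Hypothesis minorization : forall D s, measurable D -> C s ->
  dl%:E * nu D <= iter m.+1 Pop (ind D) s.

(** Integral of [g] under the law following [l] when the chain makes [m.+1] steps at once from [C]
    and a single one elsewhere. For this chain the minorization is available at each visit to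
    [C]. *)
Definition accelerated_int (l : set S -> \bar R) (g : S -> \bar R) : \bar R :=
  \int[l]_(x in ~` C) Pop g x + \int[l]_(x in C) iter m.+1 Pop g x.

Let accelerated_measure (l : fmeasure) : exists l' : fmeasure,
  forall g : S -> \bar R, measurable_fun setT g -> (forall x, 0 <= g x) ->
  \int[l']_x g x = accelerated_int l g.
Proof.
pose l1 : {measure set S -> \bar R} :=
  measure_add (push_measure mu mF (mrestr l (measurableC mC)))
              (iter m.+1 (push_measure mu mF) (mrestr l mC)).
have l1g g : measurable_fun setT g -> (forall x, 0 <= g x) ->
    \int[l1]_x g x = accelerated_int l g.
  move=> mg g0; rewrite ge0_integral_measure_add//.
  rewrite integral_push_measure// integral_iter_push// !ge0_integral_mrestr//.
  - by apply: measurable_iter_markov_op.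
  - by move=> x; apply: iter_markov_op_ge0.
  - by apply: measurable_markov_op.
  - by move=> x; apply: markov_op_ge0.
have l1fin : l1 setT < +oo.
  rewrite [l1 setT]measure_addE.
  by rewrite lte_add_pinfty// -ge0_fin_numE// fin_num_measure.
exists (mfrestr measurableT l1fin) => g mg g0; rewrite -l1g//.
by apply: eq_measure_integral => A mA _; rewrite /= /mfrestr /mrestr setIT.
Qed.

(** By the minorization, the mass [l C] sitting on [C] contributes at least [dl * l C] copies of
    [nu] to the next law; [l'] is what is left once they are subtracted. *)
Let regeneration_step (l : fmeasure) : exists l' : fmeasure,
  forall g : S -> \bar R, measurable_fun setT g -> (forall x, 0 <= g x) ->
  accelerated_int l g = \int[l']_x g x + dl%:E * l C * \int[nu]_x g x.
Proof.
have [l1 l1E] := accelerated_measure l.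
have k0 : (0 <= dl * fine (l C))%R by rewrite mulr_ge0 ?fine_ge0// ltW.
pose k := NngNum k0.
have [|l3 l3E] := @measure_subtraction _ S R (mscale k nu) l1.
  move=> D mD.
  have -> : l1 D = accelerated_int l (ind D).
    rewrite -l1E; [|exact: measurable_eindic|exact: eindic_ge0].
    by rewrite integral_indic// setIT.
  change ((dl * fine (l C))%:E * nu D <= accelerated_int l (ind D)).
  apply: (@le_trans _ _ (\int[l]_(x in C) iter m.+1 Pop (ind D) x)); last first.
    rewrite leeDr// integral_ge0// => x _; apply: markov_op_ge0.
    exact: eindic_ge0.
  rewrite EFinM fineK ?fin_num_measure//.
  rewrite muleAC -integral_cst//; apply: ge0_le_integral => //.
  - by move=> x _; rewrite mule_ge0// lee_fin ltW.
  - by apply: measurable_funTS; apply: measurable_iter_markov_op => //;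
      first [exact: measurable_eindic|exact: eindic_ge0].
  - by move=> x Cx; exact: minorization.
exists l3 => g mg g0; rewrite -l1E//.
rewrite (eq_measure_integral (measure_add (mscale k nu) l3)); last first.
  by move=> A mA _; rewrite [RHS]measure_addE -l3E.
rewrite ge0_integral_measure_add// ge0_integral_mscale//= addeC.
by rewrite EFinM fineK// fin_num_measure.
Qed.

Let next (l : fmeasure) : fmeasure := sval (cid (regeneration_step l)).

Let nextE (l : fmeasure) (g : S -> \bar R) : measurable_fun setT g -> (forall x, 0 <= g x) ->
  accelerated_int l g = \int[next l]_x g x + dl%:E * l C * \int[nu]_x g x.
Proof. by rewrite /next; case: cid => l' /= h; exact: h. Qed.

(* Law at time k of the chain that makes m+1 steps at once on C, started from nu
   and restricted to the event of no regeneration up to time k. *)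
Let lk (k : nat) : fmeasure := iter k next nu.

Variables (V : S -> \bar R) (b : R).
Hypothesis mV : measurable_fun setT V.
Hypothesis V0 : forall x, 0 <= V x.
Hypothesis b0 : (0 <= b)%R.
Hypothesis drift : forall s, Pop V s + 1 <= V s + (b * \1_C s)%:E.
Hypothesis nuV : \int[nu]_x V x < +oo.

Lemma iter_markov_op_drift k s : iter k Pop V s <= V s + (k%:R * b)%:E.
Proof.
elim: k s => [s|k IH s]; first by rewrite mul0r adde0.
rewrite iterS; apply: (@le_trans _ _ (Pop (fun x => V x + (k%:R * b)%:E) s)).
  apply: le_markov_op => //.
  - exact: measurable_iter_markov_op.
  - exact: emeasurable_funD.
  - by move=> x; apply: iter_markov_op_ge0.
rewrite markov_opD//; last by move=> _; rewrite lee_fin mulr_ge0.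
rewrite [X in _ + X](markov_op_cst mu F).
have h : Pop V s <= V s + b%:E.
  apply: (@le_trans _ _ (Pop V s + 1)); first by rewrite leeDl.
  apply: le_trans (drift s) _; rewrite leeD2l// lee_fin.
  by rewrite ler_piMr// indicE lern1 leq_b1.
apply: le_trans (leeD2r _ h) _.
by rewrite -addeA -EFinD -natr1 mulrDl mul1r (addrC b).
Qed.

Let B := ((m.+1%:R * b + 1) / dl)%R.
Let Phi (l : fmeasure) := \int[l]_x V x + B%:E * l setT.

Let B0 : (0 <= B)%R.
Proof.
exact: (divr_ge0 (addr_ge0 (mulr_ge0 (ler0n _ _) b0) ler01) (ltW dl0)).
Qed.

Let Phi_ge0 l : 0 <= Phi l.
Proof. by rewrite /Phi adde_ge0// ?integral_ge0// mule_ge0. Qed.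

Let massE (l : fmeasure) : l setT = next l setT + dl%:E * l C.
Proof.
have := @nextE l (cst 1) (measurable_cst _) (fun=> @lee01 R).
rewrite /accelerated_int (_ : Pop (cst 1) = cst 1); last first.
  by apply/funext => s; exact: markov_op_cst.
rewrite (_ : iter m.+1 Pop (cst 1) = cst 1); last first.
  by apply/funext => s; exact: iter_markov_op_cst.
rewrite !integral_cst//; last exact: measurableC.
rewrite !mul1e [X in _ * X](probability_setT nu) mule1 => <-.
by rewrite -measureU// ?setUv ?setvU// ?setICl//; exact: measurableC.
Qed.

Let PhiE (l : fmeasure) : Phi (next l) + l setT <= Phi l.
Proof.
have mnC := measurableC mC.
have VE : \int[next l]_x V x + l (~` C) <=
          \int[l]_x V x + (m.+1%:R * b)%:E * l C.
  apply: (@le_trans _ _ (accelerated_int l V + l (~` C))).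
    rewrite leeD2r// nextE// leeDl// mule_ge0 ?integral_ge0//.
    by rewrite mule_ge0// lee_fin ltW.
  rewrite /accelerated_int addeAC.
  rewrite -{1}[l (~` C)]mul1e -integral_cst// -ge0_integralD//; first last.
  - by apply: measurable_funTS; exact: measurable_markov_op.
  - by move=> x _; exact: markov_op_ge0.
  rewrite -integral_cst//.
  rewrite -(setUv C) ge0_integral_setU//; last 2 first.
  - by apply: measurable_funTS.
  - by apply/disj_setPS => x [].
  rewrite [X in _ <= X + _]addeC.
  apply: (@le_trans _ _ (\int[l]_(x in ~` C) V x +
    (\int[l]_(x in C) V x + \int[l]_(x in C) cst (m.+1%:R * b)%:E x)));
    last by rewrite addeA.
  apply: leeD.
    apply: ge0_le_integral => //.
    - by move=> x _; rewrite adde_ge0// markov_op_ge0.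
    - apply: emeasurable_funD => //; apply: measurable_funTS.
      exact: measurable_markov_op.
    - exact: measurable_funTS.
    - move=> x nCx; have := drift x.
      by rewrite indicE memNset// mulr0 adde0.
  rewrite -ge0_integralD//; first last.
  - by move=> x _; rewrite lee_fin mulr_ge0.
  - exact: measurable_funTS.
  apply: ge0_le_integral => //.
  - by move=> x _; apply: iter_markov_op_ge0.
  - by apply: measurable_funTS; exact: measurable_iter_markov_op.
  - by apply: emeasurable_funD => //; exact: measurable_funTS.
  - by move=> x _; exact: iter_markov_op_drift.
have lC : l setT = l (~` C) + l C.
  by rewrite -measureU// ?setUv ?setvU// ?setICl.
have -> : Phi (next l) + l setT =
   (\int[next l]_x V x + l (~` C)) + (B%:E * next l setT + l C).
  by rewrite /Phi lC addeACA.
apply: le_trans (leeD2r _ VE) _.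
rewrite /Phi (massE l).
set I := \int[l]_x V x; set c := l C; set q := next l setT.
have c0 : 0 <= c by exact: measure_ge0.
have q0 : 0 <= q by exact: measure_ge0.
rewrite -addeA leeD2l// [leRHS]ge0_muleDr//; last first.
  by rewrite mule_ge0// lee_fin ltW.
rewrite addeCA leeD2l// muleA -EFinM divfK ?gt_eqF//.
by rewrite EFinD ge0_muleDl ?mul1e// lee_fin mulr_ge0.
Qed.

(** Each step costs [Phi] the current mass, so the masses are summable: the expected regeneration
    time of the accelerated chain is finite. *)
Let sum_mass n : \sum_(i < n) lk i setT <= Phi nu.
Proof.
suff : \sum_(i < n) lk i setT + Phi (lk n) <= Phi nu.
  by apply: le_trans; rewrite leeDl.
elim: n => [|n IH]; first by rewrite big_ord0 add0e.
apply: le_trans IH; rewrite big_ord_recr/= -addeA leeD2l// addeC.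
exact: PhiE.
Qed.

Let Phi_nu : Phi nu < +oo.
Proof.
rewrite /Phi lte_add_pinfty// [X in _ * X](probability_setT nu) mule1.
exact: ltry.
Qed.

Let PiR0 : {measure set S -> \bar R} := mseries lk 0.

Let PiR0_fin : PiR0 setT < +oo.
Proof.
apply: le_lt_trans Phi_nu; rewrite /PiR0 /= /mseries.
apply: lime_le; first exact: is_cvg_nneseries.
by apply: nearW => n; rewrite big_mkord; exact: sum_mass.
Qed.

Let PiR : fmeasure := mfrestr measurableT PiR0_fin.


Let PiRE D (g : S -> \bar R) : measurable D -> measurable_fun setT g ->
  (forall x, 0 <= g x) ->
  \int[PiR]_(x in D) g x = \sum_(n <oo) \int[lk n]_(x in D) g x.
Proof.
move=> mD mg g0; rewrite -(@ge0_integral_measure_series _ S R lk D)//.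
  by apply: eq_measure_integral => A mA _; rewrite /= /mfrestr /mrestr setIT.
exact: measurable_funTS.
Qed.

(** A shift of the series by one index. Its term of index 0 is [nu], which appears on the left,
    while the regenerated masses add up to [dl * PiR C] copies of [nu] on the right. *)
Let PiR_balance (g : S -> \bar R) : measurable_fun setT g ->
  (forall x, 0 <= g x) -> \int[nu]_x g x < +oo ->
  accelerated_int PiR g + \int[nu]_x g x =
  \int[PiR]_x g x + dl%:E * PiR C * \int[nu]_x g x.
Proof.
move=> mg g0 gfin.
have I0 (l : {measure set S -> \bar R}) : 0 <= \int[l]_x g x.
  by apply: integral_ge0.
have mPg : measurable_fun setT (Pop g) by exact: measurable_markov_op.
have Pg0 : forall x, 0 <= Pop g x by exact: markov_op_ge0.
have mPmg : measurable_fun setT (iter m.+1 Pop g).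
  exact: measurable_iter_markov_op.
have Pmg0 : forall x, 0 <= iter m.+1 Pop g x by move=> x; exact: iter_markov_op_ge0.
have -> : PiR C = \sum_(n <oo) lk n C by rewrite /= /mfrestr /mrestr setIT.
have [r rE] : exists r : R, \int[nu]_x g x = r%:E.
  by exists (fine (\int[nu]_x g x)); rewrite fineK// ge0_fin_numE.
rewrite {1}/accelerated_int !PiRE//; last exact: measurableC.
rewrite -nneseriesD//; last 2 first.
- by move=> i _ _; exact: integral_ge0.
- by move=> i _ _; exact: integral_ge0.
have -> : \sum_(i <oo) (\int[lk i]_(x in ~` C) Pop g x +
     \int[lk i]_(x in C) iter m.+1 Pop g x) =
   \sum_(i <oo) (\int[lk i.+1]_x g x + (dl%:E * r%:E) * lk i C).
  apply: eq_eseriesr => i _.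
  by rewrite [LHS](@nextE (lk i) g)// rE muleAC.
have r0 : 0 <= r%:E by rewrite -rE.
rewrite nneseriesD; last 2 first.
- by move=> i _ _; exact: I0.
- by move=> i _ _; rewrite mule_ge0// mule_ge0// lee_fin ltW.
rewrite -EFinM nneseriesZl// (nneseries_recl (f := fun n => \int[lk n]_x g x))//.
have -> : \sum_(1 <= k <oo) \int[lk k]_x g x = \sum_(i <oo) \int[lk i.+1]_x g x.
  rewrite -(@nneseries_addn _ (fun n => \int[lk n]_x g x) 1)//.
  by apply: eq_eseriesr => i _; rewrite addn1.
rewrite [\int[lk 0]_x g x]rE EFinM.
set A := \sum_(i <oo) \int[lk i.+1]_x g x.
by rewrite addeAC (addeC A) (muleAC dl%:E).
Qed.

(** The balance for [g = 1]: the accelerated chain preserves mass, so the two multiples of [nu]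
    agree. In other words regeneration occurs almost surely, and [PiR] is invariant for the
    accelerated chain. *)
Let nuC : dl%:E * PiR C = 1.
Proof.
have h1 : \int[nu]_x cst 1 x = 1.
  by rewrite integral_cst// [X in _ * X](probability_setT nu) mule1.
have := PiR_balance (measurable_cst (1 : \bar R)) (fun=> @lee01 R).
rewrite h1 => /(_ (ltry _)).
have -> : accelerated_int PiR (cst 1) = \int[PiR]_x cst 1 x.
  rewrite /accelerated_int (_ : Pop (cst 1) = cst 1); last first.
    by apply/funext => s; exact: markov_op_cst.
  rewrite (_ : iter m.+1 Pop (cst 1) = cst 1); last first.
    by apply/funext => s; exact: iter_markov_op_cst.
  rewrite !integral_cst//; last exact: measurableC.
  rewrite !mul1e -measureU// ?setUv ?setvU// ?setICl//; exact: measurableC.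
rewrite mule1 => /(congr1 (fun x => x - \int[PiR]_x cst 1 x)).
have PiRfin : \int[PiR]_x cst 1 x \is a fin_num.
  by rewrite integral_cst// mul1e fin_num_measure.
by rewrite -addeA addeC subeK// [X in _ = X - _]addeC addeK.
Qed.

Let PiR_acc (g : S -> \bar R) : measurable_fun setT g ->
  (forall x, 0 <= g x) -> \int[nu]_x g x < +oo ->
  accelerated_int PiR g = \int[PiR]_x g x.
Proof.
move=> mg g0 gfin; have := PiR_balance mg g0 gfin.
rewrite nuC mul1e => /(congr1 (fun x => x - \int[nu]_x g x)).
have Ifin : \int[nu]_x g x \is a fin_num by rewrite ge0_fin_numE// integral_ge0.
by rewrite !addeK.
Qed.

Let Pi0 : {measure set S -> \bar R} :=
  measure_add (mrestr PiR (measurableC mC))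
    (msum (fun i => iter i (push_measure mu mF) (mrestr PiR mC)) m.+1).

Let Pi0E (g : S -> \bar R) : measurable_fun setT g -> (forall x, 0 <= g x) ->
  \int[Pi0]_x g x = \int[PiR]_(x in ~` C) g x +
    \sum_(i < m.+1) \int[PiR]_(x in C) iter i Pop g x.
Proof.
move=> mg g0; rewrite ge0_integral_measure_add//; congr (_ + _).
  by rewrite ge0_integral_mrestr.
rewrite ge0_integral_measure_sum//; apply: eq_bigr => i _.
rewrite integral_iter_push// ge0_integral_mrestr//.
  exact: measurable_iter_markov_op.
by move=> x; exact: iter_markov_op_ge0.
Qed.

(** One step shifts the [m.+1] terms carried by [C]. The last one, shifted to time [m.+1], joins the
    image of the mass outside [C] to form [accelerated_int PiR], which restores [PiR] and with it
    the term of index 0. *)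
Let Pi0_invariant D : measurable D -> \int[Pi0]_x Pop (ind D) x = Pi0 D.
Proof.
move=> mD; have mi : measurable_fun setT (ind D) by exact: measurable_eindic.
have i0 : forall x, 0 <= ind D x by exact: eindic_ge0.
have -> : Pi0 D = \int[Pi0]_x ind D x by rewrite integral_indic// setIT.
rewrite !Pi0E//; last 2 first.
- exact: measurable_markov_op.
- exact: markov_op_ge0.
under eq_bigr do under eq_integral do rewrite -iterSr.
rewrite big_ord_recr [in RHS]big_ord_recl.
have aux (x z y t u : \bar R) : x + z = t + u -> x + (y + z) = t + (u + y).
  by move=> h; rewrite addeCA h addeC addeA.
apply: aux.
rewrite [LHS](PiR_acc mi i0).
  rewrite -[in LHS](setvU C) ge0_integral_setU//.
  - exact: measurableC.
  - exact: measurable_funTS.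
  - by apply/disj_setPS => x [].
rewrite integral_indic// setIT.
exact: le_lt_trans (probability_le1 _ _) (ltry _).
Qed.

Let infV : set S := [set x | V x = +oo].

Let minfV : measurable infV.
Proof.
by rewrite -[infV]setTI; exact: (mV measurableT (emeasurable_set1 +oo)).
Qed.

(** From a point where [V] is finite the drift keeps the mean of [V] finite, so [+oo] is reached
    with probability 0. *)
Let Pop_infV s : Pop (ind infV) s <= ind infV s.
Proof.
have mi : measurable_fun setT (ind infV) by exact: measurable_eindic.
have [Vs|/eqP Vs] := eqVneq (V s) +oo.
  rewrite [in leRHS]indicE mem_set// -(markov_op_cst mu F 1 s).
  by apply: le_markov_op => // x; first [exact: eindic_ge0|exact: eindic_le1].
have PV : Pop V s < +oo.
  apply: (@le_lt_trans _ _ (Pop V s + 1)); first by rewrite leeDl.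
  apply: le_lt_trans (drift s) _; rewrite lte_add_pinfty ?ltry// ltey.
  exact/eqP.
suff : Pop (ind infV) s = 0 by move=> ->; exact: eindic_ge0.
have : +oo * Pop (ind infV) s <= Pop V s.
  have mFs : measurable_fun setT (fun w => F (s, w)).
    by apply: measurableT_comp => //; exact: measurable_pair1.
  have miF : measurable_fun setT (fun w => ind infV (F (s, w))).
    exact: (measurableT_comp mi mFs).
  have mVF : measurable_fun setT (fun w => V (F (s, w))).
    exact: (measurableT_comp mV mFs).
  have i0 w : 0 <= ind infV (F (s, w)) by exact: eindic_ge0.
  rewrite /markov_op -ge0_integralZl//.
  apply: ge0_le_integral => //.
  - exact: emeasurable_funM.
  - move=> w _; rewrite indicE; have [/set_mem /= ->|_] := boolP (_ \in _).
      by rewrite leey.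
    by rewrite mule0.
have P0 : 0 <= Pop (ind infV) s by apply: markov_op_ge0; exact: eindic_ge0.
move: P0; rewrite le_eqVlt => /orP[/eqP <-//|P0].
by rewrite gt0_mulye// => /(lt_le_trans PV); rewrite ltxx.
Qed.

Let iter_infV k s : iter k Pop (ind infV) s <= ind infV s.
Proof.
have mi : measurable_fun setT (ind infV) by exact: measurable_eindic.
have i0 : forall x, 0 <= ind infV x by exact: eindic_ge0.
elim: k s => // k IH s; rewrite iterS; apply: le_trans (Pop_infV s).
apply: le_markov_op => //; first exact: measurable_iter_markov_op.
by move=> x; exact: iter_markov_op_ge0.
Qed.

(** [Phi] is nonincreasing along [lk] and finite at [nu], so [V] is integrable under every
    [lk k]. *)
Let lk_infV k : lk k infV = 0.
Proof.
have IV : \int[lk k]_x V x < +oo.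
  apply: (@le_lt_trans _ _ (Phi (lk k))).
    by rewrite /Phi leeDl// mule_ge0.
  apply: le_lt_trans Phi_nu; elim: k => // k IH; apply: le_trans IH.
  by apply: le_trans (PhiE (lk k)); rewrite leeDl.
have : +oo * lk k infV <= \int[lk k]_x V x.
  rewrite -integral_cst//.
  apply: (@le_trans _ _ (\int[lk k]_(x in infV) V x)).
    apply: ge0_le_integral => //.
    - by move=> x _; exact: leey.
    - exact: measurable_funTS.
    - by move=> x ->.
  by apply: ge0_subset_integral.
have := measure_ge0 (lk k) infV.
rewrite le_eqVlt => /orP[/eqP <-//|P0].
by rewrite gt0_mulye// => /(lt_le_trans IV); rewrite ltxx.
Qed.

Let PiR_infV : PiR infV = 0.
Proof.
rewrite /= /mfrestr /mrestr setIT /= /mseries.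
by rewrite eseries0// => i _ _; exact: lk_infV.
Qed.

Let Pi0_infV : Pi0 infV = 0.
Proof.
have mi : measurable_fun setT (ind infV) by exact: measurable_eindic.
have i0 : forall x, 0 <= ind infV x by exact: eindic_ge0.
have PiR0' D : measurable D -> forall k,
    \int[PiR]_(x in D) iter k Pop (ind infV) x = 0.
  move=> mD k; have mk : measurable_fun setT (iter k Pop (ind infV)).
    exact: measurable_iter_markov_op.
  have k0 x : 0 <= iter k Pop (ind infV) x by exact: iter_markov_op_ge0.
  apply/eqP; rewrite eq_le integral_ge0// andbT -PiR_infV.
  apply: (@le_trans _ _ (\int[PiR]_x iter k Pop (ind infV) x)).
    exact: ge0_subset_integral.
  apply: (@le_trans _ _ (\int[PiR]_x ind infV x)).
    by apply: ge0_le_integral.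
  by rewrite integral_indic// setIT.
have -> : Pi0 infV = \int[Pi0]_x ind infV x by rewrite integral_indic// setIT.
rewrite Pi0E// (PiR0' _ _ 0%N)//; last exact: measurableC.
by rewrite add0e big1// => i _; exact: PiR0'.
Qed.

Let Pi0T_gt0 : 0 < Pi0 setT.
Proof.
have -> : Pi0 setT = \int[Pi0]_x cst 1 x by rewrite integral_cst// mul1e.
rewrite Pi0E// big_ord_recl addeA.
apply: (@lt_le_trans _ _ (\int[PiR]_x cst 1 x)).
  rewrite integral_cst// mul1e.
  have : 0 < PiR C.
    rewrite lt0e measure_ge0 andbT; apply/eqP => PC.
    by have := nuC; rewrite PC mule0 => /eqP; rewrite eq_sym onee_eq0.
  by move=> /lt_le_trans; apply; apply: le_measure; rewrite ?inE.
apply: (@le_trans _ _ (\int[PiR]_(x in ~` C) cst 1 x +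
  \int[PiR]_(x in C) cst 1 x)); last first.
  rewrite leeDl// sume_ge0// => i _; apply: integral_ge0 => x _.
  by apply: iter_markov_op_ge0.
rewrite -(setvU C) ge0_integral_setU//.
- exact: measurableC.
- by apply/disj_setPS => x [].
Qed.

Let Pi0T_fin : Pi0 setT < +oo.
Proof.
have -> : Pi0 setT = \int[Pi0]_x cst 1 x by rewrite integral_cst// mul1e.
rewrite Pi0E//.
have h D k : measurable D -> \int[PiR]_(x in D) iter k Pop (cst 1) x < +oo.
  move=> mD; rewrite (_ : iter k Pop (cst 1) = cst 1); last first.
    by apply/funext => s; exact: iter_markov_op_cst.
  by rewrite integral_cst// mul1e -ge0_fin_numE// fin_num_measure.
rewrite lte_add_pinfty//; first exact: (h _ 0%N (measurableC mC)).
by apply: lte_sum_pinfty => i _; exact: h.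
Qed.

Theorem exists_invariant_probability : exists pi : probability S R,
  (forall D, measurable D -> \int[pi]_x Pop (ind D) x = pi D) /\
  pi [set x | V x = +oo] = 0.
Proof.
have k0 : (0 <= (fine (Pi0 setT))^-1)%R by rewrite invr_ge0 fine_ge0.
pose k := NngNum k0.
(* The argument [nu] is the default value of [mnormalize] for a null or infinite measure; both cases
   are excluded by [Pi0T_gt0] and [Pi0T_fin]. *)
have piE D : mnormalize Pi0 nu D = mscale k Pi0 D.
  rewrite /mnormalize gt_eqF//= lt_eqF// /mscale/= muleC.
  by [].
exists (mnormalize Pi0 nu); split; last first.
  by rewrite [LHS]piE /mscale [X in _ * X]Pi0_infV mule0.
move=> D mD; rewrite [RHS]piE (eq_measure_integral (mscale k Pi0)); last first.
  by move=> A mA _; exact: piE.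
have mi : measurable_fun setT (ind D) by exact: measurable_eindic.
have i0 : forall x, 0 <= ind D x by exact: eindic_ge0.
rewrite ge0_integral_mscale//.
- by rewrite Pi0_invariant.
- exact: measurable_markov_op.
- by move=> x _; exact: markov_op_ge0.
Qed.

End regeneration.

(** * Uniqueness of the invariant probability *)

Section uniqueness.
Local Open Scope ereal_scope.
Context d d' (S : measurableType d) (W : measurableType d') (R : realType).
Variables (mu : probability W R) (F : S * W -> S)
  (mF : measurable_fun setT F).

Local Notation Pop := (markov_op mu F).
Local Notation ind A := (fun x : S => (\1_A x)%:E : \bar R).
Local Notation fmeasure := {finite_measure set S -> \bar R}.

Definition invariant_measure (l : set S -> \bar R) :=
  forall D, measurable D -> \int[l]_x Pop (ind D) x = l D.

Lemma integral_invariant_measure (l : fmeasure) (g : S -> \bar R) :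
  invariant_measure l -> measurable_fun setT g -> (forall x, 0 <= g x) ->
  \int[l]_x Pop g x = \int[l]_x g x.
Proof.
move=> li mg g0; rewrite -(integral_push_measure mu mF)//.
apply: eq_measure_integral => A mA _; rewrite -[RHS]li//.
have mi : measurable_fun setT (ind A) by exact: measurable_eindic.
have i0 : forall x, 0 <= ind A x by exact: eindic_ge0.
by rewrite -(integral_push_measure mu mF)// integral_indic// setIT.
Qed.

Lemma integral_iter_invariant_measure (l : fmeasure) (g : S -> \bar R) k :
  invariant_measure l -> measurable_fun setT g -> (forall x, 0 <= g x) ->
  \int[l]_x iter k Pop g x = \int[l]_x g x.
Proof.
move=> li mg g0; elim: k => // k IH; rewrite iterS integral_invariant_measure//.
- exact: measurable_iter_markov_op.
- by move=> x; exact: iter_markov_op_ge0.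
Qed.

(** For [D] inside [P] one has [jn D = 0], and invariance of [p1] and [p2] gives [jp D <= jp P(D)],
    because the contribution of [jn] to the difference is nonpositive. This inequality for [D] and
    for its complement, together with equal total masses, forces equality. The roles of the two
    parts can be exchanged. *)
Lemma jordan_part_invariant (p1 p2 jp jn : fmeasure) (P : set S) :
  measurable P -> (forall D, measurable D -> p1 D + jn D = p2 D + jp D) ->
  jn P = 0 -> jp (~` P) = 0 ->
  invariant_measure p1 -> invariant_measure p2 -> invariant_measure jp.
Proof.
move=> mP pE jnP jpP p1i p2i.
have Pi0 A x : 0 <= Pop (ind A) x.
  by apply: markov_op_ge0; exact: eindic_ge0.
have mPi A : measurable A -> measurable_fun setT (Pop (ind A)).
  by move=> mA; apply: measurable_markov_op => //; exact: measurable_eindic.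
have le_jp D : measurable D -> jp D <= \int[jp]_x Pop (ind D) x.
  move=> mD; pose D' := D `&` P.
  have mD' : measurable D' by exact: measurableI.
  have jnD' : jn D' = 0.
    apply/eqP; rewrite eq_le measure_ge0 andbT -jnP.
    by apply: le_measure; rewrite ?inE//; exact: subIsetr.
  have -> : jp D = jp D'.
    rewrite -[in LHS](setIT D) -(setUv P) setIUr measureU//; first last.
    - by rewrite setIACA setICr setI0.
    - by apply: measurableI => //; exact: measurableC.
    rewrite [X in _ + X](_ : _ = 0) ?adde0//.
    apply/eqP; rewrite eq_le measure_ge0 andbT -jpP.
    apply: le_measure; [rewrite inE|rewrite inE|exact: subIsetr].
    - by apply: measurableI => //; exact: measurableC.
    - exact: measurableC.
  apply: (@le_trans _ _ (\int[jp]_x Pop (ind D') x)); last first.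
    apply: ge0_le_integral => //; [exact: mPi|exact: mPi|move=> x _].
    apply: le_markov_op => //; try exact: measurable_eindic.
    move=> y; rewrite lee_fin !indicE ler_nat.
    by have [/set_mem[Dy _]|//] := boolP (y \in D'); rewrite mem_set.
  have h : p1 D' + \int[jn]_x Pop (ind D') x = p2 D' + \int[jp]_x Pop (ind D') x.
    rewrite -p1i// -p2i// -!ge0_integral_measure_add//; try exact: mPi.
    apply: eq_measure_integral => A mA _.
    by rewrite [LHS]measure_addE [RHS]measure_addE pE.
  have := pE _ mD'; rewrite jnD' adde0 => p1E.
  rewrite -(@leeD2lE _ (p2 D')) ?fin_num_measure// -h p1E.
  by rewrite leeDl// integral_ge0.
have JT : \int[jp]_x Pop (ind setT) x = jp setT.
  rewrite -[RHS]mul1e -integral_cst//; apply: eq_integral => x _.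
  rewrite -(markov_op_cst mu F 1 x); apply: eq_integral => w _.
  by rewrite indicT.
have Jfin D : measurable D -> \int[jp]_x Pop (ind D) x \is a fin_num.
  move=> mD; rewrite ge0_fin_numE ?integral_ge0//.
  apply: (@le_lt_trans _ _ (jp setT)).
    rewrite -JT; apply: ge0_le_integral => //; [exact: mPi|exact: mPi|move=> x _].
    apply: le_markov_op => //; try exact: measurable_eindic.
    by move=> y; rewrite indicT; exact: eindic_le1.
  by rewrite -ge0_fin_numE// fin_num_measure.
move=> D mD; apply/eqP; rewrite eq_le le_jp// andbT.
have mDC := measurableC mD.
have e : \int[jp]_x Pop (ind D) x + \int[jp]_x Pop (ind (~` D)) x =
    jp D + jp (~` D).
  transitivity (jp setT); last by rewrite -(setUv D) measureU// setICr.
  rewrite -JT -ge0_integralD//; try exact: mPi.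
  apply: eq_integral => x _; rewrite -markov_opD//; try exact: measurable_eindic;
    try exact: eindic_ge0.
  apply: eq_integral => w _; rewrite indicT !indicE in_setC -EFinD.
  by case: (_ \in D); rewrite ?addr0 ?add0r.
rewrite -(@leeD2rE _ (\int[jp]_x Pop (ind (~` D)) x)) ?Jfin// e.
by rewrite leeD2l// le_jp.
Qed.

Variables (V : S -> \bar R) (C : set S) (b : R).
Hypothesis mV : measurable_fun setT V.
Hypothesis V0 : forall x, 0 <= V x.
Hypothesis mC : measurable C.
Hypothesis b0 : (0 <= b)%R.
Hypothesis drift : forall s, Pop V s + 1 <= V s + (b * \1_C s)%:E.

Let mindC : measurable_fun setT (ind C).
Proof. exact: measurable_eindic. Qed.

Let g i := iter i Pop (ind C).

Let g0 i x : 0 <= g i x. Proof. exact: iter_markov_op_ge0. Qed.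

Let mg i : measurable_fun setT (g i).
Proof. exact: measurable_iter_markov_op. Qed.

(** The drift summed over [n] steps: a time [n] has to be paid for by [V s] and by visits to [C]. *)
Let occupation n s : n%:R%:E <= V s + \sum_(i < n) b%:E * g i s.
Proof.
have mS k : measurable_fun setT (fun s => \sum_(i < k) b%:E * g i s).
  by apply: emeasurable_sum => i; apply: emeasurable_funM.
have bg0 (i : nat) x : 0 <= b%:E * g i x by rewrite mule_ge0.
have S0 k x : 0 <= \sum_(i < k) b%:E * g i x by apply: sume_ge0.
have mVn k : measurable_fun setT (iter k Pop V).
  exact: measurable_iter_markov_op.
have Vn0 k x : 0 <= iter k Pop V x by exact: iter_markov_op_ge0.
suff : iter n Pop V s + n%:R%:E <= V s + \sum_(i < n) b%:E * g i s.
  by apply: le_trans; rewrite leeDr.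
elim: n s => [s|n IH s]; first by rewrite big_ord0 !adde0.
rewrite iterS -natr1 EFinD addeA.
have -> : Pop (iter n Pop V) s + n%:R%:E = Pop (fun x => iter n Pop V x + n%:R%:E) s.
  rewrite markov_opD//.
  by rewrite [X in _ = _ + X](markov_op_cst mu F).
apply: (@le_trans _ _ (Pop (fun x => V x + \sum_(i < n) b%:E * g i x) s + 1)).
  rewrite leeD2r//; apply: le_markov_op => //.
  - exact: emeasurable_funD.
  - exact: emeasurable_funD.
  - by move=> x; rewrite adde_ge0// lee_fin.
rewrite markov_opD// addeAC.
apply: le_trans (leeD2r _ (drift s)) _.
rewrite -addeA leeD2l// big_ord_recl EFinM leeD2l//.
rewrite (@markov_op_sum _ _ _ _ _ mu F mF _ (fun i x => b%:E * g i x))//; last first.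
  by move=> i; exact: emeasurable_funM.
by apply: lee_sum => i _; rewrite markov_opZ.
Qed.

(** Under [l] the expected number of visits in [n] steps is [n * l C]. [V] need not be integrable,
    so [occupation] is integrated over [A M], where [V <= M]; dividing by [n] removes the
    contribution of [V], and [M] then tends to infinity. *)
Lemma invariant_mass_le (l : fmeasure) : invariant_measure l ->
  l [set x | V x = +oo] = 0 -> l setT <= b%:E * l C.
Proof.
move=> li linf.
have intg i : \int[l]_x g i x = l C.
  by rewrite integral_iter_invariant_measure// integral_indic// setIT.
pose A (M : nat) := [set x | V x <= M%:R%:E].
have mA M : measurable (A M).
  by rewrite -[A M]setTI; exact: emeasurable_fun_le.
have bound M (n : nat) : n%:R%:E * l (A M) <=
    M%:R%:E * l (A M) + (n%:R * b)%:E * l C.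
  rewrite -integral_cst//.
  apply: (@le_trans _ _ (\int[l]_(x in A M) (M%:R%:E + \sum_(i < n) b%:E * g i x))).
    apply: ge0_le_integral => //.
    - by move=> x _; rewrite lee_fin.
    - apply: emeasurable_funD => //; apply: emeasurable_sum => i.
      by apply: emeasurable_funM => //; exact: measurable_funTS.
    - by move=> x Ax; apply: le_trans (occupation n x) _; rewrite leeD2r.
  rewrite ge0_integralD//; last 2 first.
  - by move=> x _; apply: sume_ge0 => i _; rewrite mule_ge0.
  - apply: emeasurable_sum => i.
    by apply: emeasurable_funM => //; exact: measurable_funTS.
  rewrite integral_cst// leeD2l//.
  apply: (@le_trans _ _ (\int[l]_x (\sum_(i < n) b%:E * g i x))).
    apply: ge0_subset_integral => //.
    - by apply: emeasurable_sum => i; exact: emeasurable_funM.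
    - by move=> x _; apply: sume_ge0 => i _; rewrite mule_ge0.
  rewrite ge0_integral_sum//; last 2 first.
  - by move=> i; exact: emeasurable_funM.
  - by move=> i x _; rewrite mule_ge0.
  under eq_bigr do rewrite ge0_integralZl// intg.
  by rewrite sumr_const card_ord EFinM -muleA mule_natl.
have lA M : l (A M) <= b%:E * l C.
  have xf := fin_num_measure l _ (mA M); have cf := fin_num_measure l _ mC.
  have h := bound M; rewrite -(fineK xf) -(fineK cf) in h *.
  have x0 : (0 <= fine (l (A M)))%R by exact: fine_ge0.
  move: (fine (l (A M))) (fine (l C)) x0 h => x c x0 h.
  rewrite lee_fin leNgt; apply/negP => bcx.
  have y0 : (0 < x - b * c)%R by rewrite subr_gt0.
  (* With [x = l (A M)] and [c = l C], the bound reads [n * (x - b * c) <= M * x]; this [n] violates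
     it. *)
  pose n := (Num.truncn (M%:R * x / (x - b * c))).+1.
  have nlt : (M%:R * x / (x - b * c) < n%:R)%R.
    by rewrite /n; exact: truncnS_gt.
  have := h n; rewrite -!EFinM -EFinD lee_fin -mulrA -lerBlDr -mulrBr leNgt.
  by rewrite -ltr_pdivrMr// nlt.
have AT : l setT = l (\bigcup_M A M).
  have -> : [set: S] = \bigcup_M A M `|` [set x | V x = +oo].
    apply/esym; rewrite -subTset => y _; have := V0 y.
    case Vy : (V y) => [r| |]// r0; last by right.
    left; exists (Num.truncn r).+1 => //=; rewrite /A/= Vy lee_fin.
    exact: ltW (truncnS_gt _).
  have minf : measurable [set x | V x = +oo].
    rewrite -[X in measurable X]setTI.
    exact: (mV measurableT (emeasurable_set1 +oo)).
  have mU : measurable (\bigcup_M A M) by exact: bigcupT_measurable.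
  apply/eqP; rewrite eq_le; apply/andP; split.
    apply: le_trans (measureU2 l mU minf) _.
    by rewrite [X in _ + X]linf adde0.
  apply: le_measure; [rewrite inE|rewrite inE|exact: subsetUl] => //.
  exact: measurableU.
rewrite [leLHS]AT.
have cvgA : l (A n) @[n --> \oo] --> l (\bigcup_M A M).
  apply: nondecreasing_cvg_mu => //; first exact: bigcupT_measurable.
  move=> i j ij; apply/subsetPset => x; rewrite /A/= => /le_trans; apply.
  by rewrite lee_fin ler_nat.
rewrite -(cvg_lim _ cvgA)//; apply: lime_le.
  by apply/cvg_ex; exists (l (\bigcup_M A M)).
exact: nearW.
Qed.

Variables (m : nat) (dl : R) (nu : probability S R).
Hypothesis dl0 : (0 < dl)%R.
Hypothesis minorization : forall D s, measurable D -> C s ->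
  dl%:E * nu D <= iter m.+1 Pop (ind D) s.

Let invariant_concentrated (l : fmeasure) (P : set S) : measurable P ->
  invariant_measure l -> l [set x | V x = +oo] = 0 -> l (~` P) = 0 ->
  nu (~` P) != 0 -> l setT = 0.
Proof.
move=> mP li linf lP nuP; apply/eqP; rewrite eq_le measure_ge0 andbT.
apply: le_trans (invariant_mass_le li linf) _.
suff -> : l C = 0 by rewrite mule0.
have mCP := measurableC mP.
have mi : measurable_fun setT (ind (~` P)) by exact: measurable_eindic.
have i0 : forall x, 0 <= ind (~` P) x by exact: eindic_ge0.
have : \int[l]_x iter m.+1 Pop (ind (~` P)) x = 0.
  by rewrite integral_iter_invariant_measure// integral_indic// setIT.
move=> h.
have : dl%:E * nu (~` P) * l C <= 0.
  rewrite -h -integral_cst//.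
  apply: (@le_trans _ _ (\int[l]_(x in C) iter m.+1 Pop (ind (~` P)) x)).
    apply: ge0_le_integral => //.
    - by move=> x _; rewrite mule_ge0// lee_fin ltW.
    - by apply: measurable_funTS; exact: measurable_iter_markov_op.
    - by move=> x Cx; exact: minorization.
  apply: ge0_subset_integral => //; first exact: measurable_iter_markov_op.
  by move=> x _; exact: iter_markov_op_ge0.
move=> le0; apply/eqP; move: le0; apply: contraTT => lC0.
rewrite -ltNge !mule_gt0 ?lte_fin//; rewrite lt0e ?nuP ?lC0 measure_ge0//.
Qed.

Theorem invariant_probability_unique (p1 p2 : probability S R) :
  invariant_measure p1 -> invariant_measure p2 ->
  p1 [set x | V x = +oo] = 0 -> p2 [set x | V x = +oo] = 0 ->
  forall D, measurable D -> p1 D = p2 D.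
Proof.
move=> p1i p2i p1inf p2inf.
have minf : measurable [set x | V x = +oo].
  rewrite -[X in measurable X]setTI.
  exact: (mV measurableT (emeasurable_set1 +oo)).
pose k := cadd (charge_of_finite_measure p1) (copp (charge_of_finite_measure p2)).
have kE D : k D = p1 D - p2 D by [].
have [P [N PN]] := Hahn_decomposition k.
have [[mP posP] [mN negN] PNT PN0] := PN.
pose jp : fmeasure := jordan_pos PN; pose jn : fmeasure := jordan_neg PN.
have jpE D : measurable D -> jp D = p1 (D `&` P) - p2 (D `&` P).
  by move=> mD; rewrite /jp [LHS]jordan_posE cjordan_posE /crestr0 mem_set.
have jnE D : measurable D -> jn D = p2 (D `&` N) - p1 (D `&` N).
  move=> mD; rewrite /jn [LHS]jordan_negE cjordan_negE /crestr0 mem_set//.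
  rewrite /crestr [X in - X]kE fin_num_oppeB; first by rewrite addeC.
  by apply: fin_num_measure; exact: measurableI.
have NC : N = ~` P.
  apply/seteqP; split => x.
    by move=> Nx Px; have : (P `&` N) x by []; rewrite PN0.
  by move=> nPx; have : [set: S] x by []; rewrite -PNT => -[].
have pE D : measurable D -> p1 D + jn D = p2 D + jp D.
  move=> mD; rewrite jpE// jnE//.
  have mDP : measurable (D `&` P) by exact: measurableI.
  have mDN : measurable (D `&` N) by exact: measurableI.
  have pD (p : probability S R) : p D = p (D `&` P) + p (D `&` N).
    rewrite -measureU//; first by rewrite -setIUr PNT setIT.
    by rewrite setIACA PN0 setI0.
  rewrite (pD p1) (pD p2).
  rewrite -(@fineK _ (p1 (D `&` P))) ?fin_num_measure//.
  rewrite -(@fineK _ (p2 (D `&` P))) ?fin_num_measure//.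
  rewrite -(@fineK _ (p1 (D `&` N))) ?fin_num_measure//.
  rewrite -(@fineK _ (p2 (D `&` N))) ?fin_num_measure//.
  by rewrite -!EFinB -!EFinD; congr (_%:E); ring.
have jnP : jn P = 0 by rewrite jnE// PN0 !measure0 sube0.
have jpN : jp N = 0 by rewrite jpE// setIC PN0 !measure0 sube0.
have jpi : invariant_measure jp.
  by apply: (jordan_part_invariant mP pE) => //; rewrite -NC.
have jni : invariant_measure jn.
  apply: (@jordan_part_invariant p2 p1 jn jp N mN) => //.
    by move=> D mD; rewrite pE.
  by rewrite NC setCK.
have jinf (D : set S) : measurable D -> p1 D = 0 -> p2 D = 0 ->
    jp D = 0 /\ jn D = 0.
  move=> mD p1D p2D.
  have z (p : probability S R) A : measurable A -> p D = 0 -> p (D `&` A) = 0.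
    move=> mA pD; apply/eqP; rewrite eq_le measure_ge0 andbT -pD.
    by apply: le_measure; rewrite ?inE//; exact: measurableI.
  by rewrite jpE// jnE// !z// sube0.
have [jpinf jninf] := jinf _ minf p1inf p2inf.
have massE : jn setT = jp setT.
  have := pE _ measurableT; have nf := fin_num_measure jn _ measurableT.
  have pf := fin_num_measure jp _ measurableT.
  rewrite [X in X + _ = _](probability_setT p1).
  rewrite [X in _ = X + _](probability_setT p2).
  move: (jn setT) (jp setT) nf pf => x y.
  by case: x => [x| |] //; case: y => [y| |] // _ _ [/addrI ->].
suff jpT : jp setT = 0.
  have jz (j : fmeasure) D : measurable D -> j setT = 0 -> j D = 0.
    move=> mD jT; apply/eqP; rewrite eq_le measure_ge0 andbT -jT.
    by apply: le_measure; rewrite ?inE.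
  move=> D mD; have := pE _ mD.
  by rewrite (jz jn) ?massE// (jz jp)// !adde0.
(* [nu] charges [P] or its complement, so one of the Jordan parts vanishes; the other follows, both
   having the same mass because [p1] and [p2] are probabilities. *)
have [nuP|nuP] := eqVneq (nu (~` P)) 0.
  rewrite -massE; apply: (@invariant_concentrated jn N) => //.
    by rewrite NC setCK.
  rewrite NC setCK; apply/eqP => nuP0.
  have := probability_setT nu; rewrite -(setUv P) measureU//.
  - by rewrite [X in X + _]nuP0 [X in _ + X]nuP adde0 => /eqP; rewrite eq_sym onee_eq0.
  - exact: measurableC.
  - by rewrite setICr.
by apply: (@invariant_concentrated jp P) => //; rewrite -NC.
Qed.

End uniqueness.

(** * Lebesgue measure on column vectors and small sets *)

Section lebesgue_translation.
Context {R : realType}.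
Local Open Scope ereal_scope.

Lemma lebesgue_measure_translation (a : R) (A : set R) : measurable A ->
  lebesgue_measure ((fun x => x + a)%R @^-1` A) = lebesgue_measure A.
Proof.
move=> mA.
have mt : measurable_fun [set: measurableTypeR R]
    (fun x => (x + a)%R : measurableTypeR R).
  by apply: measurable_funD => //; exact: measurable_cst.
pose m : {measure set (measurableTypeR R) -> \bar R} :=
  measure_function_pushforward__canonical__measure_function_Measure
    lebesgue_measure mt.
apply/esym; rewrite (@lebesgue_measure_unique R m)// => _ [[x y]] _ <-.
rewrite /m /= /pushforward.
have -> : (fun z => z + a)%R @^-1` `]x, y]%classic = `](x - a)%R, (y - a)%R]%classic.
  by apply/seteqP; split => z /=; rewrite !in_itv/= ltrBlDr lerBrDr.
rewrite !lebesgue_measure_itv/= !lte_fin ltrBlDr subrK.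
by case: ifP => // _; rewrite -!EFinB; congr _%:E; ring.
Qed.

Lemma measurable_translation n (f : 'cV[R]_n) :
  measurable_fun [set: 'cV[R]_n] (fun x : 'cV[R]_n => (x + f)%R).
Proof.
apply: measurable_fun_coordP => i; under eq_fun do rewrite mxE.
by apply: measurable_funD => //; exact: measurable_coord.
Qed.

(** Induction through the sections of [cV_cons]: translating the first coordinate leaves the length
    of each section unchanged, and translating the others is the induction hypothesis inside the
    outer integral. *)
Lemma lebesgue_cV_translation n (f : 'cV[R]_n) (A : set 'cV[R]_n) :
  measurable A ->
  lebesgue_cV n ((fun x => x + f)%R @^-1` A) = lebesgue_cV n A.
Proof.
elim: n f A => [f A _|n IH f A mA].
  congr (lebesgue_cV 0 _); apply/seteqP; split => x /=;
  by rewrite (flatmx0 x) (flatmx0 (_ + f)%R).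
pose f0 := f ord0 0%R; pose f' : 'cV[R]_n := \col_i f (lift ord0 i) 0%R.
pose X := @cV_cons R n @^-1` A.
have mX : measurable X.
  by rewrite /X -[X in measurable X]setTI; exact: measurable_cV_cons.
pose h (y : 'cV[R]_n) := lebesgue_measure (ysection X y).
have mh : measurable_fun setT h by exact: measurable_fun_ysection.
have consD r y : (cV_cons (r, y) + f = cV_cons (r + f0, y + f') :> 'cV[R]_n.+1)%R.
  apply/matrixP => i j; rewrite ord1 !mxE.
  by case: unliftP => [k ->|->]; rewrite ?mxE.
change (\int[lebesgue_cV n]_y lebesgue_measure
    (ysection (@cV_cons R n @^-1` ((fun x => x + f)%R @^-1` A)) y) =
  \int[lebesgue_cV n]_y h y).
transitivity (\int[lebesgue_cV n]_y h (y + f')%R).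
  apply: eq_integral => y _; rewrite /h -[RHS](lebesgue_measure_translation f0).
    congr (lebesgue_measure _); apply/seteqP; split => r /=;
    by rewrite /ysection /= !in_setE /X /= consD.
  exact: measurable_ysection.
pose m : {measure set 'cV[R]_n -> \bar R} :=
  measure_function_pushforward__canonical__measure_function_Measure
    (lebesgue_cV n) (measurable_translation f').
transitivity (\int[m]_y h y).
  by rewrite (ge0_integral_pushforward (measurable_translation f')).
by apply: eq_measure_integral => B mB _; exact: IH.
Qed.

End lebesgue_translation.

(** * Noise with a positive density *)

Section density.
Context {R : realType} {n : nat}.
Local Open Scope ereal_scope.
Variables (mu : probability 'cV[R]_n R) (eta : 'cV[R]_n -> R).
Hypothesis eta_measurable : measurable_fun setT eta.
Hypothesis eta_gt0 : forall x, (0 < eta x)%R.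
Hypothesis mu_density : forall D : set 'cV[R]_n, measurable D ->
  mu D = \int[lebesgue_cV n]_(x in D) (eta x)%:E.

Let mE : measurable_fun setT (fun x => (eta x)%:E).
Proof. exact/measurable_EFinP. Qed.

Lemma density_translation (f : 'cV[R]_n) (D : set 'cV[R]_n) : measurable D ->
  mu ((fun x => f + x)%R @^-1` D) =
  \int[lebesgue_cV n]_(z in D) (eta (z - f))%:E.
Proof.
move=> mD.
have mt := measurable_translation f.
have fE : (fun x => f + x)%R = (fun x => x + f)%R.
  by apply/funext => x; rewrite addrC.
have mD' : measurable ((fun x => x + f)%R @^-1` D).
  by rewrite -[X in measurable X]setTI; exact: mt.
rewrite fE mu_density//.
pose m : {measure set 'cV[R]_n -> \bar R} :=
  measure_function_pushforward__canonical__measure_function_Measure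
    (lebesgue_cV n) mt.
transitivity (\int[m]_(z in D) (eta (z - f))%:E).
  rewrite (ge0_integral_pushforward mt)//.
  - by apply: eq_integral => x _ /=; rewrite addrK.
  - apply: measurable_funTS; apply/measurable_EFinP.
    exact: (measurableT_comp eta_measurable (measurable_translation (- f))).
  - by move=> z _; rewrite lee_fin ltW.
by apply: eq_measure_integral => B mB _; exact: lebesgue_cV_translation.
Qed.

(** Continuity of the integral of [eta]. As translations preserve Lebesgue measure, the same [k]
    will serve for all starting points. *)
Lemma density_absolutely_continuous (e : R) : (0 < e)%R ->
  exists2 k : R, (0 < k)%R & forall A, measurable A ->
    lebesgue_cV n A < k%:E -> mu A <= e%:E.
Proof.
move=> e0.
have ieta : (lebesgue_cV n).-integrable setT (EFin \o eta).
  apply/integrableP; split => //.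
  rewrite (eq_integral (fun x => (eta x)%:E)); last first.
    by move=> x _ /=; rewrite ger0_norm// ltW.
  by rewrite -mu_density// (le_lt_trans (probability_le1 _ _))// ltry.
have [k [k0 H]] := integral_normr_continuous ieta e0.
exists k => // A mA Ak; have := H A mA Ak.
rewrite mu_density// /Rintegral.
have -> : \int[lebesgue_cV n]_(x in A) (`|eta x|)%:E =
    \int[lebesgue_cV n]_(x in A) (eta x)%:E.
  by apply: eq_integral => x _; rewrite ger0_norm// ltW.
rewrite -mu_density// => h; rewrite -(@fineK _ (mu A)) ?fin_num_measure//.
by rewrite lee_fin ltW.
Qed.

Lemma density_gt0 (A : set 'cV[R]_n) : measurable A ->
  0 < lebesgue_cV n A -> 0 < mu A.
Proof.
move=> mA A0; rewrite lt0e measure_ge0 andbT; apply/eqP => muA.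
have : \int[lebesgue_cV n]_(x in A) `|(eta x)%:E| = 0.
  rewrite -[RHS]muA mu_density//; apply: eq_integral => x _.
  by rewrite gee0_abs// lee_fin ltW.
move/ae_eq_integral_abs => /(_ mA (measurable_funTS mE)) [N [mN N0 AN]].
have AN' : A `<=` N.
  move=> x Ax; apply: AN => /= /(_ Ax) /= /eqP.
  by rewrite eqe gt_eqF.
have : lebesgue_cV n A <= 0 by rewrite -N0; apply: le_measure; rewrite ?inE.
by rewrite leNgt A0.
Qed.

End density.

Section cubes.
Context {R : realType} {n : nat}.

Definition cube (c : 'cV[R]_n) (r : R) : set 'cV[R]_n :=
  [set x | forall i, `|x i 0 - c i 0| <= r].

Lemma measurable_cube c r : measurable (cube c r).
Proof.
rewrite (_ : cube c r = \bigcap_(i in [set: 'I_n])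
    ((fun x : 'cV[R]_n => x i 0) @^-1` `[c i 0 - r, c i 0 + r])).
  apply: fin_bigcap_measurable => // i _.
  rewrite -[X in measurable X]setTI.
  by apply: measurable_coord => //; exact: measurable_itv.
apply/seteqP; split => x /= h i.
  by move=> _; rewrite /= in_itv/= -ler_distl.
by have := h i Logic.I; rewrite /= in_itv/= -ler_distl.
Qed.

Lemma lebesgue_cV_cube (c : 'cV[R]_n) (r : R) : 0 <= r ->
  lebesgue_cV n (cube c r) = ((2 * r) ^+ n)%:E.
Proof.
move=> r0.
rewrite (_ : cube c r = [set x | forall i, `[c i 0 - r, c i 0 + r]%classic (x i 0)]).
  rewrite (lebesgue_cV_box (A := fun i => `[c i 0 - r, c i 0 + r]%classic)) //.
  rewrite (eq_bigr (fun=> (2 * r)%:E)).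
    by rewrite prodEFin prodr_const card_ord.
  move=> i _; rewrite lebesgue_measure_itv/= lte_fin.
  case: ltP => [_|h]; first by rewrite -EFinB; congr _%:E; ring.
  by congr _%:E; lra.
by apply/seteqP; split => x /= h i; have := h i; rewrite in_itv/= -ler_distl.
Qed.

End cubes.

(** * Minorization from a positive, jointly measurable density *)

Section minorization.
Local Open Scope ereal_scope.
Context d d' d2 (S : measurableType d) (W : measurableType d')
  (Z : measurableType d2) (R : realType).
Variables (mu : probability W R) (F : S * W -> S)
  (mF : measurable_fun setT F).
Variables (lam : {finite_measure set Z -> \bar R}) (iota : Z -> S)
  (miota : measurable_fun setT iota).
Variables (g : S * Z -> \bar R) (mg : measurable_fun setT g).
Hypothesis g0 : forall yz, 0 <= g yz.

Local Notation Pop := (markov_op mu F).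
Local Notation ind A := (fun x : S => (\1_A x)%:E : \bar R).

(** Only an inequality: [g (y, _)] is the density of the part of the one-step law carried by the
    image of [iota], possibly cut down by [lam]. *)
Hypothesis g_density : forall (A : set S) y, measurable A ->
  \int[lam]_(z in iota @^-1` A) g (y, z) <= Pop (ind A) y.

(* Carrying the target point z along as an inert coordinate turns a k-step
   transition density, jointly measurable in (y, z), into an iterate of markov_op. *)
Definition inert_step (x : (S * Z) * W) : S * Z := (F (x.1.1, x.2), x.1.2).

Lemma measurable_inert_step : measurable_fun setT inert_step.
Proof.
apply: measurable_fun_pair.
  apply: (measurableT_comp mF); apply: measurable_fun_pair => //.
  exact: measurableT_comp.
exact: measurableT_comp.
Qed.

Let p k := iter k (markov_op mu inert_step) g.

Let p0 k yz : 0 <= p k yz.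
Proof. exact: iter_markov_op_ge0. Qed.

Let mp k : measurable_fun setT (p k).
Proof. by apply: measurable_iter_markov_op => //; exact: measurable_inert_step. Qed.

Let mpiota A : measurable A -> measurable (iota @^-1` A).
Proof. by move=> mA; rewrite -[X in measurable X]setTI; exact: miota. Qed.

Let mpy k y : measurable_fun setT (fun z => p k (y, z)).
Proof. by apply: (measurableT_comp (mp k)); exact: measurable_pair1. Qed.

Let exchange (D : set Z) k s : measurable D ->
  \int[lam]_(z in D) (\int[mu]_w p k (F (s, w), z)) =
  \int[mu]_w (\int[lam]_(z in D) p k (F (s, w), z)).
Proof.
move=> mD.
have mf : measurable_fun setT (fun zw : Z * W => p k (F (s, zw.2), zw.1)).
  apply: (measurableT_comp (mp k)); apply: measurable_fun_pair => //.
  by apply: (measurableT_comp mF); exact: measurable_fun_pair.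
have f0 zw : 0 <= p k (F (s, zw.2), zw.1) by exact: p0.
have := @fubini_tonelli _ _ Z W R (mrestr lam mD) mu _ mf f0.
rewrite /fubini_F /fubini_G /= => H.
rewrite -(ge0_integral_mrestr lam mD); last 2 first.
- exact: (@measurable_fun_fubini_tonelli_F _ _ _ _ _ mu _ mf f0).
- by move=> z; exact: integral_ge0.
by rewrite H; apply: eq_integral => w _; rewrite ge0_integral_mrestr.
Qed.

Lemma iterated_density k (A : set S) y : measurable A ->
  \int[lam]_(z in iota @^-1` A) p k (y, z) <= iter k.+1 Pop (ind A) y.
Proof.
move=> mA; have mi : measurable_fun setT (ind A) by exact: measurable_eindic.
elim: k y => [y|k IH y]; first exact: g_density.
rewrite [leLHS](_ : _ =
    \int[lam]_(z in iota @^-1` A) (\int[mu]_w p k (F (y, w), z)))//.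
rewrite exchange; last exact: mpiota.
rewrite iterS; apply: ge0_le_integral => //.
- by move=> w _; exact: integral_ge0.
- rewrite (_ : (fun w => _) = (fun y => \int[lam]_(z in iota @^-1` A) p k (y, z))
     \o (fun w => F (y, w)))//.
  apply: measurableT_comp; last first.
    by apply: measurableT_comp => //; exact: measurable_pair1.
  rewrite (_ : (fun y => _) = fubini_F (mrestr lam (mpiota mA)) (p k)).
    exact: measurable_fun_fubini_tonelli_F.
  by apply/funext => x; rewrite /fubini_F ge0_integral_mrestr.
- have mit : measurable_fun setT (iter k.+1 Pop (ind A)).
    exact: measurable_iter_markov_op.
  apply: (measurableT_comp mit).
  by apply: measurableT_comp => //; exact: measurable_pair1.
Qed.

Variables (C : set S) (refm : {finite_measure set S -> \bar R}) (kap : R).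
Hypothesis kap0 : (0 < kap)%R.
(** Uniform absolute continuity of the one-step laws from [C]: whatever [refm]-small set is given,
    at least half of the mass avoids it. *)
Hypothesis refmC : forall s A, C s -> measurable A -> refm A < kap%:E ->
  Pop (ind A) s <= (2^-1)%:E.
Variables (k : nat) (G0 : set S).
Hypothesis mG0 : measurable G0.
Hypothesis refmG0 : refm (~` G0) = 0.
Hypothesis p_gt0 : forall y z, G0 y -> 0 < p k (y, z).
Variables (B : set Z) (mB : measurable B).
Hypothesis lamB : 0 < lam B.

Let low (j : nat) := [set yz : S * Z | p k yz < (j.+1%:R^-1)%:E].

Let mlow j : measurable (low j).
Proof.
rewrite -[low j]setTI.
by apply: emeasurable_fun_lt => //; exact: measurable_cst.
Qed.

(** For fixed [z] the sets where the density is below [1 / j.+1] decrease to a set avoiding [G0],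
    which is [refm]-null; continuity from above applies as [refm] is finite. *)
Let exists_low z : exists j, refm (ysection (low j) z) < kap%:E.
Proof.
have mys j : measurable (ysection (low j) z) by exact: measurable_ysection.
have : refm (ysection (low j) z) @[j --> \oo] -->
    refm (\bigcap_j ysection (low j) z).
  apply: nonincreasing_cvg_mu => //.
  - by rewrite -ge0_fin_numE// fin_num_measure.
  - exact: bigcapT_measurable.
  - move=> i j ij; apply/subsetPset => y; rewrite /ysection/= !in_setE/low/=.
    move=> /lt_le_trans; apply; rewrite lee_fin lef_pV2 ?posrE// ler_nat.
    by rewrite ltnS.
have -> : refm (\bigcap_j ysection (low j) z) = 0.
  apply/eqP; rewrite eq_le measure_ge0 andbT -refmG0.
  apply: le_measure; [rewrite inE|rewrite inE|].
  - exact: bigcapT_measurable.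
  - exact: measurableC.
  move=> y h Gy; have := p_gt0 z Gy; rewrite ltNge => /negP; apply.
  apply/lee_addgt0Pr => e e0; rewrite add0e.
  pose j := Num.truncn e^-1.
  have := h j Logic.I; rewrite /ysection/= in_setE/low/= => /ltW/le_trans; apply.
  rewrite lee_fin -[leRHS]invrK lef_pV2 ?posrE ?invr_gt0//.
  exact: ltW (truncnS_gt _).
move=> /fine_cvgP[_ cv].
have : \forall j \near \oo, (`|0 - fine (refm (ysection (low j) z))| < kap)%R.
  by move/cvgrPdist_lt : cv; apply.
move=> [j _ /(_ j (leqnn j))]; rewrite /= sub0r normrN => h; exists j.
rewrite -(@fineK _ (refm _)) ?fin_num_measure// lte_fin.
exact: le_lt_trans (ler_norm _) h.
Qed.

(** The level [j] found for [z] depends on [z]. These sets exhaust [B], so one of them has positive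
    [lam]-measure, and on it a single level works. *)
Let good (j : nat) := B `&` [set z | refm (ysection (low j) z) < kap%:E].

Let mgood j : measurable (good j).
Proof.
apply: measurableI => //; rewrite -[X in measurable X]setTI.
apply: emeasurable_fun_lt => //.
exact: (measurable_fun_ysection refm (mlow j)).
Qed.

Let exists_good : exists j, 0 < lam (good j).
Proof.
apply: contrapT => /forallNP h.
have h0 j : lam (good j) = 0.
  apply/eqP; rewrite eq_le measure_ge0 andbT leNgt; apply/negP; exact: h.
have BE : B = \bigcup_j good j.
  apply/seteqP; split => [z Bz|z [j _ []]//].
  by have [j jP] := exists_low z; exists j.
move: lamB; rewrite BE ltNge => /negP; apply.
apply: le_trans (measure_sigma_subadditive lam mgood _ _) _.
- by rewrite -BE.
- exact: subset_refl.
by rewrite eseries0// => i _ _; exact: h0.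
Qed.

(** The first step leaves the low-density set with probability at least 1/2, whatever [s] in [C],
    and from there the density at [z] is at least [1 / j.+1]. The count [k.+2] is this step, [k]
    steps of the path and the step having density [g]. The last clause expresses that [nu] lives on
    the image of [B]. *)
Lemma small_set_minorization : exists (dl : R) (nu : probability S R),
  [/\ (0 < dl)%R,
    (forall A s, measurable A -> C s ->
      dl%:E * nu A <= iter k.+2 Pop (ind A) s) &
    forall (h : S -> \bar R) (M : R), measurable_fun setT h ->
      (forall x, 0 <= h x) -> (forall z, B z -> h (iota z) <= M%:E) ->
      \int[nu]_x h x <= M%:E].
Proof.
have [j lam_good] := exists_good.
pose Z0 := good j; have mZ0 : measurable Z0 by exact: mgood.
have lamZ0fin : lam Z0 \is a fin_num by rewrite fin_num_measure.
pose m0 : {measure set S -> \bar R} :=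
  measure_function_pushforward__canonical__measure_function_Measure
    (mrestr lam mZ0) miota.
have m0E A : m0 A = lam (iota @^-1` A `&` Z0) by [].
have [z0 Z0z0] : Z0 !=set0.
  by apply/set0P/eqP => Z00; move: lam_good; rewrite -/Z0 Z00 measure0 ltxx.
(* The Dirac mass is a mere default value; [z0] is there to supply a point for it. *)
pose nu : probability S R := mnormalize m0 (dirac (iota z0)).
have nuE A : nu A = lam (iota @^-1` A `&` Z0) * ((fine (lam Z0))^-1)%:E.
  rewrite /nu /= /mnormalize m0E preimage_setT setTI gt_eqF//=.
  by rewrite lt_eqF//= ltey_eq lamZ0fin.
have lamZ0 : (0 < fine (lam Z0))%R by rewrite fine_gt0// lam_good ltey_eq lamZ0fin.
(* One half from the first step, [1 / j.+1] from the density, and the mass of [Z0] to undo the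
   normalization of [nu]. *)
pose dl := (2^-1 * j.+1%:R^-1 * fine (lam Z0))%R.
exists dl, nu; split.
- by rewrite /dl !mulr_gt0.
- move=> A s mA Cs; have mi : measurable_fun setT (ind A) by exact: measurable_eindic.
  pose D := iota @^-1` A `&` Z0.
  have mD : measurable D by apply: measurableI => //; exact: mpiota.
  rewrite nuE /dl muleCA -EFinM mulfK ?gt_eqF// -/D.
  rewrite muleC -integral_cst//.
  have mFs : measurable_fun setT (fun w => F (s, w)).
    by apply: measurableT_comp => //; exact: measurable_pair1.
  apply: (@le_trans _ _ (\int[lam]_(z in D) (\int[mu]_w p k (F (s, w), z)))).
    apply: ge0_le_integral => //.
    - by move=> z _; rewrite lee_fin.
    - apply: measurable_funTS.
      have mf : measurable_fun setT (fun zw : Z * W => p k (F (s, zw.2), zw.1)).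
        apply: (measurableT_comp (mp k)); apply: measurable_fun_pair => //.
        by apply: (measurableT_comp mF); exact: measurable_fun_pair.
      by apply: (@measurable_fun_fubini_tonelli_F _ _ _ _ _ mu _ mf) => zw; exact: p0.
    - move=> z [_ [_ zlow]].
      pose L := ysection (low j) z.
      have mL : measurable L by exact: measurable_ysection.
      have mLC := measurableC mL.
      have miL : measurable_fun setT (ind (~` L)) by exact: measurable_eindic.
      have PL : (2^-1)%:E <= Pop (ind (~` L)) s.
        have := iter_markov_op_indicC mu mF mL 1 s; rewrite /= => PE.
        have PLfin : Pop (ind L) s \is a fin_num.
          rewrite ge0_fin_numE; last by apply: markov_op_ge0; exact: eindic_ge0.
          by apply: le_lt_trans (refmC Cs mL zlow) (ltry _).
        rewrite -(@leeD2rE _ (Pop (ind L) s))// PE.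
        apply: le_trans (leeD2l _ (refmC Cs mL zlow)) _.
        by rewrite -EFinD lee_fin; lra.
      apply: (@le_trans _ _ ((j.+1%:R^-1)%:E * Pop (ind (~` L)) s)).
        by rewrite mulrC EFinM lee_wpmul2l// lee_fin.
      rewrite -markov_opZ//.
      apply: ge0_le_integral => //.
      - apply: emeasurable_funM => //; exact: (measurableT_comp miL mFs).
      - apply: (measurableT_comp (mp k)).
        by apply: measurable_fun_pair => //; exact: measurable_cst.
      - move=> w _; rewrite indicE in_setC.
        have [_|nL] := boolP (F (s, w) \in L); first by rewrite mule0.
        rewrite mule1 leNgt; apply: contra nL => h.
        by rewrite in_setE /L /ysection/= in_setE.
  rewrite exchange// iterS; apply: ge0_le_integral => //.
  - by move=> w _; exact: integral_ge0.
  - rewrite (_ : (fun w => _) = (fun y => \int[lam]_(z in D) p k (y, z))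
       \o (fun w => F (s, w)))//.
    apply: measurableT_comp => //.
    rewrite (_ : (fun y => _) = fubini_F (mrestr lam mD) (p k)).
      exact: measurable_fun_fubini_tonelli_F.
    by apply/funext => x; rewrite /fubini_F ge0_integral_mrestr.
  - have mit : measurable_fun setT (iter k.+1 Pop (ind A)).
      exact: measurable_iter_markov_op.
    exact: (measurableT_comp mit mFs).
  - move=> w _; apply: le_trans (iterated_density k _ mA).
    apply: ge0_subset_integral => //; first exact: mpiota.
      exact: measurable_funTS.
    by move=> z [].
- move=> h M mh h0 hM.
  have r0 : (0 <= (fine (lam Z0))^-1)%R by rewrite invr_ge0 ltW.
  pose r := NngNum r0.
  rewrite (eq_measure_integral (mscale r m0)); last first.
    by move=> A mA _; rewrite [LHS]nuE muleC.
  rewrite ge0_integral_mscale//.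
  rewrite (ge0_integral_pushforward miota)// preimage_setT.
  rewrite ge0_integral_mrestr//; last first.
  - by move=> x; exact: h0.
  - exact: measurableT_comp.
  apply: (@le_trans _ _ (r%:num%:E * \int[lam]_(x in Z0) cst M%:E x)).
    apply: lee_wpmul2l; first by rewrite lee_fin.
    apply: ge0_le_integral => //.
    - by move=> x _; exact: h0.
    - by apply: measurable_funTS; exact: measurableT_comp.
    - by move=> x [Bx _]; exact: hM.
  rewrite integral_cst// [X in _ * (_ * X)](_ : _ = (fine (lam Z0))%:E); last first.
    by rewrite fineK.
  rewrite -!EFinM lee_fin /=.
  by rewrite mulrCA mulVf ?mulr1// gt_eqF.
Qed.

End minorization.

(** * Chains driven by independent noise *)

Section chain_law.
Local Open Scope ereal_scope.
Context dT dS dW (T : measurableType dT) (S : measurableType dS)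
  (W : measurableType dW) (R : realType) (P : probability T R).
Variables (w : nat -> {RV P >-> W}).
Hypothesis w_indep : mutually_independent P w.
Hypothesis w_ident : identically_distributed P w.
Variables (F : S * W -> S) (mF : measurable_fun setT F).
Variables (X : nat -> T -> S) (s : S).
Hypothesis X0 : forall omega, X 0 omega = s.
Hypothesis XS : forall t omega, X t.+1 omega = F (X t omega, w t omega).

Let mu : probability W R := distribution P (w 0%N).

Lemma measurable_chain t : measurable_fun setT (X t).
Proof.
elim: t => [|t IH]; first by rewrite (_ : X 0 = cst s)//; exact/funext.
rewrite (_ : X t.+1 = fun omega => F (X t omega, w t omega)); last exact/funext.
by apply: (measurableT_comp mF); exact: measurable_fun_pair.
Qed.

Let mX t (B : set S) : measurable B -> measurable (X t @^-1` B).
Proof. by move=> mB; rewrite -[X in measurable X]setTI; exact: measurable_chain. Qed.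

Let mw t (B : set W) : measurable B -> measurable (w t @^-1` B).
Proof. by move=> mB; rewrite -[X in measurable X]setTI; exact: measurable_funP. Qed.

Variables (D : set S) (mD : measurable D).

Fixpoint avoid (k : nat) : set T :=
  if k is j.+1 then avoid j `&` X j.+1 @^-1` (~` D) else setT.

Lemma measurable_avoid k : measurable (avoid k).
Proof.
elim: k => [|k IH] /=; first exact: measurableT.
by apply: measurableI => //; apply: mX; exact: measurableC.
Qed.

Let mk k : {measure set S -> \bar R} :=
  measure_function_pushforward__canonical__measure_function_Measure
    (mrestr P (measurable_avoid k)) (measurable_chain k).

Let mkE k B : mk k B = P (X k @^-1` B `&` avoid k). Proof. by []. Qed.

Let mk_fin k : mk k setT < +oo.
Proof. by rewrite mkE; apply: le_lt_trans (probability_le1 _ _) (ltry _); apply: measurableI; [exact: mX|exact: measurable_avoid]. Qed.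

Let fk k : {finite_measure set S -> \bar R} := mfrestr measurableT (mk_fin k).

Let fkE k B : fk k B = P (X k @^-1` B `&` avoid k).
Proof. by rewrite [LHS]/= /mfrestr /mrestr setIT. Qed.

Let future (J : {fset nat}) (C : nat -> set W) : set T :=
  \bigcap_(t in [set` J]) (w t @^-1` C t).

Let mfuture J C : (forall t, measurable (C t)) -> measurable (future J C).
Proof.
move=> mC; apply: fin_bigcap_measurable => //.
by move=> t _; exact: mw.
Qed.

(** The Markov property in the form that passes through the induction: on [avoid k] the law of [X k]
    factors from every finite rectangle in the noises of index at least [k]. Only products over
    finite index sets occur, which is how [mutually_independent] is given. *)
Let independent_future k := forall (J : {fset nat}) (C : nat -> set W) (B : set S),
  (forall t, measurable (C t)) -> measurable B ->
  (forall t, t \in J -> (k <= t)%N) ->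
  P ((X k @^-1` B `&` avoid k) `&` future J C) =
  fk k B * (\prod_(t <- J) P (w t @^-1` C t)).

(** On a rectangle [A x B] the event on [w k] is counted as one more factor of the future, with
    index [k]; uniqueness of the product measure extends the formula to all measurable [Q]. *)
Let joint k J C : independent_future k -> (forall t, measurable (C t)) ->
  (forall t, t \in J -> (k < t)%N) ->
  forall Q : set (S * W), measurable Q ->
  P (((fun omega => (X k omega, w k omega)) @^-1` Q `&` avoid k) `&` future J C) =
  (\prod_(t <- J) P (w t @^-1` C t)) * (fk k \x mu) Q.
Proof.
move=> IH mC Jk Q mQ.
have c0 : 0 <= \prod_(t <- J) P (w t @^-1` C t) by exact: prode_ge0.
have cfin : \prod_(t <- J) P (w t @^-1` C t) \is a fin_num.
  by apply: prode_fin_num => t _; apply: fin_num_measure; exact: mw.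
have fc0 : (0 <= fine (\prod_(t <- J) P (w t @^-1` C t))%E)%R by exact: fine_ge0.
pose c := NngNum fc0.
have mXw : measurable_fun setT (fun omega => (X k omega, w k omega)).
  by apply: measurable_fun_pair => //; exact: measurable_chain.
have mAF : measurable (avoid k `&` future J C).
  by apply: measurableI; [exact: measurable_avoid|exact: mfuture].
pose m' : {measure set (S * W) -> \bar R} :=
  measure_function_pushforward__canonical__measure_function_Measure
    (mrestr P mAF) mXw.
have m'E Q' : m' Q' = P (((fun omega => (X k omega, w k omega)) @^-1` Q' `&`
    avoid k) `&` future J C) by rewrite /m' /= /pushforward /mrestr setIA.
rewrite -m'E -(@product_measure_unique _ _ _ _ _ (mscale c (fk k)) mu)//.
  rewrite /product_measure1 ge0_integral_mscale//; first by rewrite /c /= fineK.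
  exact: measurable_fun_xsection.
move=> A B mA mB; rewrite m'E.
pose C' t := if t == k then B else C t.
have kJ : k \notin J by apply/negP => /Jk; rewrite ltnn.
have := IH (k |` J)%fset C' A.
have mC' t : measurable (C' t) by rewrite /C'; case: ifP.
move=> /(_ mC' mA) H.
have -> : ((fun omega => (X k omega, w k omega)) @^-1` (A `*` B) `&` avoid k) `&`
    future J C = (X k @^-1` A `&` avoid k) `&` future (k |` J)%fset C'.
  apply/seteqP; split => omega /=.
    move=> [[[XA wB] av] fu]; split => //= t /=.
    rewrite in_fset1U /C' => /orP[/eqP ->|tJ]; first by rewrite eqxx.
    case: eqP => [->//|_]; exact: fu.
  move=> [[XA av] fu]; split; first split => //; first split => //.
    by have := fu k; rewrite /= fset1U1 /C' eqxx; apply.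
  move=> t /= tJ; have := fu t; rewrite /= in_fset1U tJ orbT => /(_ isT).
  by rewrite /C'; case: eqP => // tk; move: kJ; rewrite -tk tJ.
rewrite H; last first.
  by move=> t; rewrite in_fset1U => /orP[/eqP ->//|/Jk/ltnW].
rewrite big_fsetU1//= /C' eqxx.
rewrite (_ : \prod_(t <- J) P (w t @^-1` (if t == k then B else C t)) =
    \prod_(t <- J) P (w t @^-1` C t)); last first.
  rewrite big_seq [RHS]big_seq; apply: eq_bigr => t tJ.
  by case: eqP => // tk; move: kJ; rewrite -tk tJ.
have -> : P (w k @^-1` B) = mu B by rewrite w_ident.
transitivity (\prod_(t <- J) P (w t @^-1` C t) * fk k A * mu B).
  by rewrite [in LHS](muleC (mu B)) muleA (muleC (fk k A)).
congr (_ * _); rewrite -[X in X * _](fineK cfin).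
by [].
Qed.

Let avoidS k B : X k.+1 @^-1` B `&` avoid k.+1 =
  (fun omega => (X k omega, w k omega)) @^-1` (F @^-1` (B `\` D)) `&` avoid k.
Proof.
apply/seteqP; split => omega /=; rewrite XS.
  by move=> [XB [av nD]].
by move=> [[XB nD] av].
Qed.

Let mFB B : measurable B -> measurable (F @^-1` (B `\` D)).
Proof.
move=> mB; rewrite -[X in measurable X]setTI.
by apply: mF => //; exact: measurableD.
Qed.

Let no_future C : future fset0 C = setT.
Proof. by rewrite /future; apply/seteqP; split => // omega _ t /=; rewrite in_fset0. Qed.

Let fkS k B : independent_future k -> measurable B ->
  fk k.+1 B = (fk k \x mu) (F @^-1` (B `\` D)).
Proof.
move=> IH mB; rewrite fkE avoidS.
have := @joint k fset0 (fun=> setT) IH (fun=> measurableT) _ _ (mFB mB).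
rewrite no_future setIT big_seq_fset0 mul1e; apply => t.
by rewrite in_fset0.
Qed.

Let indep k : independent_future k.
Proof.
elim: k => [J C B mC mB _|k IH J C B mC mB Jk].
  rewrite fkE /= !setIT -w_indep// -/(future J C).
  have [Bs|nBs] := pselect (B s).
    have -> : X 0 @^-1` B = setT.
      by apply/seteqP; split => // omega _ /=; rewrite X0.
    by rewrite setTI [X in X * _](probability_setT P) mul1e.
  have -> : X 0 @^-1` B = set0.
    by apply/seteqP; split => // omega /=; rewrite X0.
  by rewrite set0I measure0 mul0e.
rewrite fkS// avoidS joint//; first by rewrite muleC.
exact: mFB.
Qed.

(** Proved for all integrands [h]: [fk k] is the law of [X k] on [avoid k], and one more step of it
    is the pushed measure restricted to the complement of [D]. *)
Lemma avoid_prob k : P (avoid k) = iter k (killed_op mu F D) (cst 1) s.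
Proof.
suff H h : measurable_fun setT h -> (forall x, 0 <= h x) ->
    \int[fk k]_x h x = iter k (killed_op mu F D) h s.
  by rewrite -H// integral_cst// mul1e [RHS]fkE preimage_setT setTI.
elim: k h => [h mh h0|k IH h mh h0].
  transitivity (\int[dirac s]_x h x).
    apply: eq_measure_integral => A mA _; rewrite [LHS]fkE [RHS]diracE [X in P X]setIT.
    have [/set_mem As|nAs] := boolP (s \in A).
      have -> : X 0 @^-1` A = setT.
        by apply/seteqP; split => // omega _ /=; rewrite X0.
      by rewrite [LHS](probability_setT P).
    have -> : X 0 @^-1` A = set0.
      apply/seteqP; split => // omega /=; rewrite X0 => As.
      by move/negP : nAs; apply; rewrite inE.
    by rewrite measure0.
  by rewrite integral_dirac// diracT mul1e.
rewrite iterSr -IH; last 2 first.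
- exact: measurable_killed_op.
- exact: killed_op_ge0.
rewrite /killed_op -(integral_push_measure mu mF); last 2 first.
- apply: emeasurable_funM => //; apply: measurable_eindic; exact: measurableC.
- by move=> x; rewrite mule_ge0//; exact: eindic_ge0.
transitivity (\int[push_measure mu mF (fk k)]_(x in ~` D) h x).
  have mDC := measurableC mD.
  rewrite -(ge0_integral_mrestr _ mDC)//; apply: eq_measure_integral => A mA _.
  rewrite [LHS]fkS// [RHS]/= /mfrestr /mrestr setIT.
  by [].
rewrite integral_mkcond; apply: eq_integral => x _.
rewrite patchE indicE; case: ifPn => xD; first by rewrite mul1e.
by rewrite mul0e.
Qed.

Lemma one_step_prob : P (X 1 @^-1` D) = markov_op mu F (fun x => (\1_D x)%:E) s.
Proof.
have mFs : measurable_fun setT (fun z => F (s, z)).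
  by apply: measurableT_comp => //; exact: measurable_pair1.
have mFD : measurable ((fun z => F (s, z)) @^-1` D).
  by rewrite -[X in measurable X]setTI; exact: mFs.
transitivity (mu ((fun z => F (s, z)) @^-1` D)).
  by congr (P _); apply/seteqP; split => omega /=; rewrite XS X0.
rewrite /markov_op -[LHS]mul1e -integral_cst// integral_mkcond.
apply: eq_integral => x _; rewrite patchE indicE.
have [/set_mem h|h] := boolP (F (s, x) \in D); first by rewrite mem_set.
by rewrite memNset//= => h'; move/negP: h; apply; rewrite inE.
Qed.

(** The return time is infinite exactly on the intersection of all [avoid k], whose probability is
    below each of the killed iterates. *)
Lemma return_prob_avoid (XX : S -> nat -> T -> S) : XX s = X ->
  (forall e : R, (0 < e)%R -> exists k,
    iter k (killed_op mu F D) (cst 1) s <= e%:E) ->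
  return_prob P XX s D = 1.
Proof.
move=> XXE small; rewrite /return_prob XXE.
set A := [set omega | _].
have AE : A = ~` (\bigcap_k avoid k).
  apply/seteqP; split => omega /=.
    move=> rt av; suff : return_time D (X ^~ omega) = +oo :> \bar R.
      by move=> rE; move: rt; rewrite /A/= rE ltxx.
    rewrite /return_time.
    have -> : [set t : nat | (1 <= t)%N /\ D (X t omega)] = set0.
      rewrite -subset0; case=> [|j] /= [//] _ XD.
      by have [] := av j.+1 Logic.I.
    by rewrite image_set0 ereal_inf0.
  move=> nav; have [j XD] : exists j, D (X j.+1 omega).
    apply: contrapT => /forallNP h; apply: nav => k _.
    by elim: k => [//|k IH]; split => //; exact: h.
  apply: (@le_lt_trans _ _ (j.+1%:R%:E)); last exact: ltry.
  by apply: ereal_inf_lbound; exists j.+1.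
have mB : measurable (\bigcap_k avoid k).
  by apply: bigcapT_measurable; exact: measurable_avoid.
rewrite AE probability_setC// (_ : P (\bigcap_k avoid k) = 0) ?sube0//.
apply/eqP; rewrite eq_le measure_ge0 andbT; apply/lee_addgt0Pr => e e0.
rewrite add0e; have [k ke] := small e e0; apply: le_trans ke.
rewrite -avoid_prob; apply: le_measure; [rewrite inE|rewrite inE|] => //.
  exact: measurable_avoid.
exact: bigcap_inf.
Qed.

End chain_law.

(** * Drift and minorization imply positive Harris recurrence *)

Section foster_lyapunov.
Local Open Scope ereal_scope.
Context dT dS dW (T : measurableType dT) (S : measurableType dS)
  (W : measurableType dW) (R : realType) (P : probability T R).
Variables (w : nat -> {RV P >-> W}).
Hypothesis w_indep : mutually_independent P w.
Hypothesis w_ident : identically_distributed P w.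
Variables (F : S * W -> S) (mF : measurable_fun setT F).
Variable X : S -> nat -> T -> S.
Hypothesis X0 : forall s omega, X s 0 omega = s.
Hypothesis XS : forall s t omega, X s t.+1 omega = F (X s t omega, w t omega).

Local Notation mu := (distribution P (w 0%N)).
Local Notation Pop := (markov_op mu F).
Local Notation ind A := (fun x : S => (\1_A x)%:E : \bar R).

Variables (E C : set S) (mE : measurable E) (mC : measurable C).
Hypothesis EF : forall s v, E s -> E (F (s, v)).
Variables (V : S -> \bar R) (b : R).
Hypothesis mV : measurable_fun setT V.
Hypothesis V0 : forall x, 0 <= V x.
Hypothesis V_pinfty : [set x | V x = +oo] = ~` E.
Hypothesis b0 : (0 <= b)%R.
Hypothesis drift : forall s, Pop V s + 1 <= V s + (b * \1_C s)%:E.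
Variables (m : nat) (dl : R) (nu : probability S R).
Hypothesis dl0 : (0 < dl)%R.
Hypothesis minorization : forall D s, measurable D -> C s ->
  dl%:E * nu D <= iter m.+1 Pop (ind D) s.
Hypothesis nuE : nu (~` E) = 0.
Hypothesis nuV : \int[nu]_x V x < +oo.

Lemma return_prob_eq1 s D : E s -> measurable D -> 0 < nu D ->
  return_prob P X s D = 1.
Proof.
move=> Es mD nuD; apply: (return_prob_avoid w_indep w_ident mF (X0 s) (XS s) mD) => //.
move=> e e0; have nufin : nu D \is a fin_num by exact: fin_num_measure.
pose a := (dl * fine (nu D))%R.
have a0 : (0 < a)%R by rewrite mulr_gt0// fine_gt0// nuD -ge0_fin_numE.
have aD x : C x -> a%:E <= iter m.+1 Pop (ind D) x.
  by move=> Cx; rewrite /a EFinM fineK//; exact: minorization.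
have Vfin : V s \is a fin_num.
  rewrite ge0_fin_numE// lt_neqAle leey andbT; apply/eqP => Vs.
  by have : (~` E) s by rewrite -V_pinfty.
pose c := (a * fine (V s) + b * m.+1%:R)%R.
(* [iter_killed_drift] bounds the killed iterate by [c / (k * a)]; this [k] brings it below [e]. *)
pose k := (Num.truncn (c / (a * e))).+1.
have kc : (c < k%:R * a * e)%R.
  by rewrite -mulrA -ltr_pdivrMr ?(mulr_gt0 a0 e0)//; exact: truncnS_gt.
exists k; have := iter_killed_drift mF mD mV V0 b0 drift (ltW a0) aD k s.
move=> h; have ka0 : (0 < k%:R * a)%R by apply: mulr_gt0.
rewrite -(@lee_pmul2l _ (k%:R * a)%:E)//.
apply: (le_trans h); rewrite -(fineK Vfin) -!EFinM -EFinD lee_fin.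
exact: ltW.
Qed.

Let Pi0 D x : 0 <= Pop (ind D) x.
Proof. by apply: markov_op_ge0; exact: eindic_ge0. Qed.

Let mPi D : measurable D -> measurable_fun setT (Pop (ind D)).
Proof. by move=> mD; apply: measurable_markov_op => //; exact: measurable_eindic. Qed.

Let integral_state_space (p : probability S R) D : measurable D -> p (~` E) = 0 ->
  \int[p]_(s in E) Pop (ind D) s = \int[p]_s Pop (ind D) s.
Proof.
move=> mD pE; rewrite [RHS](@ge0_negligible_integral _ _ _ _ setT (~` E))//.
- by rewrite setTD setCK.
- exact: measurableC.
- exact: mPi.
Qed.

Let one_step D (p : probability S R) : measurable D ->
  \int[p]_(s in E) P (X s 1%N @^-1` D) = \int[p]_(s in E) Pop (ind D) s.
Proof.
by move=> mD; apply: eq_integral => s _; exact: (one_step_prob mF (X0 s) (XS s) mD).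
Qed.

(** Invariance on a subset of [E] is tested only for [D] inside [E]. It extends to all measurable
    [D] since the chain does not leave [E] and [p] does not charge its complement. *)
Lemma invariant_probability_measure (p : probability S R) :
  invariant_probability P E X p -> invariant_measure mu F p.
Proof.
move=> [pE pinv] D mD.
have mDE : measurable (D `&` E) by exact: measurableI.
rewrite -integral_state_space//.
have -> : \int[p]_(s in E) Pop (ind D) s = \int[p]_(s in E) Pop (ind (D `&` E)) s.
  apply: eq_integral => s /set_mem Es; apply: eq_integral => v _; congr (_%:E).
  rewrite !indicE; congr ((nat_of_bool _)%:R); apply/idP/idP => /set_mem.
    by move=> h; rewrite inE; split => //; exact: EF.
  by move=> [h _]; rewrite inE.
rewrite -one_step// (pinv _ mDE); last exact: subIsetr.
have mDC : measurable (D `&` ~` E) by apply: measurableI => //; exact: measurableC.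
rewrite -[in RHS](setIT D) -(setUv E) setIUr measureU//; last first.
  by rewrite setIACA setICr setI0.
rewrite [X in _ = _ + X](_ : _ = 0) ?adde0//.
apply/eqP; rewrite eq_le measure_ge0 andbT -pE.
have mEC := measurableC mE.
by apply: le_measure; rewrite ?inE//; exact: subIsetr.
Qed.

Theorem foster_lyapunov :
  positive_harris_recurrent P E X /\ unique_invariant_probability P E X.
Proof.
have [pi [piI piV]] :=
  exists_invariant_probability mF mC dl0 minorization mV V0 b0 drift nuV.
have piE : invariant_probability P E X pi.
  split; first by rewrite -V_pinfty.
  move=> D mD _; rewrite one_step// integral_state_space//; first exact: piI.
  by rewrite -V_pinfty.
split; last first.
  exists pi => // pi' pi'I D mD.
  apply: (invariant_probability_unique mF mV V0 mC b0 drift dl0 minorization) => //.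
  - exact: invariant_probability_measure.
  - by rewrite V_pinfty; have [] := pi'I.
(* The minorizing probability itself is taken as irreducibility measure; irreducibility is then
   contained in return with probability 1. *)
exists nu; split => //.
- apply/eqP => nuE'; have := probability_setT nu.
  rewrite -(setUv E) measureU//; [|exact: measurableC|by rewrite setICr].
  by rewrite [X in X + _]nuE' [X in _ + X]nuE adde0 => /eqP; rewrite eq_sym onee_eq0.
- split=> s D Es mD _ nuD; rewrite return_prob_eq1//.
- by exists pi.
Qed.

End foster_lyapunov.

(** * The quantization scheme *)

Section scheme_measurability.
Context {R : realType}.

(** The bin size by which the quantizer divides is a coordinate of the state, so the inverse is
    needed as a function on the whole line. It is discontinuous at 0 and is treated on each
    half-line as the power -1. *)
Lemma measurable_invr : measurable_fun [set: R] (@GRing.inv R).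
Proof.
rewrite (_ : GRing.inv =
    fun x : R => if 0 <= x then x `^ (-1) else - ((- x) `^ (-1))).
  apply: measurable_fun_ifT.
  - by apply: measurable_fun_ler => //; exact: measurable_cst.
  - exact: measurable_powR.
  - have mo : measurable_fun [set: R] (fun x : R => - x) by exact: measurableT_comp.
    apply: (measurableT_comp mo).
    exact: (measurableT_comp (measurable_powR (-1)) mo).
apply/funext => x; case: ifPn => [x0|]; first by rewrite powR_inv1.
rewrite -ltNge => x0; rewrite powR_inv1; last by rewrite oppr_ge0 ltW.
by rewrite invrN opprK.
Qed.

Lemma measurable_floorr : measurable_fun [set: R] (fun x : R => (Num.floor x)%:~R : R).
Proof.
apply: nondecreasing_measurable => // x y xy.
by rewrite ler_int le_floor.
Qed.

Lemma measurable_quantizer d (T : measurableType d) (M : nat) (D y : T -> R) :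
  measurable_fun setT D -> measurable_fun setT y ->
  measurable_fun setT (fun t => quantizer M (D t) (y t)).
Proof.
move=> mD my; rewrite /quantizer.
have mMD : measurable_fun setT (fun t => M%:R / 2 * D t).
  by apply: measurable_funM => //; exact: measurable_cst.
have mD2 : measurable_fun setT (fun t => D t / 2).
  by apply: measurable_funM => //; exact: measurable_cst.
apply: measurable_fun_ifT; first exact: measurable_fun_eqr.
  exact: measurable_funB.
apply: measurable_funD => //; apply: measurable_funM => //.
apply: (measurableT_comp measurable_floorr); apply: measurable_funM => //.
exact: (measurableT_comp measurable_invr).
Qed.

Lemma le_norm_cV n (x : 'cV[R]_n) (r : R) : 0 <= r ->
  `|x| <= r <-> forall i, `|x i 0| <= r.
Proof.
move=> r0; rewrite [ `|x| ]mx_normrE; split => [/bigmax_leP[_ h] i|h].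
  by have := h (i, 0) isT.
by apply/bigmax_leP; split => // -[i j] _ /=; rewrite ord1.
Qed.

Lemma coord_le_norm n (x : 'cV[R]_n) i : `|x i 0| <= `|x|.
Proof. by have [+ _] := le_norm_cV x (normr_ge0 x); apply. Qed.

Lemma measurable_norm_cV n : measurable_fun [set: 'cV[R]_n] (fun x => `|x|).
Proof.
rewrite (_ : (fun x : 'cV[R]_n => `|x|) = fun x => \big[Num.max/0]_ij `|x ij.1 ij.2|).
  elim: (index_enum _) => [|ij s IH].
    by under eq_fun do rewrite big_nil; exact: measurable_cst.
  under eq_fun do rewrite big_cons; apply: measurable_maxr => //.
  apply: measurableT_comp => //; case: ij => i j /=; rewrite ord1.
  exact: measurable_coord.
by apply/funext => x; rewrite -mx_normrE.
Qed.

Lemma measurable_mulmx_cV d (T : measurableType d) m n (A : 'M[R]_(m, n))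
    (x : T -> 'cV[R]_n) : measurable_fun setT x ->
  measurable_fun setT (fun t => A *m x t).
Proof.
move=> mx; apply: measurable_fun_coordP => i.
under eq_fun do rewrite mxE.
apply: measurable_sum => j; apply: measurable_funM; first exact: measurable_cst.
exact: (measurableT_comp (measurable_coord j)).
Qed.

Lemma measurable_addmx_cV d (T : measurableType d) n (x y : T -> 'cV[R]_n) :
  measurable_fun setT x -> measurable_fun setT y ->
  measurable_fun setT (fun t => x t + y t).
Proof.
move=> mx my; apply: measurable_fun_coordP => i; under eq_fun do rewrite mxE.
by apply: measurable_funD; exact: (measurableT_comp (measurable_coord i)).
Qed.

Lemma measurable_oppmx_cV d (T : measurableType d) n (x : T -> 'cV[R]_n) :
  measurable_fun setT x -> measurable_fun setT (fun t => - x t).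
Proof.
move=> mx; apply: measurable_fun_coordP => i; under eq_fun do rewrite mxE.
by apply: measurableT_comp => //; exact: (measurableT_comp (measurable_coord i)).
Qed.

Lemma measurable_quantizerQ d (T : measurableType d) n (M : nat) (D : T -> R)
    (x : T -> 'cV[R]_n) : measurable_fun setT D -> measurable_fun setT x ->
  measurable_fun setT (fun t => quantizerQ M (D t) (x t)).
Proof.
move=> mD mx; apply: measurable_fun_ifT.
- apply: measurable_fun_ler; first exact: (measurableT_comp (@measurable_norm_cV n)).
  by apply: measurable_funM => //; exact: measurable_cst.
- apply: measurable_fun_coordP => i; under eq_fun do rewrite mxE.
  by apply: measurable_quantizer => //; exact: (measurableT_comp (measurable_coord i)).
- exact: measurable_cst.
Qed.

Lemma measurable_quantizerU d (T : measurableType d) n (M : nat) (D : R)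
    (x : T -> 'cV[R]_n) : measurable_fun setT x ->
  measurable_fun setT (fun t => quantizerU M D (x t)).
Proof.
move=> mx; apply: measurable_fun_coordP => i; under eq_fun do rewrite mxE.
have mxi : measurable_fun setT (fun t => x t i 0).
  exact: (measurableT_comp (measurable_coord i)).
apply: measurable_fun_ifT.
- by apply: measurable_fun_ler; [exact: measurableT_comp|exact: measurable_cst].
- by apply: measurable_quantizer => //; exact: measurable_cst.
- exact: measurable_cst.
Qed.

Section step.
Context {n : nat}.
Variables (A B : 'M[R]_n) (beta eps : R) (K : nat) (alpha rho L : R) (N : nat).

Lemma measurable_next_bin : measurable_fun [set: 'cV[R]_n * R]
  (fun z => next_bin K alpha rho L z.1 z.2).
Proof.
have m2 : measurable_fun [set: 'cV[R]_n * R] snd by exact: measurable_snd.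
have m1 : measurable_fun [set: 'cV[R]_n * R] fst by exact: measurable_fst.
apply: measurable_fun_ifT.
- apply: measurable_fun_ltr; last exact: (measurableT_comp (@measurable_norm_cV n)).
  by apply: measurable_funM => //; exact: measurable_cst.
- by apply: measurable_funM => //; exact: measurable_cst.
- apply: measurable_fun_ifT => //.
  + by apply: measurable_fun_ler => //; exact: measurable_cst.
  + by apply: measurable_funM => //; exact: measurable_cst.
Qed.

(** The noise-free part of the next vector; not to be confused with the drift of the Lyapunov
    function. *)
Definition drift_part (z : 'cV[R]_n * R) : 'cV[R]_n :=
  A *m z.1 + B *m control A B beta eps K N z.1 z.2.

Lemma measurable_drift_part : measurable_fun setT drift_part.
Proof.
have m2 : measurable_fun [set: 'cV[R]_n * R] snd by exact: measurable_snd.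
have m1 : measurable_fun [set: 'cV[R]_n * R] fst by exact: measurable_fst.
have mQ := measurable_quantizerQ K m2 m1.
apply: measurable_addmx_cV; first exact: measurable_mulmx_cV.
apply: measurable_mulmx_cV; apply: measurable_oppmx_cV.
apply: measurable_mulmx_cV; apply: measurable_addmx_cV => //.
apply: measurable_quantizerU; apply: measurable_addmx_cV => //.
exact: measurable_oppmx_cV.
Qed.

Definition scheme_map (zw : ('cV[R]_n * R) * 'cV[R]_n) : 'cV[R]_n * R :=
  scheme_step A B beta eps K alpha rho L N zw.1 zw.2.

Lemma scheme_mapE zw : scheme_map zw =
  (drift_part zw.1 + zw.2, next_bin K alpha rho L zw.1.1 zw.1.2).
Proof. by []. Qed.

Lemma measurable_scheme_map : measurable_fun setT scheme_map.
Proof.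
have m1 : measurable_fun [set: ('cV[R]_n * R) * 'cV[R]_n] fst.
  exact: measurable_fst.
apply: measurable_fun_pair.
  apply: measurable_addmx_cV; last exact: measurable_snd.
  exact: (measurableT_comp measurable_drift_part m1).
exact: (measurableT_comp measurable_next_bin m1).
Qed.

End step.
End scheme_measurability.

(** * The Lyapunov function in two scalar variables *)

Section scalar_drift.
Context {R : realType}.
Variables (a alpha rho L : R).
Hypotheses (alpha_gt0 : 0 < alpha) (alpha_lt1 : alpha < 1) (a_lt_rho : a < rho)
  (rho_gt1 : 1 < rho) (L_gt0 : 0 < L).

(* replaces the growth rate a = opnorm A, whose logarithm is junk when a = 0 *)
Let abar := Num.max a 1.

(** Chosen so that a contraction by [alpha] lowers the first term of [lyapunov] by exactly 2: one
    unit for the drift, one to absorb the noise far from the core. *)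
Definition bin_weight : R := 2 / - ln alpha.
(** The rise [bin_weight * ln rho] caused by an expansion, plus the desired decrease 2. It is given
    back when overflow ends. *)
Definition overflow_base : R := bin_weight * ln rho + 2.
(** While overflow lasts, [y / D] is multiplied by about [abar / rho]; with this slope its
    logarithmic term falls by [overflow_base] at each step. *)
Definition overflow_slope : R := overflow_base / (ln rho - ln abar).

(* y stands for 2 |x| / K, so that overflow is D < y. *)
Definition lyapunov (y D : R) : R :=
  bin_weight * ln (D / (alpha * L)) +
  (if D < y then overflow_base + overflow_slope * ln (y / D) else 0).

Let ka_gt0 : 0 < bin_weight.
Proof. by rewrite divr_gt0// oppr_gt0 ln_lt0// alpha_gt0. Qed.

Let lnrho : 0 < ln rho. Proof. exact: ln_gt0. Qed.

Let c0_ge2 : 2 <= overflow_base.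
Proof. by rewrite /overflow_base lerDr mulr_ge0// ltW. Qed.

Let abar_ge1 : 1 <= abar. Proof. by rewrite le_max lexx orbT. Qed.

Let abar_gt0 : 0 < abar. Proof. exact: lt_le_trans abar_ge1. Qed.

Let rho_gt0 : 0 < rho. Proof. exact: lt_trans rho_gt1. Qed.

Let slope_den : 0 < ln rho - ln abar.
Proof. by rewrite subr_gt0 ltr_ln ?posrE// gt_max a_lt_rho. Qed.

Lemma overflow_slope_gt0 : 0 < overflow_slope.
Proof. by rewrite divr_gt0// (lt_le_trans _ c0_ge2). Qed.

Let aL_gt0 : 0 < alpha * L. Proof. by rewrite mulr_gt0. Qed.

Lemma overflow_base_ge0 : 0 <= overflow_base.
Proof. by apply: le_trans c0_ge2. Qed.

Lemma lyapunov_ge0 y D : alpha * L <= D -> 0 <= lyapunov y D.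
Proof.
move=> hD; have D0 : 0 < D by exact: lt_le_trans hD.
rewrite /lyapunov addr_ge0//.
  by rewrite mulr_ge0 ?(ltW ka_gt0)// ln_ge0// ler_pdivlMr// mul1r.
case: ifP => // Dy; rewrite addr_ge0 ?overflow_base_ge0//.
rewrite mulr_ge0 ?(ltW overflow_slope_gt0)// ln_ge0//.
by rewrite ler_pdivlMr// mul1r ltW.
Qed.

Lemma lyapunov_le y D Y : alpha * L <= D -> D <= Y -> y <= Y ->
  lyapunov y D <= bin_weight * ln (Y / (alpha * L)) +
    (overflow_base + overflow_slope * ln (Y / (alpha * L))).
Proof.
move=> hD DY yY; have D0 : 0 < D by exact: lt_le_trans hD.
have Y0 : 0 < Y by exact: lt_le_trans DY.
have lnY : 0 <= ln (Y / (alpha * L)).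
  by rewrite ln_ge0// ler_pdivlMr// mul1r (le_trans hD).
rewrite /lyapunov lerD//.
  rewrite ler_wpM2l ?(ltW ka_gt0)// ler_ln ?posrE ?divr_gt0//.
  by rewrite ler_pM2r// invr_gt0.
case: ifP => [Dy|_]; last first.
  by rewrite addr_ge0 ?overflow_base_ge0// mulr_ge0// ltW// overflow_slope_gt0.
have y0 : 0 < y by exact: lt_trans Dy.
rewrite lerD2l ler_wpM2l ?(ltW overflow_slope_gt0)//.
rewrite ler_ln ?posrE ?divr_gt0//; apply: ler_pM => //; first exact: ltW.
  by rewrite invr_ge0 ltW.
by rewrite lef_pV2// posrE.
Qed.

(** If overflow ends, [overflow_base] is recovered and pays for the expansion; if it goes on, the
    slope term pays. The noise costs [overflow_slope * o / y] by [ln (1 + x) <= x]. *)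
Lemma lyapunov_overflow y D y' o : alpha * L <= D -> D < y -> 0 <= o ->
  y' <= a * y + o ->
  lyapunov y' (rho * D) + 2 <= lyapunov y D + overflow_slope * o / y.
Proof.
move=> hD Dy o0 hy'; have D0 : 0 < D by exact: lt_le_trans hD.
have y0 : 0 < y by exact: lt_trans Dy.
have cpos := overflow_slope_gt0.
have oy0 : 0 <= o / y by rewrite divr_ge0// ltW.
have lnyD : 0 <= ln (y / D) by rewrite ln_ge0// ler_pdivlMr// mul1r ltW.
have slopeE : overflow_slope * (ln rho - ln abar) = overflow_base.
  by rewrite divfK// gt_eqF.
rewrite /lyapunov Dy -mulrA lnM ?posrE ?divr_gt0//.
have baseE : overflow_base = bin_weight * ln rho + 2 by [].
case: ifP => [ov|_]; last first.
  have := mulr_ge0 (ltW cpos) lnyD; have := mulr_ge0 (ltW cpos) oy0.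
  rewrite -[overflow_slope * o / y]mulrA mulrDr; lra.
have y'0 : 0 < y' by apply: lt_trans ov; rewrite mulr_gt0.
have h1 : ln (y' / (rho * D)) = ln (y' / y) + ln (y / D) - ln rho.
  rewrite !ln_div ?posrE ?mulr_gt0// lnM ?posrE//; ring.
have h2 : ln (y' / y) <= ln abar + o / y.
  apply: (@le_trans _ _ (ln (abar * (1 + o / y)))).
    rewrite ler_ln ?posrE ?divr_gt0 ?mulr_gt0 ?ltr_pwDl//.
    rewrite ler_pdivrMr// -mulrA mulrDl mul1r divfK ?gt_eqF//.
    apply: le_trans hy' _; rewrite mulrDr lerD//.
      by rewrite ler_pM2r// le_max lexx.
    by rewrite ler_peMl.
  rewrite lnM ?posrE ?ltr_pwDl// lerD2l le_ln1Dx//.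
  by apply: lt_le_trans oy0; rewrite ltrN10.
rewrite h1 -[overflow_slope * o / y]mulrA.
have := ler_wpM2l (ltW cpos) h2; rewrite !mulrDr mulrN.
move: slopeE; rewrite mulrBr; rewrite baseE; lra.
Qed.

Variable s : R.
Hypothesis s_gt0 : 0 < s.

(** Price of an overflow created by noise [o] after a granular step. Such an overflow needs
    [o > s * D], so [o / (s * D)] exceeds 1 and covers the constant part; the last summand covers
    the noise inside the logarithm. *)
Definition granular_cost : R :=
  (overflow_base + overflow_slope) / s + overflow_slope / alpha.

Lemma granular_cost_ge0 : 0 <= granular_cost.
Proof.
rewrite addr_ge0// divr_ge0 ?(ltW s_gt0) ?(ltW alpha_gt0)//.
  by rewrite addr_ge0 ?overflow_base_ge0// ltW// overflow_slope_gt0.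
by rewrite ltW// overflow_slope_gt0.
Qed.

(** Without noise [y'] would stay below the next bin by the margin [s * D], so only noise can
    reintroduce the overflow term. No decrease is claimed for [D < L], where the bin is kept; such
    states will lie in the core set. *)
Lemma lyapunov_granular y D y' o : alpha * L <= D -> y <= D -> 0 <= o ->
  y' <= (alpha - s) * D + o ->
  lyapunov y' (if L <= D then alpha * D else D) + (if L <= D then 2 else 0)
    <= lyapunov y D + granular_cost * o / D.
Proof.
move=> hD yD o0 hy'; have D0 : 0 < D by exact: lt_le_trans hD.
have cpos := overflow_slope_gt0.
set D' := if _ then alpha * D else D.
have D'0 : 0 < D' by rewrite /D'; case: ifP => // _; rewrite mulr_gt0.
have D'ge : alpha * D <= D'.
  by rewrite /D'; case: ifP => // _; rewrite ler_piMl// ltW.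
have oD0 : 0 <= o / D by rewrite divr_ge0// ltW.
have lnD' : bin_weight * ln (D' / (alpha * L)) + (if L <= D then 2 else 0) =
    bin_weight * ln (D / (alpha * L)).
  rewrite /D'; case: ifP => _; last by rewrite addr0.
  rewrite -[alpha * D / _]mulrA lnM ?posrE ?divr_gt0// mulrDr.
  have -> : bin_weight * ln alpha = - 2.
    rewrite /bin_weight invrN mulrN mulNr divfK// lt_eqF// ln_lt0//.
    by rewrite alpha_gt0.
  by ring.
rewrite {2}/lyapunov ltNge yD /= addr0 /lyapunov addrAC lnD' lerD2l.
rewrite -mulrA; case: ifP => [ov|_]; last by rewrite mulr_ge0// granular_cost_ge0.
have y'0 : 0 < y' by exact: lt_trans ov.
(* A new overflow gives [alpha * D <= D' < y' <= (alpha - s) * D + o]. *)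
have h1 : 1 <= s^-1 * (o / D).
  rewrite mulrC -[leRHS]mulrA -invfM ler_pdivlMr ?mulr_gt0// mul1r.
  have := le_lt_trans D'ge (lt_le_trans ov hy').
  by rewrite mulrBl (mulrC D); lra.
have h2 : ln (y' / D') <= 1 + alpha^-1 * (o / D).
  apply: le_trans (ltW (ln_sublinear (divr_gt0 y'0 D'0))) _.
  rewrite ler_pdivrMr//; apply: le_trans hy' _.
  apply: (@le_trans _ _ ((1 + alpha^-1 * (o / D)) * (alpha * D))); last first.
    rewrite ler_wpM2l// addr_ge0// mulr_ge0// invr_ge0 ltW//.
  rewrite [leRHS]mulrDl mul1r mulrACA mulVf ?gt_eqF// mul1r divfK ?gt_eqF//.
  by rewrite lerD2r ler_pM2r// lerBlDr lerDl ltW.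
have h3 := ler_wpM2l (ltW cpos) h2.
have h4 : overflow_base + overflow_slope <=
    (overflow_base + overflow_slope) * (s^-1 * (o / D)).
  by rewrite ler_peMr// addr_ge0 ?overflow_base_ge0// ltW.
move: h3 h4; rewrite /granular_cost [(_ / s + _) * _]mulrDl.
rewrite -[_ / s * _]mulrA -[_ / alpha * _]mulrA mulrDr mulr1.
move: (s^-1 * _) (alpha^-1 * _) => u v h3 h4.
by apply: le_trans (lerD (lexx _) h3) _; rewrite addrA lerD2r.
Qed.

End scalar_drift.

(** * Quantization errors *)

Section quantization_error.
Context {R : realType}.

Lemma opnorm_ge0 n (A : 'M[R]_n) : 0 <= opnorm A.
Proof. exact: bigmax_ge_id. Qed.

Lemma norm_mulmx_le n (A : 'M[R]_n) (x : 'cV[R]_n) (r : R) : 0 <= r ->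
  `|x| <= r -> `|A *m x| <= opnorm A * r.
Proof.
move=> r0 /le_norm_cV -/(_ r0) xr.
apply/le_norm_cV; first by rewrite mulr_ge0// opnorm_ge0.
move=> i; rewrite mxE; apply: le_trans (ler_norm_sum _ _ _) _.
apply: (@le_trans _ _ (\sum_j `|A i j| * r)).
  by apply: ler_sum => j _; rewrite normrM ler_wpM2l.
rewrite -mulr_suml ler_wpM2r//.
exact: (le_bigmax_cond _ (fun i => \sum_j `|A i j|)).
Qed.

(** No range condition on [y] appears, because the total definition continues the uniform quantizer
    to the whole line. *)
Lemma quantizer_error (M : nat) (D y : R) : 0 < D ->
  `|y - quantizer M D y| <= D / 2.
Proof.
move=> D0; rewrite /quantizer; case: eqP => [->|_].
  by rewrite opprB addrCA subrr addr0 ger0_norm// divr_ge0// ltW.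
have -> : y - (D * (Num.floor (y / D))%:~R + D / 2) =
    D * (y / D - (Num.floor (y / D))%:~R - 2^-1).
  by field; rewrite gt_eqF.
rewrite normrM (gtr0_norm D0) ler_pM2l//.
have := floor_itv (y / D); rewrite intrD /= => /andP[h1 h2].
by rewrite ler_norml; apply/andP; split; lra.
Qed.

(** A coordinate out of range is sent to 0 and keeps an error of at most [r], any other errs by at
    most [D / 2]; the sum covers both. *)
Lemma quantizerU_error n (M : nat) (D : R) (x : 'cV[R]_n) (r : R) : 0 < D ->
  `|x| <= r -> `|x - quantizerU M D x| <= r + D / 2.
Proof.
move=> D0 xr; have r0 : 0 <= r by exact: le_trans xr.
have D20 : 0 <= D / 2 by rewrite divr_ge0// ltW.
apply/le_norm_cV; first by rewrite addr_ge0.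
move=> i; rewrite !mxE; case: ifP => _.
  by apply: le_trans (quantizer_error M (x i 0) D0) _; rewrite lerDr.
rewrite subr0; apply: le_trans (coord_le_norm x i) _.
by apply: le_trans xr _; rewrite lerDl.
Qed.

Lemma quantizerQ_error n (M : nat) (D : R) (x : 'cV[R]_n) : 0 < D ->
  `|x| <= M%:R / 2 * D -> `|x - quantizerQ M D x| <= D / 2.
Proof.
move=> D0 xM; rewrite /quantizerQ xM.
apply/le_norm_cV; first by rewrite divr_ge0// ltW.
by move=> i; rewrite !mxE; exact: quantizer_error.
Qed.

End quantization_error.

(** * Pathwise drift of the scheme *)

Section scheme_drift.
Context {R : realType} {n : nat}.
Variables (A B : 'M[R]_n) (beta eps : R) (K : nat) (alpha rho L Delta0 : R).
Hypothesis B_unit : B \in unitmx.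
Hypothesis params : scheme_parameters A beta eps K alpha rho L Delta0.
Variable N : nat.
Hypotheses (N_even : ~~ odd N) (N_ge2 : (2 <= N)%N).

Let a := opnorm A.
Let dN := fine_bin beta eps N.

Lemma fine_bin_gt0 : 0 < dN.
Proof.
rewrite /dN /fine_bin mulr_gt0// powR_gt0// ltr0n.
exact: leq_trans N_ge2.
Qed.

Let a0 : 0 <= a. Proof. exact: opnorm_ge0. Qed.

Let K0 : 0 < K%:R :> R.
Proof. by rewrite ltr0n; exact: leq_trans (K_ge2 params). Qed.

Lemma alpha_gt0 : 0 < alpha.
Proof. by apply: le_lt_trans (alpha_gt params); rewrite divr_ge0// ltW. Qed.

Let L0 : 0 < L. Proof. exact: L_gt0 params. Qed.

Let aL0 : 0 < alpha * L. Proof. by rewrite mulr_gt0// alpha_gt0. Qed.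

Lemma rho_gt1 : 1 < rho.
Proof.
have [j [k [j1 k1 _ ajk]]] := alpha_rho_rel params.
rewrite ltNge; apply/negP => rho1.
have rho0 : 0 <= rho by rewrite (le_trans a0)// ltW// (rho_gt_norm params).
have : alpha ^+ j * rho ^+ k < 1.
  apply: (@le_lt_trans _ _ (alpha ^+ j)).
    by rewrite ler_piMr ?exprn_ile1// exprn_ge0// ltW// alpha_gt0.
  by rewrite exprn_ilt1// ?ltW ?alpha_gt0 ?(alpha_lt1 params)// -lt0n.
by rewrite ajk ltxx.
Qed.

Local Notation drift_part := (drift_part A B beta eps K N).

Lemma drift_partE z : drift_part z =
  A *m (z.1 - quantizerQ K z.2 z.1
        - quantizerU N dN (z.1 - quantizerQ K z.2 z.1)).
Proof.
rewrite /drift_part /control -/dN mulmxN !mulmxA mulmxV// mul1mx.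
by rewrite -mulmxBr; congr (A *m _); rewrite opprD addrA.
Qed.

Lemma drift_part_granular z : 0 < z.2 -> `|z.1| <= K%:R / 2 * z.2 ->
  `|drift_part z| <= a * ((z.2 + dN) / 2).
Proof.
move=> z20 h; rewrite drift_partE.
have h0 : 0 <= (z.2 + dN) / 2 by rewrite divr_ge0// addr_ge0// ltW// fine_bin_gt0.
apply: norm_mulmx_le => //; rewrite mulrDl.
exact: (quantizerU_error N fine_bin_gt0 (quantizerQ_error z20 h)).
Qed.

Lemma drift_part_overflow z : K%:R / 2 * z.2 < `|z.1| ->
  `|drift_part z| <= a * (`|z.1| + dN / 2).
Proof.
move=> h; have nh : (`|z.1| <= K%:R / 2 * z.2) = false by rewrite leNgt h.
rewrite drift_partE /quantizerQ nh subr0.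
have h0 : 0 <= `|z.1| + dN / 2.
  by rewrite addr_ge0// divr_ge0// ltW// fine_bin_gt0.
apply: norm_mulmx_le => //.
exact: (quantizerU_error N fine_bin_gt0 (lexx _)).
Qed.

Definition scaled_norm (x : 'cV[R]_n) : R := 2 * `|x| / K%:R.

Lemma overflowE x D : (K%:R / 2 * D < `|x|) = (D < scaled_norm x).
Proof.
rewrite /scaled_norm ltr_pdivlMr// -(ltr_pM2l (ltr0n R 2)).
by congr (_ < _); field.
Qed.

(* Positive by the parameter condition a / (K alpha - a) * dN < alpha L. *)
Definition margin : R := alpha - a / K%:R - a / K%:R * dN / (alpha * L).

Lemma margin_gt0 : 0 < margin.
Proof.
have Ka : 0 < K%:R * alpha - a.
  rewrite subr_gt0 mulrC -ltr_pdivrMr//; exact: alpha_gt params.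
have := alphaL_gt params N_even N_ge2.
rewrite -/a -/dN mulrAC ltr_pdivrMr// => h.
rewrite /margin subr_gt0 ltr_pdivrMr// -(ltr_pM2l K0).
have -> : K%:R * (a / K%:R * dN) = a * dN by field; rewrite gt_eqF.
have -> : K%:R * ((alpha - a / K%:R) * (alpha * L)) = alpha * L * (K%:R * alpha - a).
  by field; rewrite gt_eqF.
exact: h.
Qed.

Lemma scaled_norm_overflow z (w : 'cV[R]_n) : z.2 < scaled_norm z.1 ->
  scaled_norm (drift_part z + w) <=
    a * scaled_norm z.1 + 2 / K%:R * (a * dN / 2 + `|w|).
Proof.
rewrite -overflowE => h; have := drift_part_overflow h => hd.
rewrite /scaled_norm.
have -> : a * (2 * `|z.1| / K%:R) + 2 / K%:R * (a * dN / 2 + `|w|) =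
  2 * (a * (`|z.1| + dN / 2) + `|w|) / K%:R by field; rewrite gt_eqF.
rewrite ler_pM2r ?invr_gt0// ler_pM2l//.
by apply: le_trans (ler_normD _ _) _; rewrite lerD2r.
Qed.

(** The quantizers leave [a / K * (z.2 + dN)]. As [z.2 >= alpha * L], the fixed bin [dN] is at most
    [dN / (alpha * L)] times [z.2], and the total factor is [alpha - margin]. *)
Lemma scaled_norm_granular z (w : 'cV[R]_n) : alpha * L <= z.2 ->
  scaled_norm z.1 <= z.2 ->
  scaled_norm (drift_part z + w) <= (alpha - margin) * z.2 + 2 / K%:R * `|w|.
Proof.
move=> hz; rewrite leNgt -overflowE -leNgt => h.
have z20 : 0 < z.2 by exact: lt_le_trans hz.
have hd := drift_part_granular z20 h.
apply: (@le_trans _ _ (a / K%:R * (z.2 + dN) + 2 / K%:R * `|w|)).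
  rewrite /scaled_norm.
  have -> : a / K%:R * (z.2 + dN) + 2 / K%:R * `|w| =
    2 * (a * ((z.2 + dN) / 2) + `|w|) / K%:R by field; rewrite gt_eqF.
  rewrite ler_pM2r ?invr_gt0// ler_pM2l//.
  by apply: le_trans (ler_normD _ _) _; rewrite lerD2r.
rewrite lerD2r.
have -> : alpha - margin = a / K%:R + a / K%:R * dN / (alpha * L).
  by rewrite /margin; ring.
rewrite mulrDr mulrDl lerD2l -[leRHS]mulrA ler_peMr//.
  by rewrite mulr_ge0// ?divr_ge0// ltW// fine_bin_gt0.
by rewrite mulrC ler_pdivlMr// mul1r.
Qed.

Let V2 := lyapunov a alpha rho L.

(** The denominator of the noise term in either regime: [y] in overflow, [D] otherwise. Bounding it
    bounds both components of the state. *)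
Definition regime_size (z : 'cV[R]_n * R) : R := Num.max (scaled_norm z.1) z.2.

(** The overflow and the granular coefficients are added so that one constant serves both regimes;
    [1 + a * dN / 2] accounts for the fine quantization error in overflow. *)
Definition drift_constant : R :=
  overflow_slope a alpha rho * (2 / K%:R) * (1 + a * dN / 2) +
  granular_cost a alpha rho margin * (2 / K%:R).

Let slope0 : 0 < overflow_slope a alpha rho.
Proof.
exact: overflow_slope_gt0 alpha_gt0 (alpha_lt1 params) (rho_gt_norm params) rho_gt1.
Qed.

Let cost0 : 0 <= granular_cost a alpha rho margin.
Proof.
exact: granular_cost_ge0 alpha_gt0 (alpha_lt1 params) (rho_gt_norm params) rho_gt1 _ margin_gt0.
Qed.

Lemma drift_constant_ge0 : 0 <= drift_constant.
Proof.
have dN0 := fine_bin_gt0.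
have K20 : 0 <= 2 / K%:R :> R by rewrite divr_ge0// ltW.
have adN0 : 0 <= a * dN / 2 by rewrite divr_ge0// mulr_ge0// ltW.
have s0 := ltW slope0.
apply: addr_ge0; last exact: mulr_ge0.
by apply: mulr_ge0; [exact: mulr_ge0|exact: addr_ge0].
Qed.

(** The final term stands for granular states with bin below [L], the only ones at which the
    deterministic decrease by 2 fails. *)
Lemma lyapunov_step z w : alpha * L <= z.2 ->
  V2 (scaled_norm (drift_part z + w)) (next_bin K alpha rho L z.1 z.2) + 2
  <= V2 (scaled_norm z.1) z.2 + drift_constant * (`|w| + 1) / regime_size z
     + (if regime_size z < L then 2 else 0).
Proof.
move=> hz; have z20 : 0 < z.2 by exact: lt_le_trans hz.
have dN0 := fine_bin_gt0.
have K20 : 0 < 2 / K%:R :> R by rewrite divr_gt0.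
have adN0 : 0 <= a * dN / 2 by rewrite divr_ge0// mulr_ge0// ltW.
rewrite /next_bin /regime_size overflowE; case: ltP => [ov|gr].
  have o0 : 0 <= 2 / K%:R * (a * dN / 2 + `|w|).
    by apply: mulr_ge0; [exact: ltW|exact: addr_ge0].
  have := lyapunov_overflow alpha_gt0 (alpha_lt1 params) (rho_gt_norm params)
    rho_gt1 L0 hz ov o0 (scaled_norm_overflow w ov).
  move=> /le_trans; apply.
  rewrite /V2 -[leRHS]addrA lerD2l -[leLHS]addr0 lerD//; last by case: ifP.
  have y0 : 0 < scaled_norm z.1 by exact: lt_trans ov.
  rewrite ler_pM2r ?invr_gt0//.
  apply: (@le_trans _ _ (overflow_slope a alpha rho * (2 / K%:R) *
      (1 + a * dN / 2) * (`|w| + 1))); last first.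
    rewrite /drift_constant [leRHS]mulrDl lerDl.
    apply: mulr_ge0; last by rewrite addr_ge0.
    by apply: mulr_ge0 => //; exact: ltW.
  rewrite [leLHS]mulrA -[leRHS]mulrA (ler_pM2l (mulr_gt0 slope0 K20)).
  have := mulr_ge0 adN0 (normr_ge0 w); have := normr_ge0 w.
  move: adN0; set u := a * dN / 2; set v := `|w|.
  by lra.
have o0 : 0 <= 2 / K%:R * `|w| by apply: mulr_ge0; [exact: ltW|].
have := lyapunov_granular alpha_gt0 (alpha_lt1 params) (rho_gt_norm params)
    rho_gt1 L0 margin_gt0 hz gr o0 (scaled_norm_granular w hz gr).
set V' := lyapunov _ _ _ _ _ _ => h.
have hc : granular_cost a alpha rho margin * (2 / K%:R * `|w|) / z.2 <=
    drift_constant * (`|w| + 1) / z.2.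
  rewrite ler_pM2r ?invr_gt0// mulrA.
  apply: (@le_trans _ _ (granular_cost a alpha rho margin * (2 / K%:R) * (`|w| + 1))).
    by rewrite ler_wpM2l ?lerDl// mulr_ge0// ltW.
  rewrite /drift_constant [leRHS]mulrDl lerDr.
  apply: mulr_ge0; last by rewrite addr_ge0.
  apply: mulr_ge0; last by rewrite addr_ge0.
  by apply: mulr_ge0; exact: ltW.
have h2 : (if L <= z.2 then 2 else 0) + (if z.2 < L then 2 else 0) = 2 :> R.
  by rewrite ltNge; case: (L <= z.2); rewrite ?addr0 ?add0r.
rewrite /V2 -[in leLHS]h2 addrA lerD2r; apply: le_trans h _.
by rewrite lerD2l.
Qed.

Local Notation E := (bin_sizes alpha rho L Delta0).

Lemma next_bin_sizes (x : 'cV[R]_n) D : E D -> E (next_bin K alpha rho L x D).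
Proof.
move=> [[j [k DE]] hD]; have D0 : 0 < D by exact: lt_le_trans hD.
rewrite /next_bin; case: ifP => _.
  split; first by exists j, k.+1; rewrite DE exprS; ring.
  by apply: le_trans hD _; rewrite ler_peMl ?(ltW D0)// ltW// rho_gt1.
case: ifP => LD; last by split => //; exists j, k.
split; first by exists j.+1, k; rewrite DE exprS; ring.
by rewrite ler_pM2l// alpha_gt0.
Qed.

End scheme_drift.

(** * Reachability among bin sizes *)

Section bin_dynamics.
Context {R : realType}.
Variables (alpha rho L Delta0 : R).
Hypotheses (alpha_gt0 : 0 < alpha) (alpha_lt1 : alpha < 1) (rho_gt1 : 1 < rho)
  (L_gt0 : 0 < L) (Delta0_ge : L <= Delta0).
Hypothesis alpha_rho : exists j k : nat,
  [/\ (1 <= j)%N, (1 <= k)%N & alpha ^+ j * rho ^+ k = 1].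

Local Notation E := (bin_sizes alpha rho L Delta0).

Lemma exists_expr_lt (x c : R) : 0 <= x < 1 -> 0 < c -> exists p, x ^+ p < c.
Proof.
move=> /andP[x0 x1] c0.
have cv : (GRing.exp x : nat -> R) @ \oo --> 0 by apply: cvg_expr; rewrite ger0_norm.
have : \forall p \near \oo, `|0 - x ^+ p| < c by move/cvgrPdist_lt : cv; apply.
move=> [p _ /(_ p (leqnn p))]; rewrite /= sub0r normrN => h; exists p.
exact: le_lt_trans (ler_norm _) h.
Qed.

Let rho_gt0 : 0 < rho. Proof. exact: lt_trans rho_gt1. Qed.
Let D00 : 0 < Delta0. Proof. exact: lt_le_trans Delta0_ge. Qed.
Let aL0 : 0 < alpha * L. Proof. by rewrite mulr_gt0. Qed.
Let a_le1 p : alpha ^+ p <= 1. Proof. by rewrite exprn_ile1// ltW. Qed.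
Let ap0 p : 0 <= alpha ^+ p. Proof. by rewrite exprn_ge0// ltW. Qed.
Let rp0 p : 0 <= rho ^+ p. Proof. by rewrite exprn_ge0// ltW. Qed.
Let r_ge1 p : 1 <= rho ^+ p. Proof. by rewrite exprn_ege1// ltW. Qed.

Lemma bin_gt0 D : E D -> 0 < D.
Proof. by move=> [_]; apply: lt_le_trans. Qed.

(** The relation [alpha ^+ j * rho ^+ k = 1] removes [j] and [k] from the exponents as long as both
    are large, so one of them may be taken below [j] or [k]. Then [alpha * L <= D] bounds the
    exponent of [alpha], or [D <= r] that of [rho]. *)
Lemma finite_bins r : finite_set [set D | E D /\ D <= r].
Proof.
have [j [k [j1 k1 ajk]]] := alpha_rho.
have norm p q : exists p' q', [/\ alpha ^+ p * rho ^+ q = alpha ^+ p' * rho ^+ q' &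
    (p' < j)%N || (q' < k)%N].
  have [m] := ubnP p; elim: m p q => // m IH p q; rewrite ltnS => pm.
  have [pj|pj] := ltnP p j; first by exists p, q; rewrite pj.
  have [qk|qk] := ltnP q k; first by exists p, q; rewrite qk orbT.
  have [|p' [q' [e h]]] := IH (p - j)%N (q - k)%N.
    by rewrite (leq_trans _ pm)// ltn_subrL j1 (leq_trans j1 pj).
  exists p', q'; split => //; rewrite -e -{1}(subnK pj) -{1}(subnK qk) !exprD.
  by rewrite mulrACA ajk mulr1.
have [P1 hP1] : exists p, alpha ^+ p < alpha * L / (rho ^+ k * Delta0).
  by apply: exists_expr_lt; rewrite ?ltW//= divr_gt0// mulr_gt0// exprn_gt0.
(* [r] has no prescribed sign; the maximum makes the threshold below positive. *)
pose r' := Num.max r 1.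
have r'0 : 0 < r' by rewrite lt_max ltr01 orbT.
have [Q1 hQ1] : exists q, rho^-1 ^+ q < alpha ^+ j * Delta0 / r'.
  apply: exists_expr_lt; first by rewrite invr_ge0 ltW//= invf_lt1.
  by rewrite divr_gt0// mulr_gt0// exprn_gt0.
pose P2 := maxn P1 j; pose Q2 := maxn Q1 k.
apply: (@sub_finite_set _ _ ((fun pq : nat * nat => alpha ^+ pq.1 * rho ^+ pq.2 * Delta0)
    @` (`I_P2 `*` `I_Q2))); last first.
  by apply: finite_image; apply: finite_setX; exact: finite_II.
move=> D /= [[[p [q DE]] hD] Dr].
have [p' [q' [e h]]] := norm p q; rewrite e in DE.
have apr : 0 < alpha ^+ p' * rho ^+ q' by rewrite mulr_gt0// exprn_gt0.
exists (p', q') => //=; rewrite /P2 /Q2 !leq_max.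
have qk_p : (q' < k)%N -> (p' < P1)%N.
  move=> qk; rewrite ltnNge; apply/negP => Pp.
  have : D < alpha * L; last by rewrite ltNge hD.
  rewrite DE; apply: (@le_lt_trans _ _ (alpha ^+ P1 * rho ^+ k * Delta0)).
    rewrite ler_pM2r//; apply: ler_pM => //.
      by rewrite (ler_wiXn2l (ltW alpha_gt0) (ltW alpha_lt1)).
    by rewrite (ler_weXn2l (ltW rho_gt1))// ltnW.
  by rewrite -mulrA -ltr_pdivlMr// mulr_gt0// exprn_gt0.
have pj_q : (p' < j)%N -> (q' < Q1)%N.
  move=> pj; rewrite ltnNge; apply/negP => Qq.
  have : r' < D; last by rewrite ltNge le_max Dr.
  rewrite DE; apply: (@lt_le_trans _ _ (alpha ^+ j * rho ^+ Q1 * Delta0)).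
    move: hQ1; rewrite exprVn ltr_pdivlMr// mulrC -ltr_pdivlMr ?invr_gt0 ?exprn_gt0//.
    by rewrite invrK mulrAC.
  rewrite ler_pM2r//; apply: ler_pM => //.
    by rewrite (ler_wiXn2l (ltW alpha_gt0) (ltW alpha_lt1))// ltnW.
  by rewrite (ler_weXn2l (ltW rho_gt1)).
by case/orP: h => [h|h]; [rewrite h (pj_q h) orbT|rewrite h (qk_p h) orbT].
Qed.

Definition bin_down D : R := if L <= D then alpha * D else D.

(** Expansion and non-overflow are chosen freely at each step: the vector component is left out
    because the noise can realize either choice. *)
Fixpoint bin_path (Dstar : R) (k : nat) (D : R) : Prop :=
  if k is k'.+1 then bin_path Dstar k' (rho * D) \/ bin_path Dstar k' (bin_down D)
  else D = Dstar.

Lemma bin_path_up Dstar i l D :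
  bin_path Dstar l (rho ^+ i * D) -> bin_path Dstar (i + l) D.
Proof.
elim: i D => [D|i IH D]; first by rewrite expr0 mul1r.
by rewrite exprSr -mulrA => /IH h; rewrite addSn; left.
Qed.

Lemma bin_path_down Dstar l D : alpha * L <= Dstar -> alpha ^+ l * D = Dstar ->
  bin_path Dstar l D.
Proof.
move=> hs; elim: l D => [D|l IH D]; first by rewrite expr0 mul1r.
rewrite exprSr -mulrA => h; right; rewrite /bin_down ifT; first exact: IH.
have D0 : 0 < D.
  by rewrite -(pmulr_rgt0 _ alpha_gt0) -(pmulr_rgt0 _ (exprn_gt0 l alpha_gt0)) h
    (lt_le_trans _ hs).
rewrite -(ler_pM2l alpha_gt0); apply: le_trans hs _.
by rewrite -h ler_piMl// mulr_ge0// ltW.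
Qed.

(** [Dstar < L] is a fixed point of [bin_down], so a path may be prolonged at its end. *)
Lemma bin_path_wait Dstar k D : Dstar < L -> bin_path Dstar k D ->
  forall k', (k <= k')%N -> bin_path Dstar k' D.
Proof.
move=> hs h k' /subnK <-; elim: (k' - k)%N => // i; rewrite addSn.
elim: (i + k)%N D {h} => [D ->|m IH D []]/=.
- by right; rewrite /bin_down leNgt hs.
- by move=> h; left; exact: IH.
- by move=> h; right; exact: IH.
Qed.

Lemma exists_bin_path : exists2 Dstar, E Dstar & Dstar < L /\
  forall D, E D -> exists k, bin_path Dstar k D.
Proof.
have [j [k [j1 k1 ajk]]] := alpha_rho.
have exP : exists p, alpha ^+ p * Delta0 < L.
  have [||p hp] := @exists_expr_lt alpha (L / Delta0).
  - by rewrite ltW.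
  - by rewrite divr_gt0.
  by exists p; rewrite -ltr_pdivlMr.
case: (ex_minnP exP) => -[|ps] hps mins.
  by move: hps; rewrite expr0 mul1r ltNge Delta0_ge.
(* The first [alpha ^+ p * Delta0] below [L]. By minimality its predecessor is at least [L], so
   [Dstar >= alpha * L]. *)
pose Dstar := alpha ^+ ps.+1 * Delta0.
have LD : L <= alpha ^+ ps * Delta0.
  by rewrite leNgt; apply/negP => /mins; rewrite ltnn.
have aLD : alpha * L <= Dstar by rewrite /Dstar exprS -mulrA ler_pM2l.
exists Dstar; first by split => //; exists ps.+1, 0%N; rewrite expr0 mulr1.
split => // D [[p [q DE]] hD].
(* After [(k - 1) * q] expansions the exponent of [rho] is [k * q], and [j * q] contractions cancel
   it by the relation; only powers of [alpha] remain to be adjusted. *)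
pose i := ((k - 1) * q)%N; pose M := rho ^+ i * D.
have DM : alpha * L <= M.
  apply: (le_trans hD); rewrite ler_peMl// ltW//.
  exact: lt_le_trans hD.
have ME : alpha ^+ (j * q) * M = alpha ^+ p * Delta0.
  rewrite /M DE; have e1 : (alpha ^+ j * rho ^+ k) ^+ q = 1 by rewrite ajk expr1n.
  have -> : alpha ^+ (j * q) * (rho ^+ i * (alpha ^+ p * rho ^+ q * Delta0)) =
     (alpha ^+ (j * q) * (rho ^+ i * rho ^+ q)) * (alpha ^+ p * Delta0) by ring.
  rewrite -exprD /i -{3}(mul1n q) -mulnDl subnK// !exprM -exprMn e1.
  by rewrite mul1r.
(* The number of contractions must not be negative. Otherwise [Dstar < L] would put [M] below
   [alpha * L]. *)
have ple : (p <= j * q + ps.+1)%N.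
  rewrite leqNgt; apply/negP => pgt.
  have : alpha ^+ p * Delta0 < alpha ^+ p * Delta0; last by rewrite ltxx.
  rewrite -{2}ME; apply: (@lt_le_trans _ _ (alpha ^+ (j * q) * (alpha * L))); last first.
    by rewrite ler_pM2l// exprn_gt0.
  apply: (@le_lt_trans _ _ (alpha ^+ (j * q) * (alpha * Dstar))).
    by rewrite /Dstar !mulrA -exprSr -exprD ler_pM2r// (ler_wiXn2l (ltW alpha_gt0) (ltW alpha_lt1))//.
  by rewrite (ltr_pM2l (exprn_gt0 _ alpha_gt0)) ltr_pM2l.
exists (i + (j * q + ps.+1 - p))%N; apply: bin_path_up; apply: bin_path_down => //.
apply: (mulfI (lt0r_neq0 (exprn_gt0 p alpha_gt0))) => /=.
rewrite -/M mulrA -exprD subnKC// addnC exprD -mulrA ME /Dstar; ring.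
Qed.

(** Finitely many bins lie below [r]; waiting at [Dstar] brings all their paths to the maximal
    length. *)
Lemma uniform_bin_path r : exists2 Dstar, E Dstar & Dstar < L /\
  exists k, forall D, E D -> D <= r -> bin_path Dstar k D.
Proof.
have [Dstar ED [hs h]] := exists_bin_path.
exists Dstar => //; split => //.
have /finite_seqP[s sE] := finite_bins r.
have {}h D : exists k, E D -> bin_path Dstar k D.
  have [ED'|nED] := pselect (E D); last by exists 0%N => /nED.
  by have [k hk] := h D ED'; exists k.
have [kk hkk] := choice h.
exists (\max_(D <- s) kk D) => D ED' Dr.
apply: (bin_path_wait hs (hkk D ED')).
apply: leq_bigmax_seq => //.
by have : [set D | E D /\ D <= r] D by []; rewrite sE.
Qed.

End bin_dynamics.

(** * Foster-Lyapunov drift of the scheme *)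

Section scheme_operator_drift.
Context {R : realType} {n : nat}.
Variables (A B : 'M[R]_n) (beta eps : R) (K : nat) (alpha rho L Delta0 : R).
Hypothesis B_unit : B \in unitmx.
Hypothesis params : scheme_parameters A beta eps K alpha rho L Delta0.
Variable N : nat.
Hypotheses (N_even : ~~ odd N) (N_ge2 : (2 <= N)%N).
Variables (mu : probability 'cV[R]_n R) (m1 : R).
Hypothesis m1_ge0 : 0 <= m1.
Hypothesis mu_moment : (\int[mu]_w (`|w|)%:E <= m1%:E)%E.

Local Notation E := (state_space alpha rho L Delta0 : set ('cV[R]_n * R)).
Local Notation F := (scheme_map A B beta eps K alpha rho L N).
Local Notation Pop := (markov_op mu F).
Local Notation V2 := (lyapunov (opnorm A) alpha rho L).
Local Notation H := (drift_constant A beta eps K alpha rho L N).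

Lemma measurable_bin_sizes : measurable (bin_sizes alpha rho L Delta0).
Proof.
have -> : bin_sizes alpha rho L Delta0 =
   \bigcup_j \bigcup_k ([set alpha ^+ j * rho ^+ k * Delta0] `&` `[alpha * L, +oo[%classic).
  apply/seteqP; split => [D [[j [k ->]] h]|D [j _ [k _ [-> h]]]].
    by exists j => //; exists k => //; split => //=; rewrite in_itv/= andbT.
  by split; [exists j, k|move: h; rewrite /= in_itv/= andbT].
apply: bigcupT_measurable => j; apply: bigcupT_measurable => k.
by apply: measurableI.
Qed.

Lemma measurable_state_space : measurable E.
Proof.
by rewrite -[X in measurable X]setTI; apply: measurable_snd => //; exact: measurable_bin_sizes.
Qed.

Lemma scheme_map_state_space z w : E z -> E (F (z, w)).
Proof. by move=> Ez; apply: (next_bin_sizes params). Qed.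

Definition lyapunov_state (z : 'cV[R]_n * R) : \bar R :=
  if z \in E then (V2 (scaled_norm K z.1) z.2)%:E else +oo%E.

Lemma measurable_scaled_norm : measurable_fun setT (@scaled_norm R n K).
Proof.
apply: measurable_funM; last exact: measurable_cst.
apply: measurable_funM; first exact: measurable_cst.
exact: measurable_norm_cV.
Qed.

Let m2 : measurable_fun [set: 'cV[R]_n * R] snd. Proof. exact: measurable_snd. Qed.

Let msn : measurable_fun [set: 'cV[R]_n * R] (fun z => scaled_norm K z.1).
Proof. by apply: (measurableT_comp measurable_scaled_norm); exact: measurable_fst. Qed.

Lemma measurable_lyapunov_state : measurable_fun setT lyapunov_state.
Proof.
apply: measurable_fun_ifT.
- apply: (measurable_fun_bool true).
  rewrite setTI (_ : _ @^-1` _ = E); first exact: measurable_state_space.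
  by apply/seteqP; split => z; [exact: set_mem|exact: mem_set].
- apply/measurable_EFinP; apply: measurable_funD.
    apply: measurable_funM; first exact: measurable_cst.
    apply: (measurableT_comp (@measurable_ln R)).
    by apply: measurable_funM => //; exact: measurable_cst.
  apply: measurable_fun_ifT.
  + exact: measurable_fun_ltr.
  + apply: measurable_funD; first exact: measurable_cst.
    apply: measurable_funM; first exact: measurable_cst.
    apply: (measurableT_comp (@measurable_ln R)).
    apply: measurable_funM => //.
    exact: (measurableT_comp measurable_invr).
  + exact: measurable_cst.
- exact: measurable_cst.
Qed.

Let V2_ge0 y D : alpha * L <= D -> 0 <= V2 y D.
Proof.
exact: (lyapunov_ge0 (alpha_gt0 params) (alpha_lt1 params) (rho_gt_norm params)
  (rho_gt1 params) (L_gt0 params)).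
Qed.

Lemma lyapunov_state_ge0 z : (0 <= lyapunov_state z)%E.
Proof.
by rewrite /lyapunov_state; case: ifPn => // /set_mem [_ h]; rewrite lee_fin V2_ge0.
Qed.

(** Beyond [L] the bin cannot be waiting; beyond [H * (m1 + 1)] the mean noise term is below 1, so
    half of the decrease by 2 survives. *)
Definition radius : R := Num.max L (H * (m1 + 1)).

Definition core_set : set ('cV[R]_n * R) :=
  E `&` [set z | regime_size K z <= radius].

(** On the core set [regime_size] is still at least [alpha * L], which bounds the noise term; the
    added 1 is what the waiting case lacks. *)
Definition drift_bound : R := H * (m1 + 1) / (alpha * L) + 1.

Let H0 : 0 <= H. Proof. exact: drift_constant_ge0 params _ N_even N_ge2. Qed.

Let aL0 : 0 < alpha * L.
Proof. by rewrite mulr_gt0 ?(L_gt0 params)// (alpha_gt0 params). Qed.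

Let Hm0 : 0 <= H * (m1 + 1). Proof. by rewrite mulr_ge0// addr_ge0. Qed.

Lemma drift_bound_ge0 : 0 <= drift_bound.
Proof. by rewrite addr_ge0// divr_ge0// ltW. Qed.

Lemma measurable_core_set : measurable core_set.
Proof.
apply: measurableI; first exact: measurable_state_space.
rewrite -[X in measurable X]setTI; apply: measurable_fun_le => //.
  exact: measurable_maxr.
Qed.

Let integrated z : E z -> (Pop lyapunov_state z + 2%:E <=
  (V2 (scaled_norm K z.1) z.2 + H * (m1 + 1) / regime_size K z
     + (if regime_size K z < L then 2 else 0))%:E)%E.
Proof.
move=> Ez; have hz : alpha * L <= z.2 by have [] := Ez.
have r0 : 0 < regime_size K z by rewrite lt_max (lt_le_trans aL0 hz) orbT.
set i := (if _ then _ else _); have i0 : 0 <= i by rewrite /i; case: ifP.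
set v := V2 _ _; have v0 : 0 <= v by exact: V2_ge0.
have -> : (2%:E = \int[mu]_w cst 2%:E w :> \bar R)%E.
  by rewrite integral_cst// [X in (_ * X)%E](probability_setT mu) mule1.
have mFz : measurable_fun setT (fun w => F (z, w)).
  by apply: measurableT_comp; [exact: measurable_scheme_map|exact: measurable_pair1].
have mVF : measurable_fun setT (fun w => lyapunov_state (F (z, w))).
  by apply: (measurableT_comp measurable_lyapunov_state).
have V0F w : (0 <= lyapunov_state (F (z, w)))%E by exact: lyapunov_state_ge0.
rewrite /markov_op -ge0_integralD//; last by move=> w _; rewrite lee_fin.
have mnorm : measurable_fun [set: 'cV[R]_n] (fun w => (`|w|)%:E).
  by apply/measurable_EFinP; exact: measurable_norm_cV.
apply: (@le_trans _ _ (\int[mu]_w ((v + i + H / regime_size K z)%:E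
    + (H / regime_size K z)%:E * (`|w|)%:E))%E).
  apply: ge0_le_integral => //.
  - by move=> w _; apply: adde_ge0 => //; rewrite lee_fin.
  - exact: emeasurable_funD.
  - by apply: emeasurable_funD => //; exact: emeasurable_funM.
  - move=> w _; have := scheme_map_state_space w Ez.
    rewrite /lyapunov_state => EF; rewrite mem_set// -EFinM -!EFinD lee_fin.
    have := lyapunov_step B_unit params N_even N_ge2 w hz.
    move=> /le_trans; apply.
    by rewrite -/v -/i le_eqVlt; apply/orP; left; apply/eqP; ring.
have hr0 : 0 <= H / regime_size K z by rewrite divr_ge0// ltW.
have c0 : 0 <= v + i + H / regime_size K z.
  by apply: addr_ge0 => //; exact: addr_ge0.
rewrite ge0_integralD; last 5 first.
- exact: measurableT.
- by move=> w _; rewrite lee_fin.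
- exact: measurable_cst.
- by move=> w _; rewrite mule_ge0.
- exact: emeasurable_funM.
rewrite integral_cst// [X in (_ * X + _)%E](probability_setT mu) mule1.
rewrite ge0_integralZl//.
have hm : ((H / regime_size K z)%:E * (\int[mu]_w (`|w|)%:E)
    <= (H / regime_size K z)%:E * m1%:E)%E by rewrite lee_wpmul2l.
apply: le_trans (leeD2l _ hm) _; rewrite -EFinM -EFinD lee_fin.
by rewrite le_eqVlt; apply/orP; left; apply/eqP; ring.
Qed.

Lemma lyapunov_state_drift z : (Pop lyapunov_state z + 1 <=
  lyapunov_state z + (drift_bound * \1_core_set z)%:E)%E.
Proof.
have [Ez|nEz] := pselect (E z); last first.
  by rewrite {2}/lyapunov_state memNset// addye// leey.
have hz : alpha * L <= z.2 by have [] := Ez.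
have rz : alpha * L <= regime_size K z by rewrite le_max hz orbT.
have r0 : 0 < regime_size K z by exact: lt_le_trans rz.
rewrite -(@leeD2rE _ 1%E)// {2}/lyapunov_state mem_set//.
rewrite -addeA -EFinD; apply: le_trans (integrated Ez) _.
rewrite -!EFinD lee_fin indicE; move: (V2 _ _) => v.
have [Cz|nCz] := pselect (core_set z).
  rewrite mem_set// mulr1 /drift_bound -!addrA lerD2l; apply: lerD.
    by rewrite ler_wpM2l// lef_pV2 ?posrE.
  by case: ifP => _; lra.
rewrite memNset// mulr0 addr0.
have rR : radius < regime_size K z.
  by rewrite ltNge; apply/negP => h; apply: nCz.
have /andP[LR HR] : (L < regime_size K z) && (H * (m1 + 1) < regime_size K z).
  by rewrite -gt_max.
rewrite ltNge (ltW LR) /= addr0 lerD2l ler_pdivrMr// mul1r.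
exact: ltW.
Qed.

End scheme_operator_drift.

(** One copy of [lam] on each layer [y] in [s]. With [s] the finitely many bins reachable in one
    step from the core set, it is the reference measure of the minorization. *)
Lemma exists_layered_measure d d' (X : measurableType d) (Y : measurableType d')
    (R : realType) (lam : {finite_measure set X -> \bar R}) (y0 : Y) (s : seq Y) :
  exists refm : {finite_measure set (X * Y)%type -> \bar R},
    (forall Q y, y \in s -> (lam [set x | Q (x, y)] <= refm Q)%E) /\
    (forall Q, (forall x y, y \in s -> ~ Q (x, y)) -> refm Q = 0%E).
Proof.
have mp (y : Y) : measurable_fun setT (fun x : X => (x, y)).
  by apply: measurable_fun_pair; [exact: measurable_id|exact: measurable_cst].
pose u (i : nat) := measure_function_pushforward__canonical__measure_function_Measure
  lam (mp (nth y0 s i)).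
have fin : (msum u (size s) setT < +oo)%E.
  rewrite /msum; apply/lte_sum_pinfty => i _.
  by rewrite /= /pushforward preimage_setT -ge0_fin_numE// fin_num_measure.
exists (mfrestr measurableT fin); split.
- move=> Q y ys; rewrite /= /mfrestr /mrestr setIT /msum.
  have iy : (index y s < size s)%N by rewrite index_mem.
  rewrite (bigD1 (Ordinal iy))//= /pushforward nth_index//.
  by apply: leeDl; apply: sume_ge0.
- move=> Q hQ; rewrite /= /mfrestr /mrestr setIT /msum big1// => i _.
  rewrite /= /pushforward (_ : _ @^-1` Q = set0) ?measure0//.
  by apply/seteqP; split => // x; apply: hQ; exact: mem_nth.
Qed.

Lemma measurable_lt_set d (T : measurableType d) (R : realType) (f g : T -> R) :
  measurable_fun setT f -> measurable_fun setT g ->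
  measurable [set x | f x < g x].
Proof.
move=> mf mg; have -> : [set x | f x < g x] = ~` (setT `&` [set x | g x <= f x]).
  by rewrite setTI; apply/seteqP; split => x /=; rewrite ltNge => /negP.
by apply: measurableC; exact: measurable_fun_le.
Qed.

(** * The core set is small *)

Section scheme_small_set.
Context {R : realType} {n : nat}.
Hypothesis n_gt0 : (0 < n)%N.
Variables (A B : 'M[R]_n) (beta eps : R) (K : nat) (alpha rho L Delta0 : R).
Hypothesis B_unit : B \in unitmx.
Hypothesis params : scheme_parameters A beta eps K alpha rho L Delta0.
Variable N : nat.
Hypotheses (N_even : ~~ odd N) (N_ge2 : (2 <= N)%N).
Variables (mu : probability 'cV[R]_n R) (m1 : R).
Hypothesis m1_ge0 : 0 <= m1.
Hypothesis mu_moment : (\int[mu]_w (`|w|)%:E <= m1%:E)%E.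
Variable eta : 'cV[R]_n -> R.
Hypothesis eta_measurable : measurable_fun setT eta.
Hypothesis eta_gt0 : forall x, 0 < eta x.
Hypothesis mu_density : forall D : set 'cV[R]_n, measurable D ->
  mu D = (\int[lebesgue_cV n]_(x in D) (eta x)%:E)%E.

Local Notation S := ('cV[R]_n * R)%type.
Local Notation E := (state_space alpha rho L Delta0 : set S).
Local Notation F := (scheme_map A B beta eps K alpha rho L N).
Local Notation Pop := (markov_op mu F).
Local Notation ind A := (fun x : S => (\1_A x)%:E : \bar R).
Local Notation f := (drift_part A B beta eps K N).
Local Notation nb y := (next_bin K alpha rho L y.1 y.2).
Local Notation C := (core_set A beta eps K alpha rho L Delta0 N m1).

Let K0 : 0 < K%:R :> R.
Proof. by rewrite ltr0n; exact: leq_trans (K_ge2 params). Qed.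

Let al0 : 0 < alpha. Proof. exact: alpha_gt0 params. Qed.
Let rh1 : 1 < rho. Proof. exact: rho_gt1 params. Qed.
Let aL0 : 0 < alpha * L. Proof. by rewrite mulr_gt0// (L_gt0 params). Qed.

Lemma core_set_bounds : exists2 r, 0 <= r & forall z, C z -> `|f z| <= r /\ z.2 <= r.
Proof.
pose q := Num.max 0 (radius A beta eps K alpha rho L N m1).
have q0 : 0 <= q by rewrite le_max lexx.
have dN0 : 0 < fine_bin beta eps N by exact: fine_bin_gt0.
have a0 : 0 <= opnorm A by exact: opnorm_ge0.
exists (opnorm A * (K%:R / 2 * q + q + fine_bin beta eps N) + q).
  have K20 : 0 <= K%:R / 2 :> R by rewrite divr_ge0// ltW.
  by rewrite addr_ge0// mulr_ge0// addr_ge0 ?(ltW dN0)// addr_ge0// mulr_ge0.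
move=> z [[_ hz]]; rewrite /= ge_max => /andP[h1 h2].
have z20 : 0 < z.2 by exact: lt_le_trans hz.
have zq : z.2 <= q by rewrite le_max h2 orbT.
have xq : `|z.1| <= K%:R / 2 * q.
  have : scaled_norm K z.1 <= q by rewrite le_max h1 orbT.
  rewrite /scaled_norm ler_pdivrMr// => h.
  by rewrite -(ler_pM2l (ltr0n R 2)) (le_trans h)// le_eqVlt; apply/orP; left;
    apply/eqP; field.
have K2q : 0 <= K%:R / 2 * q by apply: le_trans xq.
split; last first.
  rewrite (le_trans zq)// lerDr mulr_ge0// addr_ge0 ?(ltW dN0)// addr_ge0//.
apply: (@le_trans _ _ (opnorm A * (K%:R / 2 * q + q + fine_bin beta eps N))).
  have [gr|ov] := leP `|z.1| (K%:R / 2 * z.2).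
    apply: (le_trans (@drift_part_granular R n A B beta eps K B_unit N N_ge2 z z20 gr)).
    by rewrite ler_wpM2l//; lra.
  apply: (le_trans (@drift_part_overflow R n A B beta eps K B_unit N N_ge2 z ov)).
  by rewrite ler_wpM2l//; lra.
by rewrite lerDl.
Qed.

(** Markov's inequality at [4 * m1 + 4]; the summand 4 keeps the threshold positive when [m1] is
    0. *)
Lemma noise_tail : exists2 r, 0 < r &
  (mu [set w | (r <= `|w|)%R] <= (4^-1)%:E)%E.
Proof.
have r0 : 0 < 4 * m1 + 4 by rewrite ltr_pwDr// mulr_ge0.
exists (4 * m1 + 4) => //.
have mn : measurable_fun [set: 'cV[R]_n] (fun w => (`|w|)%:E).
  by apply/measurable_EFinP; exact: measurable_norm_cV.
have := le_integral_abse mu measurableT mn r0.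
rewrite setTI; under eq_set do rewrite /= normr_id lee_fin.
set T := [set w | _] => h.
have mT : measurable T.
  rewrite -[T]setTI; apply: measurable_fun_le => //; exact: measurable_norm_cV.
have : ((4 * m1 + 4)%:E * mu T <= m1%:E)%E.
  apply: le_trans h _; rewrite (le_trans _ mu_moment)//.
  by rewrite le_eqVlt; apply/orP; left; apply/eqP; apply: eq_integral => w _ /=;
    rewrite normr_id.
rewrite -(@fineK _ (mu T)) ?fin_num_measure// -EFinM !lee_fin => h2.
by rewrite -(ler_pM2l r0) (le_trans h2)//; lra.
Qed.

(** Either the noise is large, with probability at most 1/4, or the next vector lies in a fixed
    cube, where a set of small Lebesgue measure receives at most 1/4. Translation invariance makes
    [kap] independent of [s]. *)
Lemma core_set_first_step : exists2 r, 0 < r & exists2 kap, 0 < kap &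
  forall s (Q : set S), C s -> measurable Q ->
  (lebesgue_cV n ([set x | Q (x, nb s)] `&` cube 0 r) < kap%:E)%E ->
  (Pop (ind Q) s <= (2^-1)%:E)%E.
Proof.
have [q q0 hq] := core_set_bounds; have [t t0 ht] := noise_tail.
have [//|kap kap0 hk] := density_absolutely_continuous eta_measurable eta_gt0 mu_density (_ : 0 < 4^-1).
exists (q + t); first by rewrite ltr_wpDl.
exists kap => // s Q Cs mQ lq.
have [fs _] := hq s Cs.
pose Q1 := [set x | Q (x, nb s)].
have mQ1 : measurable Q1.
  by rewrite -[Q1]setTI; exact: (measurable_pair2 (nb s) measurableT mQ).
have mcube : measurable (cube (0 : 'cV[R]_n) (q + t)) by exact: measurable_cube.
pose T1 := (fun w => w + f s) @^-1` (Q1 `&` cube 0 (q + t)).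
pose T2 := [set w : 'cV[R]_n | t <= `|w|].
have mT1 : measurable T1.
  rewrite -[T1]setTI; apply: measurable_translation => //; exact: measurableI.
have mT2 : measurable T2.
  rewrite -[T2]setTI; apply: measurable_fun_le => //; exact: measurable_norm_cV.
have muT1 : (mu T1 <= (4^-1)%:E)%E.
  apply: hk => //; rewrite lebesgue_cV_translation//; exact: measurableI.
apply: (@le_trans _ _ (mu (T1 `|` T2))).
  rewrite /markov_op -[leRHS]mul1e -integral_cst; last exact: measurableU.
  rewrite [leRHS]integral_mkcond; apply: ge0_le_integral => //.
  - have mFs : measurable_fun setT (fun w => F (s, w)).
      by apply: measurableT_comp; [exact: measurable_scheme_map|exact: measurable_pair1].
    have mi : measurable_fun setT (ind Q) by exact: measurable_eindic.
    exact: (measurableT_comp mi mFs).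
  - apply/(measurable_restrictT _ (measurableU _ _ mT1 mT2)); exact: measurable_cst.
  - move=> w _; rewrite patchE indicE.
    have [/set_mem Qw|//] := boolP (F (s, w) \in Q); last first.
      by case: ifP.
    rewrite mem_set//.
    have [tw|wt] := leP t `|w|; first by right.
    left; split; rewrite /Q1/=; first by rewrite addrC.
    move: (f s) fs => v vq i; rewrite !mxE subr0.
    apply: (@le_trans _ _ (`|v i 0| + `|w i 0|)); first by rewrite [leRHS]addrC ler_normD.
    apply: lerD; first exact: (le_trans (coord_le_norm v i)).
    exact: (le_trans (coord_le_norm w i) (ltW wt)).
apply: le_trans (measureU2 mu mT1 mT2) _.
apply: le_trans (leeD muT1 ht) _.
by rewrite -EFinD lee_fin; lra.
Qed.

Lemma overflow_granular_gt0 (y : S) : 0 < nb y ->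
  (0 < mu [set w | (K%:R / 2 * nb y < `|f y + w|)%R])%E /\
  (0 < mu [set w | (`|f y + w| <= K%:R / 2 * nb y)%R])%E.
Proof.
move=> ny0; move: (K%:R / 2 * nb y) (mulr_gt0 (divr_gt0 K0 (ltr0n R 2)) ny0) => q q0.
move: (f y) => v.
have mfy : measurable_fun [set: 'cV[R]_n] (fun w => `|v + w|).
  under eq_fun do rewrite addrC.
  exact: (measurableT_comp (@measurable_norm_cV R n) (measurable_translation (v))).
have big (c : 'cV[R]_n) r (T : set 'cV[R]_n) : measurable T -> 0 < r ->
    cube c r `<=` T -> (0 < mu T)%E.
  move=> mT r0 cT; apply: (density_gt0 eta_measurable eta_gt0 mu_density mT).
  apply: (@lt_le_trans _ _ (lebesgue_cV n (cube c r))).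
    by rewrite lebesgue_cV_cube ?(ltW r0)// lte_fin exprn_gt0// mulr_gt0.
  by apply: le_measure => //; rewrite inE//; exact: measurable_cube.
split.
(* On this cube every coordinate of [v + w] is at least [q + 1]; one coordinate suffices, and
   [n_gt0] provides it. *)
- apply: (big (const_mx (q + 2) - v) 1) => //.
    apply: measurable_lt_set => //.
  move=> w h /=; apply: lt_le_trans (coord_le_norm _ (Ordinal n_gt0)).
  have := h (Ordinal n_gt0); rewrite !mxE ler_distl => /andP[h1 _].
  by apply: lt_le_trans (ler_norm _); lra.
- apply: (big (- v) q) => //.
    rewrite -[X in measurable X]setTI; apply: measurable_fun_le => //.
  move=> w h /=; apply/le_norm_cV; first exact: ltW.
  by move=> i; have := h i; rewrite !mxE opprK addrC.
Qed.

Section last_step.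
Variable Dstar : R.

(** The next bin is determined by [y], so a step enters the layer [Dstar] either surely or never; in
    the first case the vector has the translated noise density. *)
Definition last_step_density (yz : S * 'cV[R]_n) : \bar R :=
  if nb yz.1 == Dstar then (eta (yz.2 - f yz.1))%:E else 0%E.

Lemma measurable_last_step_density : measurable_fun setT last_step_density.
Proof.
have mfst : measurable_fun [set: S * 'cV[R]_n] fst by exact: measurable_fst.
have msnd : measurable_fun [set: S * 'cV[R]_n] snd by exact: measurable_snd.
apply: measurable_fun_ifT.
- apply: measurable_fun_eqr; last exact: measurable_cst.
  exact: (measurableT_comp (measurable_next_bin _ _ _ _) mfst).
- apply/measurable_EFinP; apply: (measurableT_comp eta_measurable).
  apply: measurable_addmx_cV => //; apply: measurable_oppmx_cV.
  exact: (measurableT_comp (measurable_drift_part _ _ _ _ _ _) mfst).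
- exact: measurable_cst.
Qed.

Lemma last_step_density_ge0 yz : (0 <= last_step_density yz)%E.
Proof. by rewrite /last_step_density; case: ifP => // _; rewrite lee_fin ltW. Qed.

Lemma measurable_with_bin D : measurable_fun setT (fun z : 'cV[R]_n => (z, D) : S).
Proof. exact: measurable_pair2. Qed.

Lemma last_step_densityP (Z : set 'cV[R]_n) (mZ : measurable Z) (Q : set S) y :
  measurable Q ->
  (\int[mrestr (lebesgue_cV n) mZ]_(z in (fun z => (z, Dstar)) @^-1` Q)
    last_step_density (y, z) <= Pop (ind Q) y)%E.
Proof.
move=> mQ; rewrite /last_step_density /=.
case: eqP => [yD|_]; last first.
  by rewrite integral0; apply: markov_op_ge0; exact: eindic_ge0.
pose Q1 := (fun z : 'cV[R]_n => (z, Dstar)) @^-1` Q.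
have mQ1 : measurable Q1 by rewrite -[Q1]setTI; exact: measurable_with_bin.
have me : measurable_fun setT (fun z : 'cV[R]_n => (eta (z - f y))%:E).
  apply/measurable_EFinP.
  exact: (measurableT_comp eta_measurable (measurable_translation (- f y))).
have -> : Pop (ind Q) y = mu ((fun x : 'cV[R]_n => f y + x) @^-1` Q1).
  have mT : measurable ((fun x : 'cV[R]_n => f y + x) @^-1` Q1).
    under eq_fun do rewrite addrC.
    by rewrite -[X in measurable X]setTI; exact: measurable_translation.
  rewrite /markov_op -[RHS]mul1e -integral_cst// [RHS]integral_mkcond.
  apply: eq_integral => w _; rewrite patchE indicE scheme_mapE /= yD.
  have [h|h] := pselect (Q (f y + w, Dstar)); first by rewrite !mem_set.
  by rewrite !memNset.
rewrite (density_translation eta_measurable eta_gt0 mu_density)//.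
rewrite integral_mkcond ge0_integral_mrestr//.
- rewrite [leRHS]integral_mkcond; apply: ge0_subset_integral => //.
    by apply/(measurable_restrictT _ mQ1); exact: measurable_funTS.
  by move=> z _; rewrite patchE; case: ifP => // _; rewrite lee_fin ltW.
- by apply/(measurable_restrictT _ mQ1); exact: measurable_funTS.
- by move=> z; rewrite patchE; case: ifP => // _; rewrite lee_fin ltW.
Qed.

(** The path starts at the bin following that of [y], which is already fixed by [y]; the noise of
    the coming step decides the move after it. Each move holds on a set of positive probability,
    where the induction hypothesis makes the integrand positive. *)
Lemma path_density_gt0 k y z : E (y.1, nb y) -> bin_path alpha rho L Dstar k (nb y) ->
  (0 < iter k (markov_op mu (@inert_step _ _ _ _ _ 'cV[R]_n F)) last_step_density (y, z))%E.
Proof.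
have mg := measurable_last_step_density; have g0 := last_step_density_ge0.
have mF' : measurable_fun setT F by exact: measurable_scheme_map.
have mI : measurable_fun setT (@inert_step _ _ _ _ _ 'cV[R]_n F).
  exact: measurable_inert_step.
elim: k y => [y _ yD|k IH y Ey hp].
  by rewrite /last_step_density /= ifT ?lte_fin//; apply/eqP.
have ny0 : 0 < nb y by apply: (bin_gt0 al0 (L_gt0 params) Ey).
have [ov gr] := overflow_granular_gt0 ny0.
set p := iter k _ _ in IH *.
have p0 yz : (0 <= p yz)%E by exact: iter_markov_op_ge0.
have mp : measurable_fun setT p by exact: measurable_iter_markov_op.
have mpy : measurable_fun setT (fun w => p (F (y, w), z)).
  apply: (measurableT_comp mp); apply: measurable_fun_pair => //.
  by apply: (measurableT_comp mF'); exact: measurable_pair1.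
have key (T : set 'cV[R]_n) : measurable T -> (0 < mu T)%E ->
    (forall w, T w -> (0 < p (F (y, w), z))%E) -> (0 < \int[mu]_w p (F (y, w), z))%E.
  move=> mT muT pT; rewrite lt0e integral_ge0// andbT; apply/eqP => int0.
  have : (\int[mu]_w `|p (F (y, w), z)| = 0)%E.
    by rewrite -[RHS]int0; apply: eq_integral => w _; rewrite gee0_abs.
  move/ae_eq_integral_abs => /(_ measurableT mpy) [M [mM M0 TM]].
  have TM' : T `<=` M.
    by move=> w Tw; apply: TM => /= /(_ Logic.I) h; have := pT w Tw; rewrite h ltxx.
  have : (mu T <= 0)%E by rewrite -M0; apply: le_measure; rewrite ?inE.
  by rewrite leNgt muT.
rewrite iterS -/p /markov_op.
have mfy : measurable_fun [set: 'cV[R]_n] (fun w => `|f y + w|).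
  under eq_fun do rewrite addrC.
  exact: (measurableT_comp (@measurable_norm_cV R n) (measurable_translation (f y))).
have nbF w : nb (F (y, w)) = if K%:R / 2 * nb y < `|f y + w| then rho * nb y
    else bin_down alpha L (nb y) by [].
have EF w : E ((F (y, w)).1, nb (F (y, w))) by exact: (next_bin_sizes params).
case: hp => hp.
- apply: (key _ _ ov).
    by apply: measurable_lt_set => //.
  by move=> w /= h; apply: IH => //; rewrite nbF h.
- apply: (key _ _ gr).
    by rewrite -[X in measurable X]setTI; apply: measurable_fun_le.
  by move=> w /= h; apply: IH => //; rewrite nbF ltNge h.
Qed.

End last_step.

Lemma next_bin_le (y : S) : 0 < y.2 -> nb y <= rho * y.2.
Proof.
move=> y0; have ra : alpha <= rho by rewrite (le_trans (ltW (alpha_lt1 params)))// ltW.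
rewrite /next_bin; case: ifP => // _; case: ifP => _; first by rewrite ler_wpM2r// ltW.
by rewrite ler_peMl// ltW.
Qed.

Lemma scheme_small_set : exists m dl (nu : probability S R),
  [/\ 0 < dl,
      forall Q s, measurable Q -> C s -> (dl%:E * nu Q <= iter m.+1 Pop (ind Q) s)%E,
      nu (~` E) = 0%E &
      (\int[nu]_x lyapunov_state A K alpha rho L Delta0 x < +oo)%E].
Proof.
have [q q0 hq] := core_set_bounds.
have [r r0 [kap kap0 first_step]] := core_set_first_step.
have rel : exists j k : nat, [/\ (1 <= j)%N, (1 <= k)%N & alpha ^+ j * rho ^+ k = 1].
  by have [j [k [h1 h2 _ h3]]] := alpha_rho_rel params; exists j, k.
have al1 := alpha_lt1 params; have L0 := L_gt0 params; have D0L := Delta0_ge params.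
(* [q] bounds the bins of the core set and [rho * q] those one step later. Paths start at the bin
   after these, whence the bound [rho * r1]. *)
pose r1 := rho * q.
have [Dstar Dstar_bin [DL [k hk]]] := uniform_bin_path al0 al1 rh1 L0 D0L rel (rho * r1).
have /finite_seqP[Fin FinE] := finite_bins al0 al1 rh1 L0 D0L rel r1.
have inFin D : D \in Fin <-> bin_sizes alpha rho L Delta0 D /\ D <= r1.
  have : [set` Fin] D <-> [set D | bin_sizes alpha rho L Delta0 D /\ D <= r1] D by rewrite FinE.
  by [].
have rho0 : 0 < rho by exact: lt_trans rh1.
have mcube : measurable (cube (0 : 'cV[R]_n) r) by exact: measurable_cube.
have cfin : (lebesgue_cV n (cube (0 : 'cV[R]_n) r) < +oo)%E.
  by rewrite lebesgue_cV_cube ?ltW// ltry.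
pose lam : {finite_measure set 'cV[R]_n -> \bar R} := mfrestr mcube cfin.
have [refm [refm_ge refm0]] := @exists_layered_measure _ _ 'cV[R]_n R R lam Dstar Fin.
have mF' : measurable_fun setT F by exact: measurable_scheme_map.
have miota := measurable_with_bin Dstar.
have mg := measurable_last_step_density Dstar.
have g0 := last_step_density_ge0 Dstar.
have gP (Q : set S) (y : S) : measurable Q ->
    (\int[lam]_(z in (fun z => (z, Dstar)) @^-1` Q) last_step_density Dstar (y, z)
      <= Pop (ind Q) y)%E.
  by move=> mQ; exact: last_step_densityP.
have refmC (s : S) (Q : set S) : C s -> measurable Q -> (refm Q < kap%:E)%E ->
    (Pop (ind Q) s <= (2^-1)%:E)%E.
  move=> Cs mQ hQ; apply: first_step => //; apply: le_lt_trans hQ.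
  have Es : bin_sizes alpha rho L Delta0 (nb s).
    by apply: (next_bin_sizes params); have [] := Cs.
  have s0 : 0 < s.2 by have [Es0 _] := Cs; exact: (bin_gt0 al0 L0 Es0).
  apply: (refm_ge Q (nb s)); apply/inFin; split => //.
  apply: le_trans (next_bin_le s0) _; rewrite ler_wpM2l ?(ltW rho0)//.
  by have [] := hq s Cs.
pose G0 : set S := E `&` [set y | y.2 <= r1].
have mG0 : measurable G0.
  apply: measurableI; first exact: measurable_state_space.
  rewrite -[X in measurable X]setTI; apply: measurable_fun_le => //.
have refmG0 : refm (~` G0) = 0%E.
  apply: refm0 => x y /inFin[h1 h2]; apply; split => //.
have p_gt0 (y : S) (z : 'cV[R]_n) : G0 y ->
    (0 < iter k (markov_op mu (@inert_step _ _ _ _ _ 'cV[R]_n F))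
      (last_step_density Dstar) (y, z))%E.
  move=> [Ey yr1]; have Eny : bin_sizes alpha rho L Delta0 (nb y).
    exact: (next_bin_sizes params).
  have y0 : 0 < y.2 by exact: (bin_gt0 al0 L0 Ey).
  apply: path_density_gt0 => //; apply: hk => //.
  by apply: le_trans (next_bin_le y0) _; rewrite ler_wpM2l// ltW.
have lamB : (0 < lam (cube (0 : 'cV[R]_n) r))%E.
  rewrite /lam /= /mfrestr /mrestr setIid lebesgue_cV_cube ?ltW//.
  by rewrite lte_fin exprn_gt0// mulr_gt0.
have [dl [nu [dl0 minor nu_le]]] := small_set_minorization mF' miota mg g0 gP kap0
  (refm := refm) refmC mG0 refmG0 p_gt0 mcube lamB.
(* The minorization has [k.+2] steps, written [m.+1] with [m = k.+1]. *)
exists k.+1, dl, nu; split => //.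
- have mEc : measurable (~` E) by apply: measurableC; exact: measurable_state_space.
  apply/eqP; rewrite eq_le measure_ge0 andbT.
  rewrite -[X in nu X]setIT -integral_indic//.
  apply: nu_le => //; first exact: measurable_eindic.
  by move=> z _ /=; rewrite indicE memNset//=; exact.
- pose Y := 2 * r / K%:R + Dstar.
  have Ds0 : 0 < Dstar by exact: (bin_gt0 al0 L0 Dstar_bin).
  apply: le_lt_trans (ltry (bin_weight alpha * ln (Y / (alpha * L)) +
    (overflow_base alpha rho +
     overflow_slope (opnorm A) alpha rho * ln (Y / (alpha * L))))).
  apply: nu_le; first exact: measurable_lyapunov_state.
    exact: lyapunov_state_ge0 params.
  move=> x hx; rewrite /lyapunov_state mem_set// lee_fin.
  have xr : `|x| <= r.
    apply/le_norm_cV; first exact: ltW.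
    by move=> i; have := hx i; rewrite mxE subr0.
  have Kr : 0 <= 2 * r / K%:R by rewrite divr_ge0 ?(ltW K0)// mulr_ge0// ltW.
  apply: lyapunov_le => //.
  + exact: (rho_gt_norm params).
  + by have [] := Dstar_bin.
  + by rewrite lerDr.
  + rewrite /scaled_norm /= (@le_trans _ _ (2 * r / K%:R))//.
      by rewrite ler_wpM2r ?invr_ge0 ?(ltW K0)// ler_wpM2l.
    by rewrite lerDl ltW.
Qed.

End scheme_small_set.

(** From [|x| <= 1 + |x| ^ p] for [p >= 1]: the logarithmic Lyapunov function asks only for the
    first moment. *)
Lemma first_moment_finite (R : realType) n d (T : measurableType d) (P : probability T R)
    (X : {RV P >-> 'cV[R]_n}) (p : R) : 1 <= p ->
  ('E_P[fun omega => (`|X omega| `^ p)%R] < +oo)%E ->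
  exists2 m1, 0 <= m1 & (\int[distribution P X]_x (`|x|)%:E <= m1%:E)%E.
Proof.
move=> p1; rewrite unlock => fin.
set I := (\int[P]_w _)%E in fin *.
have I0 : (0 <= I)%E by apply: integral_ge0 => w _; rewrite lee_fin powR_ge0.
have Ifin : I \is a fin_num by rewrite ge0_fin_numE.
exists (1 + fine I); first by rewrite addr_ge0// fine_ge0.
have mn : measurable_fun [set: 'cV[R]_n] (fun x => `|x|) by exact: measurable_norm_cV.
have mX : measurable_fun setT (fun omega => `|X omega|).
  by apply: (measurableT_comp mn).
rewrite ge0_integral_distribution//; last by apply/measurable_EFinP.
rewrite EFinD (fineK Ifin) /I.
have -> : (1%:E = \int[P]_w cst 1%:E w :> \bar R)%E.
  by rewrite integral_cst// [X in (_ * X)%E](probability_setT P) mule1.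
have mXp : measurable_fun setT (fun omega => (`|X omega| `^ p)%:E).
  apply/measurable_EFinP.
  exact: (measurableT_comp (@measurable_powR R p) mX).
rewrite -ge0_integralD//.
have mXe : measurable_fun setT ((fun y : 'cV[R]_n => (`|y|)%:E) \o X).
  exact/measurable_EFinP.
apply: ge0_le_integral => //.
- by move=> x _; rewrite lee_fin.
- exact: emeasurable_funD.
- move=> w _ /=; rewrite -EFinD lee_fin.
  have [X1|X1] := leP 1 `|X w|; last by rewrite (le_trans (ltW X1))// lerDl powR_ge0.
  by rewrite (le_trans (le1r_powR X1 p1))// lerDr.
Qed.

Theorem mainTheorem3 (R : realType) (n : nat) (n_gt0 : (0 < n)%N)
  (A B : 'M[R]_n) (A_jordan : unstable_jordan_block A) (B_unit : B \in unitmx)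
  (beta eps : R) (beta_gt2 : 2 < beta) (eps_gt0 : 0 < eps)
  (eps_lt : eps < beta - 2)
  (d : measure_display) (T : measurableType d) (P : probability T R)
  (w : nat -> {RV P >-> 'cV[R]_n}) (x0 : {RV P >-> 'cV[R]_n})
  (w_indep : mutually_independent P w)
  (w_ident : identically_distributed P w)
  (w_mean0 : forall i : 'I_n, ('E_P[fun omega => (w 0%N omega i 0)%R] = 0)%E)
  (eta : 'cV[R]_n -> R) (eta_measurable : measurable_fun setT eta)
  (eta_gt0 : forall x, 0 < eta x)
  (w_density : forall D : set 'cV[R]_n, measurable D ->
     P (w 0%N @^-1` D) = (\int[lebesgue_cV n]_(x in D) (eta x)%:E)%E)
  (w_moment : ('E_P[fun omega => (`|w 0%N omega| `^ beta)%R] < +oo)%E)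
  (x0_indep : independent_of_sequence P x0 w)
  (x0_moment : ('E_P[fun omega => (`|x0 omega| `^ beta)%R] < +oo)%E)
  (K : nat) (alpha rho L Delta0 : R)
  (params : scheme_parameters A beta eps K alpha rho L Delta0) :
  forall N : nat, ~~ odd N -> (2 <= N)%N ->
  let E := state_space alpha rho L Delta0 in
  let chain := scheme_chain A B beta eps K alpha rho L w N in
  positive_harris_recurrent P E chain /\
  unique_invariant_probability P E chain.
Proof.
move=> N N_even N_ge2 E chain.
have beta1 : 1 <= beta by rewrite ltW// (lt_trans _ beta_gt2)// ltr1n.
have [m1 m1_ge0 mu_moment] := first_moment_finite beta1 w_moment.
pose mu : probability 'cV[R]_n R := distribution P (w 0%N).
have mu_density D : measurable D ->
    mu D = (\int[lebesgue_cV n]_(x in D) (eta x)%:E)%E by exact: w_density.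
have [m [dl [nu [dl0 minor nuE nuV]]]] := scheme_small_set n_gt0 B_unit params
  N_ge2 m1_ge0 mu_moment eta_measurable eta_gt0 mu_density.
have mF : measurable_fun setT (scheme_map A B beta eps K alpha rho L N).
  exact: measurable_scheme_map.
have V_pinfty : [set x | lyapunov_state A K alpha rho L Delta0 x = +oo%E] = ~` E.
  apply/seteqP; split => s /=; rewrite /lyapunov_state.
    by move=> + Es; rewrite mem_set.
  by move=> nEs; rewrite memNset.
have X0 s omega : chain s 0%N omega = s by [].
have XS s t omega : chain s t.+1 omega =
    scheme_map A B beta eps K alpha rho L N (chain s t omega, w t omega) by [].
exact: (foster_lyapunov w_indep w_ident mF X0 XS
  (measurable_state_space alpha rho L Delta0)
  (measurable_core_set A beta eps K alpha rho L Delta0 N m1)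
  (scheme_map_state_space B params N)
  (measurable_lyapunov_state A K alpha rho L Delta0)
  (lyapunov_state_ge0 params) V_pinfty (drift_bound_ge0 params N_even N_ge2 m1_ge0)
  (lyapunov_state_drift B_unit params N_even N_ge2 m1_ge0 mu_moment)
  dl0 minor nuE nuV).
Qed.
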